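(* Let $(\mathcal A,\mathcal A_* )$ be a unital dual Banach algebra. Then $\mathcal A$ is Connes-amenable if and only if $\mathcal A$ is injective.
   Context: Banach algebras have contractive product, and a unit has norm one. A dual Banach algebra $(\mathcal A,\mathcal A_* )$ is a Banach algebra $\mathcal A$ together with a Banach space $\mathcal A_*$ such that $\mathcal A=(\mathcal A_* )'$ as a Banach space and the multiplication is separately $\sigma(\mathcal A,\mathcal A_* )$-continuous; ''weak$^*$'' on $\mathcal A$ refers to $\sigma(\mathcal A,\mathcal A_* )$. For a Banach $\mathcal A$-bimodule $F$, the dual $F'$ is an $\mathcal A$-bimodule via $\langle a\cdot\mu,x\rangle=\langle\mu,x\cdot a\rangle$, $\langle\mu\cdot a,x\rangle=\langle\mu,a\cdot x\rangle$; the dual bimodule $F'$ is normal if for each $\mu\in F'$ the maps $\mathcal A\to F'$, $a\mapsto a\cdot\mu$ and $a\mapsto\mu\cdot a$, are weak$^*$-weak$^*$-continuous. A derivation $d:\mathcal A\to F'$ is a bounded linear map with $d(ab)=a\cdot d(b)+d(a)\cdot b$; it is inner if there is $\mu\in F'$ with $d(a)=a\cdot\mu-\mu\cdot a$ for all $a$. $(\mathcal A,\mathcal A_* )$ is Connes-amenable if every weak$^*$-continuous derivation from $\mathcal A$ to a normal dual $\mathcal A$-bimodule is inner. For a subset $\mathcal C\subseteq\mathcal B(E)$, its commutant is $\mathcal C^c=\{T\in\mathcal B(E):TS=ST\ (S\in\mathcal C)\}$. For a subalgebra $\mathcal C\subseteq\mathcal B(E)$, a quasi-expectation for $\mathcal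 C$ is a bounded linear projection $\mathcal Q:\mathcal B(E)\to\mathcal C^c$ onto $\mathcal C^c$ with $\mathcal Q(cTd)=c\,\mathcal Q(T)\,d$ for $c,d\in\mathcal C^c$, $T\in\mathcal B(E)$. For reflexive $E$, the weak$^*$-topology on $\mathcal B(E)$ is that given by the predual $E'\widehat\otimes E$ (projective tensor product), $\langle T,\mu\otimes x\rangle=\langle\mu,T(x)\rangle$. $(\mathcal A,\mathcal A_* )$ is injective if whenever $E$ is a reflexive Banach space and $\pi:\mathcal A\to\mathcal B(E)$ is a weak$^*$-continuous unital representation (algebra homomorphism), there is a quasi-expectation $\mathcal Q:\mathcal B(E)\to\pi(\mathcal A)^c$. *)

(* Defs.v *)
From HB Require Import structures.
From mathcomp Require Import all_boot all_order all_algebra.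
From mathcomp Require Import all_classical reals topology normedtype sequences.
From mathcomp Require Import complex.

Set Implicit Arguments.
Unset Strict Implicit.
Unset Printing Implicit Defensive.

Import Order.TTheory GRing.Theory Num.Theory.
Import numFieldNormedType.Exports.

Local Open Scope classical_set_scope.
Local Open Scope ring_scope.
Local Open Scope complex_scope.

(* Norms on a [normedModType R[i]] are [R[i]]-valued; [rnorm x] is the same
   number as an element of [R], where suprema and infima are available. *)
Definition rnorm (R : realType) (E : normedModType R[i]) (x : E) : R :=
  complex.Re `|x|.

Section rnorm_theory.
Variables (R : realType) (E : normedModType R[i]).
Implicit Types x y : E.

Lemma rnormE x : `|x| = (rnorm x)%:C.
Proof.
rewrite /rnorm; have := normr_ge0 x; case: `|x| => a b.
by rewrite lecE /= => /andP[/eqP -> _].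
Qed.

Lemma rnorm_ge0 x : 0 <= rnorm x.
Proof. by rewrite -lecR -rnormE normr_ge0. Qed.

Lemma ler_rnormD x y : rnorm (x + y) <= rnorm x + rnorm y.
Proof. by rewrite -lecR rmorphD /= -!rnormE ler_normD. Qed.

Lemma rnorm0_eq0 x : rnorm x = 0 -> x = 0.
Proof. by move=> x0; apply/eqP; rewrite -normr_eq0 rnormE x0. Qed.

Lemma rnorm0 : rnorm (0 : E) = 0.
Proof. by rewrite /rnorm normr0. Qed.

End rnorm_theory.

Lemma rnormZ (R : realType) (E : normedModType R[i]) (l : R[i]) (x : E) :
  rnorm (l *: x) = rnorm (l : R[i]^o) * rnorm x.
Proof.
apply: complexI; rewrite rmorphM /= -!rnormE.
by rewrite normrZ.
Qed.

Section bounded_linear_maps.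
Variables (R : realType) (E F : normedModType R[i]).
Implicit Types f g : E -> F.

Definition bounded_linear : {pred E -> F} := fun f =>
  `[< linear f /\ exists M : R, forall x, rnorm (f x) <= M * rnorm x >].

Lemma bounded_linear_submod_closed : submod_closed bounded_linear.
Proof.
split=> [|c f g /asboolP[lf [M fM]] /asboolP[lg [N gN]]]; apply/asboolP.
  have E0 x : (0 : E -> F) x = 0 by [].
  split=> [a x y|]; first by rewrite !E0 scaler0 addr0.
  by exists 0 => x; rewrite E0 rnorm0 mul0r.
have fgE x : (c *: f + g) x = c *: f x + g x by [].
split=> [a x y|].
  rewrite !fgE lf lg !scalerDr !scalerA (mulrC c) -!addrA; congr (_ + _).
  by rewrite addrCA.
exists (rnorm (c : R[i]^o) * M + N) => x; rewrite fgE.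
apply: le_trans (ler_rnormD _ _) _; rewrite rnormZ mulrDl -mulrA lerD//.
by rewrite ler_wpM2l// rnorm_ge0.
Qed.

HB.instance Definition _ :=
  GRing.isSubmodClosed.Build _ _ bounded_linear bounded_linear_submod_closed.

(* [blin E F] is the normed space B(E, F), with the operator norm. *)
Record blin := Blin { blin_fun :> E -> F; _ : blin_fun \in bounded_linear }.

HB.instance Definition _ := [isSub for blin_fun].
HB.instance Definition _ := [Choice of blin by <:].
HB.instance Definition _ := [SubChoice_isSubLmodule of blin by <:].

Implicit Types T : blin.

Lemma blinP T T' : (forall x, T x = T' x) -> T = T'.
Proof. by move=> TT'; apply/val_inj/funext. Qed.

Lemma blin_linear T : linear T.
Proof. by case: T => f /= /asboolP[]. Qed.

HB.instance Definition _ T := GRing.isLinear.Build _ _ _ _ _ (blin_linear T).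

Lemma blin_bounded T : exists M : R, forall x, rnorm (T x) <= M * rnorm x.
Proof. by case: T => f /= /asboolP[]. Qed.

Definition opnorm T : R := sup [set rnorm (T x) | x in [set x | rnorm x <= 1]].

Lemma opnorm_has_sup T :
  has_sup [set rnorm (T x) | x in [set x | rnorm x <= 1]].
Proof.
split; first by exists (rnorm (T 0)), 0 => //=; rewrite rnorm0.
have [M TM] := blin_bounded T; exists `|M| => _ [x /= x1 <-].
apply: le_trans (TM x) _; apply: le_trans (ler_wpM2r (rnorm_ge0 x) (ler_norm M)) _.
by rewrite ler_piMr.
Qed.

Lemma opnorm_ub T x : rnorm x <= 1 -> rnorm (T x) <= opnorm T.
Proof. by move=> x1; apply: sup_upper_bound (opnorm_has_sup T) _ _; exists x. Qed.

Lemma opnorm_ge0 T : 0 <= opnorm T.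
Proof.
by apply: (le_trans (rnorm_ge0 (T 0))); apply: opnorm_ub; rewrite rnorm0.
Qed.

Lemma opnorm_le T (M : R) :
  (forall x, rnorm x <= 1 -> rnorm (T x) <= M) -> opnorm T <= M.
Proof.
move=> TM; apply: ge_sup; first by case: (opnorm_has_sup T).
by move=> _ [x /= x1 <-]; exact: TM.
Qed.

Lemma ler_opnorm T x : rnorm (T x) <= opnorm T * rnorm x.
Proof.
have [->|x0] := eqVneq x 0; first by rewrite linear0 !rnorm0 mulr0.
have rx0 : rnorm x != 0 by apply: contra_neq x0 => /rnorm0_eq0.
have rx : 0 < rnorm x by rewrite lt_neqAle eq_sym rx0 rnorm_ge0.
have cx : rnorm (((rnorm x)^-1)%:C : R[i]^o) = (rnorm x)^-1.
  by apply: complexI; rewrite -rnormE ger0_norm// lecR invr_ge0 ltW.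
have := @opnorm_ub T (((rnorm x)^-1)%:C *: x).
rewrite linearZ !rnormZ cx mulVf// lexx => /(_ isT).
by rewrite mulrC ler_pdivrMr.
Qed.

Lemma opnormZ (l : R[i]) T : opnorm (l *: T) = rnorm (l : R[i]^o) * opnorm T.
Proof.
have le m S : opnorm (m *: S) <= rnorm (m : R[i]^o) * opnorm S.
  apply: opnorm_le => x x1; rewrite [X in rnorm X](_ : _ = m *: S x)// rnormZ.
  by rewrite ler_wpM2l ?rnorm_ge0// opnorm_ub.
have [->|l0] := eqVneq l 0.
  apply/eqP; rewrite eq_le le /= rnorm0 mul0r; exact: opnorm_ge0.
have rl0 : rnorm (l : R[i]^o) != 0 by apply: contra_neq l0 => /rnorm0_eq0.
have rl : 0 < rnorm (l : R[i]^o) by rewrite lt_neqAle eq_sym rl0 rnorm_ge0.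
apply/eqP; rewrite eq_le le /= -ler_pdivlMl//.
have {1}-> : T = l^-1 *: (l *: T) by rewrite scalerA mulVf// scale1r.
apply: le_trans (le _ _) _; rewrite le_eqVlt; apply/orP; left; apply/eqP.
congr (_ * _); apply: complexI; rewrite -rnormE fmorphV /= -rnormE.
by rewrite normfV.
Qed.

Definition blin_norm T : R[i] := (opnorm T)%:C.

Lemma ler_blin_normD T T' : blin_norm (T + T') <= blin_norm T + blin_norm T'.
Proof.
rewrite /blin_norm -rmorphD lecR; apply: opnorm_le => x x1.
rewrite [X in rnorm X](_ : _ = T x + T' x)//.
by apply: le_trans (ler_rnormD _ _) _; rewrite lerD ?opnorm_ub.
Qed.

Lemma blin_normZ (l : R[i]) T : blin_norm (l *: T) = `|l| * blin_norm T.
Proof.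
by rewrite /blin_norm opnormZ rmorphM; congr (_ * _); exact/esym/rnormE.
Qed.

Lemma blin_norm0_eq0 T : blin_norm T = 0 -> T = 0.
Proof.
move=> /complexI T0; apply: blinP => x; apply: rnorm0_eq0.
by apply/eqP; rewrite eq_le rnorm_ge0 andbT -(mul0r (rnorm x)) -T0 ler_opnorm.
Qed.

HB.instance Definition _ := Lmodule_isNormed.Build R[i] blin
  ler_blin_normD blin_normZ blin_norm0_eq0.

End bounded_linear_maps.

Section composition.
Variables (R : realType) (E F G : normedModType R[i]).
Variables (S : blin F G) (T : blin E F).

Lemma blin_comp_subproof : (S \o T) \in bounded_linear (F := G).
Proof.
apply/asboolP; split=> [a x y|]; first by rewrite /= !linearP.
exists (opnorm S * opnorm T) => x /=; apply: le_trans (ler_opnorm _ _) _.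
by rewrite -mulrA ler_wpM2l ?opnorm_ge0// ler_opnorm.
Qed.

Definition blin_comp : blin E G := Blin blin_comp_subproof.

End composition.
Infix "\oB" := blin_comp (at level 50, left associativity) : ring_scope.

Section identity.
Variables (R : realType) (E : normedModType R[i]).

Lemma blin_id_subproof : @idfun E \in bounded_linear (E := E) (F := E).
Proof. by apply/asboolP; split=> //; exists 1 => x; rewrite mul1r. Qed.

Definition blin_id : blin E E := Blin blin_id_subproof.

End identity.

Definition dual (R : realType) (E : normedModType R[i]) := blin E R[i]^o.
HB.instance Definition _ (R : realType) (E : normedModType R[i]) :=
  NormedModule.on (dual E).

(* The elements of [X] act on [S] as functionals through [J : S -> X -> C]; the
   weak* topology sigma(S, X) is the initial topology for [J] with values in the
   space of functions [X -> C] with pointwise convergence. *)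
Definition wstar_continuous (R : realType) (S1 S2 : choiceType) (X1 X2 : Type)
    (J1 : S1 -> X1 -> R[i]^o) (J2 : S2 -> X2 -> R[i]^o) (f : S1 -> S2) : Prop :=
  continuous (f : initial_topology (J1 : S1 -> {ptws X1 -> R[i]^o}) ->
                  initial_topology (J2 : S2 -> {ptws X2 -> R[i]^o})).

Definition dual_pairing (R : realType) (E : normedModType R[i]) :
  dual E -> E -> R[i]^o := fun mu x => mu x.

Definition reflexive_space (R : realType) (E : normedModType R[i]) : Prop :=
  forall Phi : dual (dual E), exists x : E, forall mu : dual E, Phi mu = mu x.

(* The algebraic tensor product of E and F is represented by finite formal sums
   of elementary tensors, identified when all bilinear forms agree on them; the
   projective norm is the infimum of sum |x_i| |y_i| over all representations;
   the points of the completion are given by the Cauchy sequences for that norm.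
   Sequences are not quotiented by the relation "the difference tends to 0": the
   completion only serves to index functionals on B(E), and equivalent sequences
   define the same functional. *)
Section projective_tensor_product.
Variables (R : realType) (E F : normedModType R[i]).
Implicit Types (B : E -> F -> R[i]^o) (u v : seq (E * F)).

Definition bilinear_form B : Prop :=
  (forall x, linear (B x)) /\ (forall y, linear (B ^~ y)).

Definition tensor_eval B u : R[i]^o := \sum_(p <- u) B p.1 p.2.

Definition tensor_eq u v : Prop :=
  forall B, bilinear_form B -> tensor_eval B u = tensor_eval B v.

Definition tensor_sub u v : seq (E * F) := u ++ [seq (- p.1, p.2) | p <- v].

Definition proj_norm u : R :=
  inf [set \sum_(p <- v) rnorm p.1 * rnorm p.2 | v in tensor_eq u].

Record proj_tensor := ProjTensor {
  proj_tensor_seq :> nat -> seq (E * F);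
  proj_tensor_cauchy : forall e : R, 0 < e -> exists N : nat, forall m n : nat,
    (N <= m)%N -> (N <= n)%N ->
    proj_norm (tensor_sub (proj_tensor_seq m) (proj_tensor_seq n)) < e }.

End projective_tensor_product.

Section tensor_theory.
Variables (R : realType) (E F : normedModType R[i]).
Implicit Types (B : E -> F -> R[i]^o) (u v : seq (E * F)).

Lemma ler_tensor_eval B u (K : R) : 0 <= K ->
  (forall x y, rnorm (B x y) <= K * (rnorm x * rnorm y)) ->
  rnorm (tensor_eval B u) <= K * \sum_(p <- u) rnorm p.1 * rnorm p.2.
Proof.
move=> K0 BK; rewrite /tensor_eval; elim: u => [|p u IH].
  by rewrite !big_nil rnorm0 mulr0.
rewrite !big_cons mulrDr; apply: le_trans (ler_rnormD _ _) _.
by apply: lerD.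
Qed.

Lemma ler_proj_norm B u (K : R) : bilinear_form B -> 0 <= K ->
  (forall x y, rnorm (B x y) <= K * (rnorm x * rnorm y)) ->
  rnorm (tensor_eval B u) <= K * proj_norm u.
Proof.
move=> Bl K0 BK; have [K00|K00] := eqVneq K 0.
  by apply: le_trans (ler_tensor_eval u K0 BK) _; rewrite K00 !mul0r.
have Kp : 0 < K by rewrite lt_neqAle eq_sym K00.
rewrite -ler_pdivrMl//; apply: lb_le_inf.
  by exists (\sum_(p <- u) rnorm p.1 * rnorm p.2), u.
move=> _ [v uv <-]; rewrite ler_pdivrMl// (uv B Bl).
exact: ler_tensor_eval.
Qed.

Lemma tensor_eval_sub B u v : bilinear_form B ->
  tensor_eval B (tensor_sub u v) = tensor_eval B u - tensor_eval B v.
Proof.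
move=> [_ Bl]; rewrite /tensor_eval /tensor_sub big_cat/= big_map/=.
congr (_ + _); rewrite -sumrN; apply: eq_bigr => p _ /=.
have := Bl p.2 (-1) p.1 0; rewrite scaleN1r addr0 => ->.
have := Bl p.2 (-1) 0 0; rewrite scaler0 add0r scaleN1r addNr => ->.
by rewrite addr0 scaleN1r.
Qed.

End tensor_theory.

Lemma rnormE_sqrt (R : realType) (z : R[i]^o) :
  rnorm z = Num.sqrt (complex.Re z ^+ 2 + complex.Im z ^+ 2).
Proof. by case: z. Qed.

Lemma complex_cauchy_cvg (R : realType) (z : nat -> R[i]^o) :
  (forall e : R, 0 < e -> exists N, forall m n, (N <= m)%N -> (N <= n)%N ->
     rnorm (z m - z n) < e) -> cvgn z.
Proof.
move=> zC.
have key (h : R[i] -> R) : (forall a b, h (a - b) = h a - h b) ->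
    (forall a, `|h a| <= rnorm (a : R[i]^o)) ->
    cvgn (fun n => h (z n)).
  move=> hB hle; apply: cauchy_cvg; apply: cauchy_exP => e e0.
  have [N NP] := zC _ e0; exists (h (z N)); exists N => // n /= Nn.
  rewrite -ball_normE /ball_/= -hB.
  by apply: le_lt_trans (hle _) _; apply: NP.
have /cvg_ex[a Ha] : cvgn (fun n => complex.Re (z n)).
  apply: (key (@complex.Re R)) => [[? ?] [? ?]//|w].
  rewrite rnormE_sqrt -sqrtr_sqr ler_wsqrtr// lerDl; exact: sqr_ge0.
have /cvg_ex[b Hb] : cvgn (fun n => complex.Im (z n)).
  apply: (key (@complex.Im R)) => [[? ?] [? ?]//|w].
  rewrite rnormE_sqrt -sqrtr_sqr ler_wsqrtr// lerDr; exact: sqr_ge0.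
apply/cvg_ex; exists (a +i* b : R[i]^o).
apply/cvgrPdist_lt => e.
case: e => e1 e2; rewrite ltcE /= => /andP[/eqP-> e0].
have e20 : 0 < e1 / 2 by rewrite divr_gt0.
near=> n; rewrite rnormE ltcR.
have -> : (a +i* b : R[i]^o) - z n = ((a - complex.Re (z n)) +i* (b - complex.Im (z n))).
  by case: (z n).
apply: (@le_lt_trans _ _ (`|a - complex.Re (z n)| + `|b - complex.Im (z n)|)).
  rewrite rnormE_sqrt /=; move: (a - _) (b - _) => x y.
  have xy0 : 0 <= `|x| + `|y| by rewrite addr_ge0.
  rewrite -[leRHS](ger0_norm xy0) -[leRHS]sqrtr_sqr ler_wsqrtr//.
  rewrite [leRHS]sqrrD !real_normK ?num_real// lerD2r lerDl mulrn_wge0//.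
  by rewrite mulr_ge0.
rewrite (splitr e1) ltrD//.
  by near: n; have /cvgrPdist_lt/(_ _ e20) := Ha.
by near: n; have /cvgrPdist_lt/(_ _ e20) := Hb.
Unshelve. all: by end_near. Qed.

(* The duality <T, mu (x) x> = mu (T x), extended by continuity from the algebraic
   tensor product to its completion. *)
Definition operator_pairing (R : realType) (E : normedModType R[i])
    (T : blin E E) (u : proj_tensor (dual E) E) : R[i]^o :=
  lim ((fun n => tensor_eval (fun (mu : dual E) (x : E) => mu (T x)) (u n))
         @ \oo).

Lemma operator_pairing_cvg (R : realType) (E : normedModType R[i])
    (T : blin E E) (u : proj_tensor (dual E) E) :
  cvgn (fun n => tensor_eval (fun (mu : dual E) (x : E) => mu (T x)) (u n)).
Proof.
have Bl : bilinear_form (fun (mu : dual E) (x : E) => mu (T x) : R[i]^o).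
  by split=> [mu a x y|x a mu nu]; rewrite ?linearP.
have T0 : 0 < opnorm T + 1 by rewrite ltr_wpDl// opnorm_ge0.
have TB (mu : dual E) x :
    rnorm (mu (T x)) <= (opnorm T + 1) * (rnorm mu * rnorm x).
  apply: le_trans (ler_opnorm _ _) _.
  rewrite mulrCA ler_wpM2l ?opnorm_ge0//; apply: le_trans (ler_opnorm _ _) _.
  by rewrite ler_wpM2r ?rnorm_ge0// lerDl.
apply: complex_cauchy_cvg => e e0.
have [N NP] := proj_tensor_cauchy u (divr_gt0 e0 T0).
exists N => m n Nm Nn; rewrite -tensor_eval_sub//.
apply: le_lt_trans (ler_proj_norm _ Bl (ltW T0) TB) _.
by rewrite mulrC -ltr_pdivlMr// NP.
Qed.

Record banachAlg (R : realType) := BanachAlg {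
  balg_space :> completeNormedModType R[i];
  bmul : balg_space -> balg_space -> balg_space;
  bmul_linearr : forall a, linear (bmul a);
  bmul_linearl : forall b, linear (bmul ^~ b);
  bmulA : associative bmul;
  ler_bnormM : forall a b, `|bmul a b| <= `|a| * `|b| }.
Infix "*b" := bmul (at level 40, left associativity) : ring_scope.

(* No unit is assumed in [banachAlg]; a unit is required to have norm one. *)
Definition is_unit (R : realType) (A : banachAlg R) (e : A) : Prop :=
  [/\ left_id e (@bmul R A), right_id e (@bmul R A) & `|e| = 1].

Record dualBanachAlg (R : realType) := DualBanachAlg {
  dba_alg :> banachAlg R;
  predual : completeNormedModType R[i];
  predual_map : dba_alg -> dual predual;
  predual_map_linear : linear predual_map;
  predual_map_isometry : forall a, `|predual_map a| = `|a|;
  predual_map_surjective : forall f, exists a, predual_map a = f;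
  bmul_wstar_continuousr : forall a : dba_alg,
    wstar_continuous predual_map predual_map (fun b => a *b b);
  bmul_wstar_continuousl : forall b : dba_alg,
    wstar_continuous predual_map predual_map (fun a => a *b b) }.
Arguments predual_map {R A} : rename.

(* The two actions are jointly bounded bilinear maps, presented in curried form:
   [lact a x] is a . x and [ract a x] is x . a.  When A has a unit, it need not
   act as the identity. *)
Record banachBimodule (R : realType) (A : banachAlg R) :=
  BanachBimodule {
    bimod_space :> completeNormedModType R[i];
    lact : blin A (blin bimod_space bimod_space);
    ract : blin A (blin bimod_space bimod_space);
    lactM : forall a b x, lact (a *b b) x = lact a (lact b x);
    ractM : forall a b x, ract (a *b b) x = ract b (ract a x);
    lractA : forall a b x, ract b (lact a x) = lact a (ract b x) }.

Section dual_bimodule.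
Variables (R : realType) (A : banachAlg R) (F : banachBimodule A).

(* <a . mu, x> = <mu, x . a> and <mu . a, x> = <mu, a . x>. *)
Definition dual_lact (a : A) (mu : dual F) : dual F := mu \oB ract F a.
Definition dual_ract (mu : dual F) (a : A) : dual F := mu \oB lact F a.

Definition is_derivation (d : blin A (dual F)) : Prop :=
  forall a b, d (a *b b) = dual_lact a (d b) + dual_ract (d a) b.

Definition is_inner (d : blin A (dual F)) : Prop :=
  exists mu : dual F, forall a, d a = dual_lact a mu - dual_ract mu a.

End dual_bimodule.

Definition normal_dual (R : realType) (A : dualBanachAlg R)
    (F : banachBimodule A) : Prop :=
  forall mu : dual F,
    wstar_continuous predual_map (@dual_pairing R F) (fun a => dual_lact a mu) /\
    wstar_continuous predual_map (@dual_pairing R F) (fun a => dual_ract mu a).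

Definition connes_amenable (R : realType) (A : dualBanachAlg R) : Prop :=
  forall F : banachBimodule A, normal_dual F ->
  forall d : blin A (dual F), is_derivation d ->
    wstar_continuous predual_map (@dual_pairing R F) d ->
    is_inner d.

Section quasi_expectation.
Variables (R : realType) (E : normedModType R[i]).

Definition commutant (C : set (blin E E)) : set (blin E E) :=
  [set T | forall S, C S -> T \oB S = S \oB T].

Definition quasi_expectation (C : set (blin E E))
    (Q : blin (blin E E) (blin E E)) : Prop :=
  [/\ range Q = commutant C,
      forall T, Q (Q T) = Q T &
      forall c d T, commutant C c -> commutant C d ->
        Q (c \oB T \oB d) = c \oB Q T \oB d].

End quasi_expectation.

Definition unital_representation (R : realType) (A : banachAlg R)
    (e : A) (E : normedModType R[i]) (pi : A -> blin E E) : Prop :=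
  [/\ linear pi, forall a b, pi (a *b b) = pi a \oB pi b & pi e = blin_id E].

Definition injective_dba (R : realType) (A : dualBanachAlg R) (e : A) : Prop :=
  forall E : completeNormedModType R[i], reflexive_space E ->
  forall pi : A -> blin E E, unital_representation e pi ->
    wstar_continuous predual_map (@operator_pairing R E) pi ->
    exists Q, quasi_expectation (range pi) Q.

(* Main.v *)
From HB Require Import structures.
Require Import Defs.
From mathcomp Require Import all_boot all_order all_algebra.
From mathcomp Require Import all_classical reals topology normedtype sequences.
From mathcomp Require Import prodnormedzmodule complex ring lra.

Set Implicit Arguments.
Unset Strict Implicit.
Unset Printing Implicit Defensive.

Import Order.TTheory GRing.Theory Num.Theory.
Import numFieldNormedType.Exports.

Local Open Scope classical_set_scope.
Local Open Scope ring_scope.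
Local Open Scope complex_scope.

(** Connes-amenability gives injectivity. Let K be the commutant of pi(A), and M the
    space of operators Q on B(E) that are K-bimodule maps and vanish on K. With the
    actions (a . Q)(T) = pi(a) Q(T) and (Q . a)(T) = Q(T) pi(a), the derivation
    a |-> a . id - id . a takes its values in M, although id is not in M. As E is
    reflexive, M is the dual of the closed span of the functionals Q |-> <mu, Q(T) x>
    in M', and M is normal because pi is weak* continuous. So some q in M implements
    the derivation, and id - q is a quasi-expectation
    (connes_amenable_expectation).

    Injectivity gives Connes-amenability. For a weak* continuous derivation d into F',
    with d(e) = 0 after subtraction of an inner one, twist the left action of A on
    G = A_* + F:

      a . (f, x) = (a . f + <. d(a), x>, a . x).

    The projection p of G onto A_* fails to be a module map exactly by d. If q were a
    module map from G to A_* that is the identity on A_* and commutes with the right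
    translations, then x |-> <e, q(0, x)> would implement d. Such a q should be the
    value of a quasi-expectation at p, but G is not reflexive, and quasi-expectations
    are available on reflexive spaces only. Normality of F' makes the orbits
    {a . (0, x) : |a| <= 1} relatively weakly compact, and likewise the sets of all
    <. nu, x> with |nu| <= 1 (orbits_compact). The interpolation construction of Davis,
    Figiel, Johnson and Pelczynski factors a weakly compact set W through a reflexive
    space: the gauges of 2^n W + 2^-n B, for B the unit ball, are summed in the l2
    sense. Here the l2 sum is taken at once over n and over all finite unions of such
    sets. The resulting space is reflexive (interp_reflexive): a functional on it is
    nearly a finite combination of coordinates (hs_dual_approx), and a bidual element
    has coordinates in G by weak compactness (bidual_point). A acts on it coordinatewise
    and weak* continuously, so there is one quasi-expectation Q for all vectors x.
    Inclusions between the sets, as well as right translations, act between the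
    coordinates and commute with A. By the bimodule property of Q they are compatible
    with the average Q(p) (expectation_square). That gives linearity in x, a bound
    uniform in x, and the identity implementing d (mean_fun_derivation).

    The functional analysis behind this starts from hahn_banach and
    uniform_boundedness. Weak* continuity is used in the form that a linear functional
    on A is weak* continuous if and only if it is the pairing with an element of the
    predual (wstar_normal). Weak compactness of a set S is used in the dual form that
    each functional on G' dominated by the support function of S is evaluation at an
    element of G; images of dual balls have it by weakly_compact_hull_ball. *)

(** * The Hahn-Banach theorem *)

Section complex_modulus.
Variable R : realType.
Implicit Types z w : R[i]^o.

Lemma rnormM z w : rnorm (z * w : R[i]^o) = rnorm z * rnorm w.
Proof. exact: (@rnormZ R (R[i]^o) z w). Qed.

Lemma rnormC (r : R) : rnorm (r%:C : R[i]^o) = `|r|.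
Proof. by rewrite rnormE_sqrt /= expr0n addr0 sqrtr_sqr. Qed.

Lemma rnorm1 : rnorm (1 : R[i]^o) = 1.
Proof. by rewrite /rnorm normr1. Qed.

Lemma rnorm_Re z : complex.Re z <= rnorm z.
Proof.
apply: le_trans (ler_norm _) _.
rewrite rnormE_sqrt -sqrtr_sqr ler_wsqrtr// lerDl; exact: sqr_ge0.
Qed.

Lemma rnorm_rot z :
  exists c : R[i], rnorm (c : R[i]^o) = 1 /\ c * z = (rnorm z)%:C.
Proof.
have [->|z0] := eqVneq z 0.
  by exists 1; rewrite mulr0 rnorm0 rnorm1.
exists (`|z| / z).
have n0 : `|z : R[i]| != 0 by rewrite normr_eq0.
split; last by rewrite divfK // -[LHS](rnormE (z : R[i]^o)).
apply: complexI; rewrite -rnormE.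
change (`|(`|z| / z : R[i])| = 1).
by rewrite normrM normfV normr_id divff.
Qed.

End complex_modulus.

Section rnorm_facts.
Variables (R : realType) (E : normedModType R[i]).
Implicit Types x y : E.

Lemma rnormN x : rnorm (- x) = rnorm x.
Proof. by rewrite /rnorm normrN. Qed.

Lemma rnormB x y : rnorm (x - y) = rnorm (y - x).
Proof. by rewrite /rnorm distrC. Qed.

Lemma rnorm_gt0 x : (0 < rnorm x) = (x != 0).
Proof.
rewrite lt_neqAle rnorm_ge0 andbT eq_sym; congr (~~ _).
by apply/eqP/eqP => [/rnorm0_eq0|->]; rewrite ?rnorm0.
Qed.

End rnorm_facts.

Definition seminorm (R : realType) (V : lmodType R[i]) (p : V -> R) : Prop :=
  (forall x y, p (x + y) <= p x + p y) /\
  (forall (c : R[i]) x, p (c *: x) = rnorm (c : R[i]^o) * p x).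

Section seminorm_theory.
Variables (R : realType) (V : lmodType R[i]) (p : V -> R) (sp : seminorm p).

Lemma seminorm0 : p 0 = 0.
Proof. by rewrite -(scale0r 0) (proj2 sp) rnorm0 mul0r. Qed.

Lemma seminormN x : p (- x) = p x.
Proof.
have [_ h] := sp; rewrite -scaleN1r h.
by rewrite /rnorm normrN normr1 mul1r.
Qed.

Lemma seminorm_ge0 x : 0 <= p x.
Proof.
have := (proj1 sp) x (- x).
by rewrite subrr seminormN seminorm0 -mulr2n pmulrn_lge0.
Qed.

End seminorm_theory.

Section Hahn_Banach.
Variables (R : realType) (V : lmodType R[i]) (p : V -> R).
Hypothesis sp : seminorm p.

(** Real-linear functionals on subspaces are encoded by their graphs: domination by
    p makes the relation functional, and unions of chains are then plain unions of
    sets. *)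
Definition dominated_graph (G : set (V * R)) : Prop :=
  [/\ G (0, 0),
      forall x y a b (r : R), G (x, a) -> G (y, b) ->
        G (r%:C *: x + y, r * a + b) &
      forall x a, G (x, a) -> a <= p x].

Lemma dominated_graph_fun G x a b :
  dominated_graph G -> G (x, a) -> G (x, b) -> a = b.
Proof.
move=> [_ lG dG]; have le a' b' : G (x, a') -> G (x, b') -> a' <= b'.
  move=> Ga Gb; have := dG _ _ (lG _ _ _ _ (-1) Gb Ga).
  rewrite rmorphN1 scaleN1r addNr seminorm0// mulN1r addrC subr_le0.
  exact.
by move=> Ga Gb; apply/eqP; rewrite eq_le !le.
Qed.

(** The one-dimensional extension step: any value c at x0 with
    a - p (x - x0) <= c <= p (x' + x0) - a' for all (x, a) and (x', a') in the graph
    will do, and the supremum of the left-hand sides is one. *)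
Lemma dominated_graph_extend G x0 : dominated_graph G ->
  exists2 G', dominated_graph G' & G `<=` G' /\ exists c, G' (x0, c).
Proof.
move=> [G0 lG dG]; have [pD pZ] := sp.
have key x a y b : G (x, a) -> G (y, b) -> a - p (x - x0) <= p (y + x0) - b.
  move=> Ga Gb; rewrite lerBlDr addrAC lerBrDr.
  have := dG _ _ (lG _ _ _ _ 1 Ga Gb).
  rewrite rmorph1 scale1r mul1r => /le_trans; apply.
  apply: le_trans (pD _ _); rewrite (_ : y + x0 + (x - x0) = x + y)//.
  by rewrite addrACA subrr addr0 addrC.
pose S := [set u.2 - p (u.1 - x0) | u in G].
have S0 : S !=set0 by exists (0 - p (0 - x0)), (0, 0).
have Sub : has_ubound S.
  by exists (p (0 + x0) - 0) => _ [[x a] /= Ga <-]; exact: key.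
pose c := sup S.
have cle x a : G (x, a) -> a - p (x - x0) <= c.
  by move=> Ga; apply: ub_le_sup => //; exists (x, a).
have cge x a : G (x, a) -> c <= p (x + x0) - a.
  by move=> Ga; apply: ge_sup => // _ [[y b] /= Gb <-]; exact: key.
exists [set z | exists x a r, G (x, a) /\ z = (x + r%:C *: x0, a + r * c)]; last first.
  split=> [[x a] Ga|]; last first.
    by exists c, 0, 0, 1; split=> //; rewrite rmorph1 scale1r add0r mul1r add0r.
  by exists x, a, 0; split=> //; rewrite rmorph0 scale0r mul0r !addr0.
split.
- by exists 0, 0, 0; split=> //; rewrite rmorph0 scale0r mul0r !addr0.
- move=> _ _ _ _ r [x [a [s [Ga [-> ->]]]]] [y [b [t [Gb [-> ->]]]]].
  exists (r%:C *: x + y), (r * a + b), (r * s + t); split; first exact: lG.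
  congr (_, _); last by ring.
  rewrite rmorphD rmorphM scalerDr scalerDl scalerA.
  by rewrite addrACA.
- move=> _ _ [x [a [r [Ga [-> ->]]]]].
  have sG s : G (s%:C *: x, s * a).
    by have := lG _ _ _ _ s Ga G0; rewrite !addr0.
  have pR s y : 0 < s -> p (s%:C *: y) = s * p y.
    by move=> s0; rewrite pZ rnormC gtr0_norm.
  have [r0|r0|->] := ltrgt0P r; last first.
  + by rewrite rmorph0 scale0r mul0r !addr0; exact: dG.
  + have nr0 : 0 < - r by rewrite oppr_gt0.
    have := cle _ _ (sG (- r)^-1).
    rewrite -(ler_pM2l nr0) mulrBr -pR// scalerBr scalerA -rmorphM mulrA.
    rewrite divff ?gt_eqF// scale1r mul1r rmorphN scaleNr opprK.
    by rewrite mulNr; lra.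
  + have := cge _ _ (sG r^-1).
    rewrite -(ler_pM2l r0) mulrBr -pR// scalerDr scalerA -rmorphM mulrA.
    by rewrite divff ?gt_eqF// scale1r mul1r; lra.
Qed.

Lemma dominated_graph_total G0 : dominated_graph G0 ->
  exists g : V -> R, [/\ forall x a, G0 (x, a) -> g x = a,
    forall r x y, g (r%:C *: x + y) = r * g x + g y & forall x, g x <= p x].
Proof.
move=> dG0; pose T := {G | dominated_graph G /\ G0 `<=` G}.
pose le (s t : T) := `[< sval s `<=` sval t >].
have [||||[G [dG G0G]] Gmax] := @Zorn T le.
- by move=> t; apply/asboolP.
- by move=> r s t /asboolP rs /asboolP st; apply/asboolP => x /rs/st.
- move=> [s ps] [t pt] /asboolP /= st /asboolP /= ts.
  apply: eq_exist => /=; by rewrite eqEsubset.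
- move=> A tA.
  have [[s0 As0]|A0] := pselect (A !=set0); last first.
    exists (exist _ G0 (conj dG0 (fun x h => h))) => s As.
    by exfalso; apply: A0; exists s.
  pose U := [set z | exists2 s : T, A s & sval s z].
  suff PU : dominated_graph U /\ G0 `<=` U.
    by exists (exist _ U PU) => s As; apply/asboolP => z sz; exists s.
  split; last by move=> z; exists s0 => //; apply: (svalP s0).2.
  split.
  + by exists s0 => //; case: (svalP s0) => -[].
  + move=> x y a b r [s As sa] [t At tb].
    have [/asboolP st|/asboolP ts] := tA _ _ As At.
      exists t => //; case: (svalP t) => -[_ lt _] _; apply: lt => //.
      exact: st.
    exists s => //; case: (svalP s) => -[_ ls _] _; apply: ls => //.
    exact: ts.
  + by move=> x a [s As sa]; case: (svalP s) => -[_ _ ds] _; exact: ds.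
have Gtot x : exists a, G (x, a).
  have [G' dG' [GG' [c Gc]]] := dominated_graph_extend x dG.
  have G0G' : G0 `<=` G' by move=> z /G0G/GG'.
  exists c; have := Gmax (exist _ G' (conj dG' G0G')).
  by move=> /(_ (asboolT GG')) [] <-.
have [g gP] := choice Gtot; exists g.
have [_ lG domG] := dG.
split=> [x a G0a|r x y|x]; last exact: domG.
  exact: (dominated_graph_fun dG (gP x) (G0G _ G0a)).
exact: (dominated_graph_fun dG (gP _) (lG _ _ _ _ r (gP x) (gP y))).
Qed.

(** Functionals are extended along a linear map L instead of from a subspace. The
    map is allowed to have a kernel, and taking for L the diagonal of a square
    splits functionals dominated by a sum of seminorms. *)
Theorem hahn_banach (U : lmodType R[i]) (L : U -> V) (f : U -> R[i]^o) :
  linear L -> linear f -> (forall u, rnorm (f u) <= p (L u)) ->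
  exists g : V -> R[i]^o, [/\ linear g, forall v, rnorm (g v) <= p v &
    forall u, g (L u) = f u].
Proof.
move=> lL lf fp; have [pD pZ] := sp.
pose G0 := [set (L u, complex.Re (f u)) | u in [set: U]].
have L0 : L 0 = 0.
  have := lL (-1) 0 0; rewrite scaleN1r oppr0 addr0 scaleN1r addNr //.
have f0 : f 0 = 0.
  have := lf (-1) 0 0; rewrite scaleN1r oppr0 addr0 scaleN1r addNr //.
have ReZ (r : R) (z : R[i]^o) : complex.Re (r%:C *: z) = r * complex.Re z.
  by case: z => a b /=; rewrite mul0r subr0.
have ReD (z w : R[i]^o) : complex.Re (z + w) = complex.Re z + complex.Re w.
  by case: z => a b; case: w.
have [|h [hG hl hp]] := @dominated_graph_total G0.
  split.
  - by exists 0 => //; rewrite L0 f0.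
  - move=> _ _ _ _ r [u _ [<- <-]] [v _ [<- <-]].
    by exists (r%:C *: u + v) => //; rewrite lL lf ReD ReZ.
  - by move=> _ _ [u _ [<- <-]]; apply: le_trans (rnorm_Re _) (fp u).
have hL u : h (L u) = complex.Re (f u) by apply: hG; exists u.
have hD x y : h (x + y) = h x + h y.
  by have := hl 1 x y; rewrite rmorph1 scale1r mul1r.
have h0 : h 0 = 0 by apply: (addrI (h 0)); rewrite -hD !addr0.
have hZ r x : h (r%:C *: x) = r * h x.
  by have := hl r x 0; rewrite !addr0 h0 addr0.
(* The complex functional whose real part is h. *)
pose g x : R[i]^o := (h x +i* - h ('i *: x)).
have gD x y : g (x + y) = g x + g y.
  by rewrite /g scalerDr !hD opprD.
have hi x : h ('i *: ('i *: x)) = - h x.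
  rewrite scalerA -expr2 sqr_i.
  by rewrite -[(-1 : R[i])](rmorphN1 (real_complex R)) hZ mulN1r.
have gR r x : g (r%:C *: x) = r%:C *: g x.
  rewrite /g scalerA (mulrC 'i) -scalerA !hZ.
  by rewrite /GRing.scale /=; apply/eqP; rewrite eq_complex /=; apply/andP; split; apply/eqP; ring.
have gi x : g ('i *: x) = 'i *: g x.
  rewrite /g hi opprK.
  by rewrite /GRing.scale /=; apply/eqP; rewrite eq_complex /=; apply/andP; split; apply/eqP; ring.
have gZ c x : g (c *: x) = c *: g x.
  have -> : c = (complex.Re c)%:C + 'i * (complex.Im c)%:C by exact: complexE.
  by rewrite scalerDl gD -scalerA gi !gR scalerA -scalerDl.
exists g; split.
- by move=> c x y; rewrite gD gZ.
- move=> v; have [c [c1 cE]] := rnorm_rot (g v).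
  have := hp (c *: v); rewrite pZ c1 mul1r; apply: le_trans.
  have := gZ c v; rewrite {2}/GRing.scale /= cE => /(congr1 (@complex.Re _)) /=.
  by move=> ->.
- move=> u; rewrite /g hL.
  have -> : 'i *: L u = L ('i *: u) by have := lL 'i u 0; rewrite L0 !addr0.
  rewrite hL.
  have -> : f ('i *: u) = 'i *: f u by have := lf 'i u 0; rewrite f0 !addr0.
  case: (f u) => a b; rewrite /GRing.scale /=; apply/eqP; rewrite eq_complex /=.
  by apply/andP; split; apply/eqP; ring.
Qed.

End Hahn_Banach.

(** * Functionals on normed spaces, and completeness *)

Section linear_functions.
Variables (R : realType) (U V : lmodType R[i]) (f : U -> V).
Hypothesis lf : linear f.

Lemma linear_fun0 : f 0 = 0.
Proof. by have := lf (-1) 0 0; rewrite scaleN1r oppr0 addr0 scaleN1r addNr. Qed.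

Lemma linear_funD x y : f (x + y) = f x + f y.
Proof. by rewrite -{1}(scale1r x) lf scale1r. Qed.

Lemma linear_funZ c x : f (c *: x) = c *: f x.
Proof. by rewrite -[c *: x]addr0 lf linear_fun0 addr0. Qed.

Lemma linear_funN x : f (- x) = - f x.
Proof. by rewrite -scaleN1r linear_funZ scaleN1r. Qed.

Lemma linear_funB x y : f (x - y) = f x - f y.
Proof. by rewrite linear_funD linear_funN. Qed.

End linear_functions.

(** Applied to c and to its inverse, an inequality for scalar multiples becomes an
    equality. *)
Lemma seminorm_of_le (R : realType) (V : lmodType R[i]) (p : V -> R) :
  (forall x y, p (x + y) <= p x + p y) ->
  (forall (c : R[i]) x, p (c *: x) <= rnorm (c : R[i]^o) * p x) -> seminorm p.
Proof.
move=> pD pZ; split=> // c x; apply/eqP; rewrite eq_le pZ /=.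
have p0 : 0 <= p 0 by have := pD 0 0; rewrite addr0 lerDl.
have [->|c0] := eqVneq c 0; first by rewrite rnorm0 mul0r scale0r.
have c0' : 0 < rnorm (c : R[i]^o) by rewrite rnorm_gt0.
rewrite -ler_pdivlMl//.
have -> : (rnorm (c : R[i]^o))^-1 = rnorm (c^-1 : R[i]^o).
  apply: (@mulfI _ (rnorm (c : R[i]^o))); first by rewrite gt_eqF.
  by rewrite mulfV ?gt_eqF// -rnormM mulfV ?rnorm1.
have {1}-> : x = c^-1 *: (c *: x) by rewrite scalerA mulVf// scale1r.
exact: pZ.
Qed.

Lemma inv_succ_small (R : realType) (e : R) : 0 < e ->
  exists N, forall n, (N <= n)%N -> (n.+1%:R)^-1 < e.
Proof.
move=> e0; exists (Num.truncn e^-1) => n Nn.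
rewrite -(invrK e) ltf_pV2 ?posrE ?invr_gt0//.
by apply: lt_le_trans (truncnS_gt _) _; rewrite ler_nat.
Qed.

Lemma rnorm_seminorm (R : realType) (E : normedModType R[i]) :
  seminorm (@rnorm R E).
Proof. by split; [exact: ler_rnormD | exact: rnormZ]. Qed.

Section functionals.
Variables (R : realType).

Lemma ler_blin (E F : normedModType R[i]) (T : blin E F) x :
  rnorm (T x) <= rnorm T * rnorm x.
Proof. exact: ler_opnorm. Qed.

Lemma blin_norm_le (E F : normedModType R[i]) (T : blin E F) (M : R) : 0 <= M ->
  (forall x, rnorm (T x) <= M * rnorm x) -> rnorm T <= M.
Proof.
move=> M0 TM; apply: opnorm_le => x x1; apply: le_trans (TM x) _.
by rewrite ler_piMr.
Qed.

Lemma blinDE (E F : normedModType R[i]) (S T : blin E F) x : (S + T) x = S x + T x.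
Proof. by []. Qed.

Lemma blinZE (E F : normedModType R[i]) (c : R[i]) (T : blin E F) x :
  (c *: T) x = c *: T x.
Proof. by []. Qed.

Lemma blin_linE (E F : normedModType R[i]) (c : R[i]) (S T : blin E F) x :
  (c *: S + T) x = c *: S x + T x.
Proof. by []. Qed.

Lemma blinBE (E F : normedModType R[i]) (S T : blin E F) x : (S - T) x = S x - T x.
Proof. by []. Qed.

Lemma blin0E (E F : normedModType R[i]) x : (0 : blin E F) x = 0.
Proof. by []. Qed.

Lemma blin_compE (E F G : normedModType R[i]) (S : blin F G) (T : blin E F) x :
  (S \oB T) x = S (T x).
Proof. by []. Qed.

Definition mkblin (E F : normedModType R[i]) (f : E -> F) (lf : linear f)
    (bf : exists M : R, forall x, rnorm (f x) <= M * rnorm x) : blin E F :=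
  Blin (asboolT (conj lf bf)).

Lemma blin_extend (E : normedModType R[i]) (U : lmodType R[i]) (L : U -> E)
    (f : U -> R[i]^o) (M : R) : 0 <= M -> linear L -> linear f ->
  (forall u, rnorm (f u) <= M * rnorm (L u)) ->
  exists2 g : dual E, rnorm g <= M & forall u, g (L u) = f u.
Proof.
move=> M0 lL lf fM.
have sp : seminorm (fun x : E => M * rnorm x).
  split=> [x y|c x]; first by rewrite -mulrDr ler_wpM2l// ler_rnormD.
  by rewrite rnormZ mulrCA.
have [g [lg gM gL]] := hahn_banach sp lL lf fM.
exists (mkblin lg (ex_intro _ M gM) : dual E) => //.
exact: blin_norm_le.
Qed.

Lemma norming_functional (E : normedModType R[i]) (x : E) :
  exists2 mu : dual E, rnorm mu <= 1 & mu x = (rnorm x)%:C.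
Proof.
pose L (c : R[i]^o) := c *: x; pose f (c : R[i]^o) : R[i]^o := c * (rnorm x)%:C.
have lL : linear L by move=> a b c; rewrite /L scalerDl scalerA.
have lf : linear f by move=> a b c; rewrite /f mulrDl -mulrA.
have [u|mu mu1 muL] := blin_extend ler01 lL lf.
  by rewrite /f /L rnormM rnormC ger0_norm ?rnorm_ge0// mul1r rnormZ.
exists mu => //; have := muL 1.
by rewrite /L /f scale1r mul1r.
Qed.

Lemma dual_separates (E : normedModType R[i]) (x y : E) :
  (forall mu : dual E, mu x = mu y) -> x = y.
Proof.
move=> xy; apply/eqP; rewrite -subr_eq0; apply/eqP/rnorm0_eq0.
have [mu _ muE] := norming_functional (x - y).
by apply: complexI; rewrite -muE linearB /= xy subrr.
Qed.

Lemma rnorm_le_dual (E : normedModType R[i]) (x : E) (M : R) :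
  (forall mu : dual E, rnorm mu <= 1 -> rnorm (mu x) <= M) -> rnorm x <= M.
Proof.
move=> xM; have [mu mu1 muE] := norming_functional x.
by have := xM mu mu1; rewrite muE rnormC ger0_norm// rnorm_ge0.
Qed.

End functionals.

Section splitting.
Variables (R : realType) (V : lmodType R[i]) (p q : V -> R).
Hypotheses (sp : seminorm p) (sq : seminorm q).

Let diag_linear : linear (fun v : V => (v, v)).
Proof. by []. Qed.

Let split_pair (g : V * V -> R[i]^o) : linear g ->
  [/\ linear (fun a => g (a, 0)), linear (fun b => g (0, b)) &
      forall a b, g (a, b) = g (a, 0) + g (0, b)].
Proof.
move=> lg; split.
- move=> c a b; rewrite -lg; congr (g (_, _)) => /=.
  by rewrite scaler0 addr0.
- move=> c a b; rewrite -lg; congr (g (_, _)) => /=.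
  by rewrite scaler0 addr0.
- move=> a b; rewrite -(linear_funD lg); congr (g (_, _)) => /=.
    by rewrite addr0.
  by rewrite add0r.
Qed.

Lemma split_add (f : V -> R[i]^o) : linear f ->
  (forall v, rnorm (f v) <= p v + q v) ->
  exists g h : V -> R[i]^o, [/\ linear g, linear h,
    forall v, f v = g v + h v, forall v, rnorm (g v) <= p v &
    forall v, rnorm (h v) <= q v].
Proof.
move=> lf fpq; have [pD pZ] := sp; have [qD qZ] := sq.
have spq : seminorm (fun w : V * V => p w.1 + q w.2).
  split=> [x y|c x] /=; last by rewrite pZ qZ mulrDr.
  by rewrite addrACA lerD.
have [k [lk kpq kf]] := hahn_banach spq diag_linear lf fpq.
have [lk1 lk2 kE] := split_pair lk.
exists (fun a => k (a, 0)), (fun b => k (0, b)); split=> // v.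
- by rewrite -kE kf.
- by apply: le_trans (kpq _) _; rewrite /= (seminorm0 sq) addr0.
- by apply: le_trans (kpq _) _; rewrite /= (seminorm0 sp) add0r.
Qed.

Lemma minkowski2 (a b c d : R) : 0 <= a -> 0 <= b -> 0 <= c -> 0 <= d ->
  Num.sqrt ((a + b) ^+ 2 + (c + d) ^+ 2) <=
  Num.sqrt (a ^+ 2 + c ^+ 2) + Num.sqrt (b ^+ 2 + d ^+ 2).
Proof.
move=> a0 b0 c0 d0.
set s := Num.sqrt (a ^+ 2 + c ^+ 2); set t := Num.sqrt (b ^+ 2 + d ^+ 2).
have s0 : 0 <= s by exact: sqrtr_ge0.
have t0 : 0 <= t by exact: sqrtr_ge0.
have s2 : s ^+ 2 = a ^+ 2 + c ^+ 2 by rewrite sqr_sqrtr// addr_ge0// sqr_ge0.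
have t2 : t ^+ 2 = b ^+ 2 + d ^+ 2 by rewrite sqr_sqrtr// addr_ge0// sqr_ge0.
rewrite -[leRHS](ger0_norm (addr_ge0 s0 t0)) -sqrtr_sqr ler_wsqrtr//.
have st : a * b + c * d <= s * t.
  rewrite -(ler_pXn2r (_ : 0 < 2)%N)// ?nnegrE ?mulr_ge0 ?addr_ge0 ?mulr_ge0//.
  rewrite [leRHS]exprMn s2 t2 -subr_ge0.
  by rewrite (_ : _ - _ = (a * d - b * c) ^+ 2) ?sqr_ge0//; ring.
by rewrite !sqrrD s2 t2; lra.
Qed.

(** The l2 variant of the splitting keeps the sharp constant in a joint estimate
    of g a + h b for independent a and b: it says that the norms of the two parts
    satisfy |g|^2 + |h|^2 <= M^2. *)
Lemma split_hilbert (f : V -> R[i]^o) (M : R) : 0 <= M -> linear f ->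
  (forall v, rnorm (f v) <= M * Num.sqrt (p v ^+ 2 + q v ^+ 2)) ->
  exists g h : V -> R[i]^o, [/\ linear g, linear h,
    forall v, f v = g v + h v &
    forall a b, rnorm (g a + h b) <= M * Num.sqrt (p a ^+ 2 + q b ^+ 2)].
Proof.
move=> M0 lf fpq; have [pD pZ] := sp; have [qD qZ] := sq.
have spq : seminorm (fun w : V * V => M * Num.sqrt (p w.1 ^+ 2 + q w.2 ^+ 2)).
  split=> [x y|c x] /=.
    rewrite -mulrDr ler_wpM2l//; apply: le_trans (minkowski2 _ _ _ _);
      rewrite ?(seminorm_ge0 sp) ?(seminorm_ge0 sq)//.
    by rewrite ler_wsqrtr// lerD// ler_pXn2r// ?nnegrE ?addr_ge0
      ?(seminorm_ge0 sp) ?(seminorm_ge0 sq).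
  rewrite pZ qZ !exprMn -mulrDr sqrtrM ?sqr_ge0// sqrtr_sqr.
  by rewrite ger0_norm ?rnorm_ge0// mulrCA.
have [k [lk kpq kf]] := hahn_banach spq diag_linear lf fpq.
have [lk1 lk2 kE] := split_pair lk.
exists (fun a => k (a, 0)), (fun b => k (0, b)); split=> // [v|a b].
- by rewrite -kE kf.
- by rewrite -kE; exact: kpq.
Qed.

End splitting.

Section completeness.
Variables (R : realType) (E : normedModType R[i]).

Definition rcauchy (u : nat -> E) : Prop := forall e : R, 0 < e ->
  exists N, forall m n, (N <= m)%N -> (N <= n)%N -> rnorm (u m - u n) < e.

Definition rcvg (u : nat -> E) (l : E) : Prop := forall e : R, 0 < e ->
  exists N, forall n, (N <= n)%N -> rnorm (u n - l) < e.

Definition seq_complete : Prop :=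
  forall u, rcauchy u -> exists l, rcvg u l.

Lemma gt0_complex (e : R[i]) : 0 < e -> 0 < complex.Re e /\ e = (complex.Re e)%:C.
Proof. by case: e => a b; rewrite ltcE /= => /andP[/eqP -> ->]. Qed.

Lemma ball_rnorm (x y : E) (e : R) : ball x e%:C y = (rnorm (x - y) < e) :> Prop.
Proof. by rewrite -ball_normE /ball_ /= rnormE ltcR. Qed.

(** Cauchy filters are reduced to Cauchy sequences by choosing the centres of balls
    of radius 1/(n+1) that belong to the filter. *)
Lemma complete_of_seq : seq_complete ->
  forall F : set_system E, ProperFilter F -> cauchy F -> cvg F.
Proof.
move=> sc F FF /cauchyP cF.
have e0 n : (0 : R) < (n.+1%:R)^-1 by rewrite invr_gt0.
have /choice[u uP] n : exists x, F (ball x ((n.+1%:R)^-1)%:C : set E).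
  by apply: cF; rewrite ltcR.
have small := @inv_succ_small R.
have [|l ul] := sc u.
  move=> e ep; have [N NP] := small (e / 2) (divr_gt0 ep (ltr0Sn _ 1)).
  exists N => m n /NP Nm /NP Nn.
  have [z [Fm Fn]] := filter_ex (filterI (uP m) (uP n)).
  move: Fm Fn; rewrite !ball_rnorm => zm zn.
  rewrite -(subrK z (u m)) -addrA (splitr e).
  apply: le_lt_trans (ler_rnormD _ _) _; rewrite (rnormB z).
  by apply: ltrD; [exact: lt_trans zm Nm|exact: lt_trans zn Nn].
apply/cvg_ex; exists l => A /nbhs_ballP[r /gt0_complex[ep rE] sA].
rewrite {}rE in sA; set e := complex.Re _ in ep sA.
have e2 := divr_gt0 ep (ltr0Sn _ 1).
have [N NP] := small _ e2; have [N' N'P] := ul _ e2.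
pose n := maxn N N'; apply: filterS (uP n) => y; rewrite ball_rnorm => uy.
apply: sA; rewrite ball_rnorm (splitr e) -(subrK (u n) l) -addrA.
apply: le_lt_trans (ler_rnormD _ _) _; rewrite rnormB ltrD ?N'P ?leq_maxr//.
by apply: lt_trans uy _; rewrite NP// leq_maxl.
Qed.

End completeness.

Lemma seq_complete_of_complete (R : realType) (E : completeNormedModType R[i]) :
  seq_complete E.
Proof.
move=> u uC; have : cvgn u.
  apply: cauchy_cvg; apply: cauchy_exP => r /gt0_complex[e0 ->].
  have [N NP] := uC _ e0; exists (u N); exists N => // n /= Nn.
  by rewrite ball_rnorm NP.
move=> /cvg_ex[l ul]; exists l => e e0.
have /cvgrPdist_lt/(_ e%:C) := ul; rewrite ltcR => /(_ e0)[N _ NP].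
by exists N => n /NP /=; rewrite rnormE ltcR rnormB.
Qed.

Lemma rcvg_blin (R : realType) (E F : normedModType R[i]) (T : blin E F) u l :
  rcvg u l -> rcvg (fun n => T (u n)) (T l).
Proof.
move=> ul e e0; have T0 : 0 < rnorm T + 1 by rewrite ltr_wpDl// rnorm_ge0.
have [N NP] := ul _ (divr_gt0 e0 T0); exists N => n /NP.
rewrite ltr_pdivlMr// => h; rewrite -linearB; apply: le_lt_trans (ler_blin _ _) _.
apply: le_lt_trans h; rewrite mulrC ler_wpM2l ?rnorm_ge0// lerDl.
exact: ler01.
Qed.

Lemma rcvg_unique (R : realType) (E : normedModType R[i]) (u : nat -> E) l l' :
  rcvg u l -> rcvg u l' -> l = l'.
Proof.
move=> ul ul'; apply/eqP; rewrite -subr_eq0; apply/eqP/rnorm0_eq0.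
apply/eqP; rewrite eq_le rnorm_ge0 andbT; apply/ler_addgt0Pr => e e0.
have e2 := divr_gt0 e0 (ltr0Sn _ 1).
have [N NP] := ul _ e2; have [N' N'P] := ul' _ e2; pose n := maxn N N'.
rewrite add0r (splitr e) -(subrK (u n) l) -addrA.
apply: le_trans (ler_rnormD _ _) _; rewrite rnormB lerD ?ltW ?NP ?N'P//.
  exact: leq_maxl.
exact: leq_maxr.
Qed.

(** * Uniform boundedness *)

Section uniform_boundedness.
Variables (R : realType) (V : normedModType R[i]).

Lemma opnorm_near (f : dual V) (K : R) : K < rnorm f ->
  exists2 y, rnorm y <= 1 & K < rnorm (f y).
Proof.
move=> Kf; have [_ [y /= y1 <-] Ky] := sup_gt (proj1 (opnorm_has_sup f)) Kf.
by exists y.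
Qed.

(** In one of two opposite directions y and -y the value grows enough, because
    f (x + r y) - f (x - r y) = 2 r f y. *)
Lemma functional_jump (f : dual V) (K r : R) (x : V) : 0 < r -> K < rnorm f ->
  exists2 x', rnorm (x' - x) <= r & r * K <= rnorm (f x').
Proof.
move=> r0 /opnorm_near[y y1 Ky].
have ry : rnorm (r%:C *: y) <= r.
  by rewrite rnormZ rnormC gtr0_norm// ler_piMr// ltW.
have [h|h] := leP (r * K) (rnorm (f (x + r%:C *: y))).
  by exists (x + r%:C *: y) => //; rewrite addrAC subrr add0r.
exists (x - r%:C *: y); first by rewrite addrAC subrr add0r rnormN.
rewrite leNgt; apply/negP => h'.
have e2 : (2%:R%:C : R[i]) *: (r%:C *: f y) = f (x + r%:C *: y) - f (x - r%:C *: y).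
  rewrite linearD linearB linearZ /= opprB addrC addrA subrK.
  by rewrite rmorphMn rmorph1 scaler_nat mulr2n scalerDr linearZ.
have := ler_rnormD (f (x + r%:C *: y)) (- f (x - r%:C *: y)).
rewrite rnormN -e2 !rnormZ !rnormC (gtr0_norm r0) ger0_norm ?ler0n//.
apply/negP; rewrite -ltNge; apply: lt_le_trans (ltrD h h') _.
by rewrite -[leLHS]mulr2n -[leLHS]mulr_natl ler_wpM2l// ler_wpM2l ?ltW.
Qed.

(** Gliding hump: functionals f_n with norm of the order of n / r_n, where
    r_n = 3^-(n+1), and points x_n with |x_(n+1) - x_n| <= r_n such that f_n is
    large at x_(n+1). The later moves add up to at most r_n / 2, too little to
    undo this, so f_n is unbounded at the limit. *)
Theorem uniform_boundedness (J : Type) (f : J -> dual V) : seq_complete V ->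
  (forall v, exists M : R, forall j, rnorm (f j v) <= M) ->
  exists M : R, forall j, rnorm (f j) <= M.
Proof.
move=> Vc fb; apply: contrapT => nM.
have big (K : R) : exists j, K < rnorm (f j).
  apply: contrapT => nj; apply: nM; exists K => j; rewrite leNgt.
  by apply/negP => Kj; apply: nj; exists j.
pose r n : R := 3^-1 ^+ n.+1.
have r0 n : 0 < r n by rewrite exprn_gt0// invr_gt0.
have rS n : r n = 3 * r n.+1 by rewrite /r [in RHS]exprS mulrA divff ?mul1r ?pnatr_eq0.
have /choice[j jP] n := big (6 * n%:R / r n).
have step (n : nat) (x : V) :
    exists x', rnorm (x' - x) <= r n /\ r n * (2 / 3 * rnorm (f (j n))) <= rnorm (f (j n) x').
  have fj0 : 0 < rnorm (f (j n)).
    by apply: le_lt_trans (jP n); rewrite divr_ge0 ?mulr_ge0// ltW.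
  have [|x' h1 h2] := @functional_jump (f (j n)) (2 / 3 * rnorm (f (j n))) (r n) x (r0 n).
    by rewrite gtr_pMl//; lra.
  by exists x'.
have /choice[g gP] := fun nx : nat * V => step nx.1 nx.2.
pose fix x n := if n is m.+1 then g (m, x m) else 0.
have xS n : rnorm (x n.+1 - x n) <= r n by case: (gP (n, x n)).
have xf n : r n * (2 / 3 * rnorm (f (j n))) <= rnorm (f (j n) (x n.+1)).
  by case: (gP (n, x n)).
have tail n k : rnorm (x (n + k)%N - x n) <= 3 / 2 * r n - 3 / 2 * r (n + k)%N.
  elim: k => [|k IH]; first by rewrite addn0 !subrr rnorm0.
  rewrite addnS -(subrK (x (n + k)%N) (x (n + k).+1)) -addrA.
  apply: le_trans (ler_rnormD _ _) _.
  have := xS (n + k)%N; have := rS (n + k)%N; lra.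
have tail' n m : (n <= m)%N -> rnorm (x m - x n) <= 3 / 2 * r n.
  move=> nm; have := tail n (m - n)%N; rewrite subnKC// => /le_trans; apply.
  by have := r0 m; lra.
have rsmall (e : R) : 0 < e -> exists N, 3 / 2 * r N < e.
  move=> e0; exists (Num.truncn e^-1).+1; set N := (Num.truncn e^-1).+1.
  have eN : e^-1 < N%:R by exact: truncnS_gt.
  have N3 k : k%:R <= (3 : R) ^+ k.
    elim: k => [|k IH]; first by rewrite expr0.
    rewrite exprS -natr1; apply: (@le_trans _ _ (3 ^+ k + 1)).
      by rewrite lerD2r.
    by have : (1 : R) <= 3 ^+ k by [apply: exprn_ege1; lra]; lra.
  have -> : r N = (3 ^+ N)^-1 / 3 by rewrite /r exprSr exprVn.
  have : (3 ^+ N)^-1 < e; last by lra.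
  rewrite -(invrK e) ltf_pV2 ?posrE ?exprn_gt0 ?invr_gt0//.
  exact: lt_le_trans eN (N3 _).
have [|l xl] := Vc x.
  move=> e e0; have [N NP] := rsmall _ (divr_gt0 e0 (ltr0Sn _ 1)).
  exists N => m n Nm Nn; rewrite (splitr e) -(subrK (x N) (x m)) -addrA.
  apply: le_lt_trans (ler_rnormD _ _) _; rewrite (rnormB (x N)).
  by apply: ltrD; apply: le_lt_trans NP; exact: tail'.
have lx n : rnorm (l - x n) <= 3 / 2 * r n.
  rewrite rnormB; apply/ler_addgt0Pr => e e0; have [N NP] := xl _ e0.
  pose m := maxn N n; rewrite rnormB -(subrK (x m) l) -addrA addrC.
  apply: le_trans (ler_rnormD _ _) _; rewrite lerD ?tail' ?leq_maxr//.
  by rewrite rnormB ltW// NP// leq_maxl.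
have [M MP] := fb l.
have fl n : n%:R <= rnorm (f (j n) l).
  have h1 := ler_blin (f (j n)) (l - x n.+1).
  have h2 : rnorm (f (j n) (x n.+1)) <= rnorm (f (j n) l) + rnorm (f (j n) (l - x n.+1)).
    rewrite -{1}(subKr l (x n.+1)) linearB; apply: le_trans (ler_rnormD _ _) _.
    by rewrite rnormN.
  have := jP n; rewrite ltr_pdivrMr// => h3.
  have h4 : rnorm (f (j n)) * rnorm (l - x n.+1) <= rnorm (f (j n)) * (3 / 2 * r n.+1).
    by rewrite ler_wpM2l ?rnorm_ge0.
  have h5 := xf n; have h6 := rS n; rewrite h6 in h3 h5.
  have := rnorm_ge0 (f (j n)); move: h1 h2 h3 h4 h5; move: (rnorm _) (rnorm _) (rnorm _) (rnorm _) (rnorm _) (r n.+1) => a b c d e' t.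
  by nra.
have := le_trans (fl (Num.truncn M).+1) (MP _); apply/negP; rewrite -ltNge.
exact: truncnS_gt.
Qed.

End uniform_boundedness.

(** * Weak* continuous functionals come from the predual *)

Section weak_star.
Variable R : realType.

Lemma cvg_initial (S : choiceType) (T : topologicalType) (f : S -> T)
    (F : set_system S) (s : S) : Filter F ->
  f @ F --> f s -> F --> (s : initial_topology f).
Proof.
move=> FF h A [_ [[B oB <-] Bs] sA].
by apply: filterS sA _; apply: h; exact: open_nbhs_nbhs.
Qed.

Lemma cvg_ptws (X : Type) (T : topologicalType) (F : set_system {ptws X -> T})
    (g : {ptws X -> T}) : Filter F ->
  F --> g <-> forall x, (fun h : X -> T => h x) @ F --> g x.
Proof.
move=> FF; split=> [Fg x|Fg].
  apply: cvg_trans (@proj_continuous {classic X} (fun=> T) x g).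
  exact: cvg_app.
by apply/cvg_sup => x; apply: cvg_initial; exact: Fg.
Qed.

Lemma wstar_continuousP (S1 S2 : choiceType) (X1 X2 : Type)
    (J1 : S1 -> X1 -> R[i]^o) (J2 : S2 -> X2 -> R[i]^o) (f : S1 -> S2) :
  wstar_continuous J1 J2 f <->
  forall x, continuous ((fun a => J2 (f a) x) :
    initial_topology (J1 : S1 -> {ptws X1 -> R[i]^o}) -> R[i]^o).
Proof.
split=> [cf x a|cf].
  have h : (J2 \o f : initial_topology (J1 : S1 -> {ptws X1 -> R[i]^o}) ->
      {ptws X2 -> R[i]^o}) @ a --> (J2 (f a) : {ptws X2 -> R[i]^o}).
    exact: (@continuous_comp
      (initial_topology (J1 : S1 -> {ptws X1 -> R[i]^o}))
      (initial_topology (J2 : S2 -> {ptws X2 -> R[i]^o})) {ptws X2 -> R[i]^o}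
      f J2 a (cf a) (@initial_continuous _ _ _ _)).
  move: h => /cvg_ptws/(_ x) h.
  apply: h; apply: fmap_filter.
  exact: (@nbhs_filter (initial_topology (J1 : S1 -> {ptws X1 -> R[i]^o})) a).
move=> a; set Fa : set_system S2 :=
  f @ (a : initial_topology (J1 : S1 -> {ptws X1 -> R[i]^o})).
have FF : Filter Fa.
  apply: fmap_filter.
  exact: (@nbhs_filter (initial_topology (J1 : S1 -> {ptws X1 -> R[i]^o})) a).
apply: (@cvg_initial S2 {ptws X2 -> R[i]^o} J2 Fa (f a)).
by apply/cvg_ptws => x; exact: cf.
Qed.

(** The sets where finitely many functionals J _ x are small generate a filter
    that converges to s0, so one of them is contained in the neighbourhood of s0
    where g is smaller than 1. *)
Lemma initial_controlled (S : choiceType) (X : Type) (J : S -> X -> R[i]^o)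
    (s0 : S) (g : S -> R[i]^o) : (forall x, J s0 x = 0) -> g s0 = 0 ->
  continuous (g : initial_topology (J : S -> {ptws X -> R[i]^o}) -> R[i]^o) ->
  exists (l : seq X) (e : R), 0 < e /\
    forall s, (forall x, List.In x l -> rnorm (J s x) < e) -> rnorm (g s) < 1.
Proof.
move=> J0 g0 cg.
pose D := [set le : seq X * R | 0 < le.2].
pose B (le : seq X * R) := [set s | forall x, List.In x le.1 -> rnorm (J s x) < le.2].
pose F := filter_from D B.
have FF : Filter F.
  apply: filter_from_filter; first by exists ([::], 1); rewrite /D /=.
  move=> [l1 e1] [l2 e2]; rewrite /D /= => e10 e20.
  exists (l1 ++ l2, Num.min e1 e2); first by rewrite /= lt_min e10.
  move=> s sl; split=> x xl; have := sl x; rewrite lt_min => /(_ _)/andP h.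
    by have [] := h (List.in_or_app _ _ _ (or_introl xl)).
  by have [] := h (List.in_or_app _ _ _ (or_intror xl)).
have F0 : F --> (s0 : initial_topology (J : S -> {ptws X -> R[i]^o})).
  apply: cvg_initial; apply/cvg_ptws => x.
  apply/cvgrPdist_lt => r /gt0_complex[e0 ->].
  exists ([:: x], complex.Re r) => // s /= /(_ x (or_introl erefl)).
  by rewrite J0 sub0r normrN rnormE ltcR.
have gF : g @ F --> g s0 by exact: cvg_trans (cvg_app g F0) (cg s0).
move/cvgrPdist_lt/(_ 1 ltr01) : gF => [[l e] /= e0 le].
exists l, e; split=> // s /le /=.
by rewrite g0 sub0r normrN rnormE (_ : 1 = 1%:C) ?ltcR.
Qed.

Lemma sum_seminorm (V : lmodType R[i]) (I : Type) (r : seq I) (p : I -> V -> R) :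
  (forall i, seminorm (p i)) -> seminorm (fun v => \sum_(i <- r) p i v).
Proof.
move=> sp; split=> [x y|c x].
  by rewrite -big_split /= ler_sum// => i _; case: (sp i).
by rewrite mulr_sumr; apply: eq_bigr => i _; case: (sp i).
Qed.

(** Split f into parts dominated by the single terms; a functional dominated by
    the modulus of J _ x is a multiple of J _ x, because it factors through the
    scalar field. *)
Lemma controlled_pairing (V X : lmodType R[i]) (J : V -> X -> R[i]^o) (r : seq X)
    (f : V -> R[i]^o) :
  (forall x, linear (J ^~ x)) -> (forall v, linear (J v)) -> linear f ->
  (forall v, rnorm (f v) <= \sum_(x <- r) rnorm (J v x)) ->
  exists x, forall v, f v = J v x.
Proof.
move=> lJ lJ'; elim: r f => [|x r IH] f lf fr.
  exists 0 => v; rewrite (linear_fun0 (lJ' v)); apply: rnorm0_eq0.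
  by apply/eqP; rewrite eq_le rnorm_ge0 andbT; have := fr v; rewrite big_nil.
have sJ y : seminorm (fun v => rnorm (J v y)).
  split=> [v w|c v]; first by rewrite (linear_funD (lJ y)) ler_rnormD.
  by rewrite (linear_funZ (lJ y)) rnormZ.
have [|f1 [f2 [lf1 lf2 fE f1p f2p]]] := split_add (sJ x) (sum_seminorm r sJ) lf.
  by move=> v; have := fr v; rewrite big_cons.
have [y yE] := IH f2 lf2 f2p.
have [g [lg _ gE]] := hahn_banach (rnorm_seminorm (R[i]^o)) (lJ x) lf1 f1p.
exists (g 1 *: x + y) => v.
rewrite lJ' fE yE -gE; congr (_ + _).
have -> : J v x = J v x *: (1 : R[i]^o) by rewrite /GRing.scale /= mulr1.
by rewrite (linear_funZ lg) /GRing.scale /= mulr1 mulrC.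
Qed.

(** By homogeneity, control near 0 by finitely many J _ x is domination by a
    multiple of the sum of their moduli. *)
Lemma wstar_representable (S : lmodType R[i]) (X : lmodType R[i])
    (J : S -> X -> R[i]^o) (g : S -> R[i]^o) :
  (forall x, linear (J ^~ x)) -> (forall s, linear (J s)) -> linear g ->
  continuous (g : initial_topology (J : S -> {ptws X -> R[i]^o}) -> R[i]^o) ->
  exists x, forall s, g s = J s x.
Proof.
move=> lJ lJ' lg cg.
have J0 x : J 0 x = 0 by rewrite (linear_fun0 (lJ x)).
have [l [e [e0 le]]] := initial_controlled J0 (linear_fun0 lg) cg.
have lsum s x : List.In x l -> rnorm (J s x) <= \sum_(y <- l) rnorm (J s y).
  elim: (l) => [|y m IH] //= [->|/IH h]; rewrite big_cons.
    by rewrite lerDl sumr_ge0// => z _; exact: rnorm_ge0.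
  by apply: le_trans h _; rewrite lerDr rnorm_ge0.
have key s : rnorm (g s) <= e^-1 * \sum_(x <- l) rnorm (J s x).
  set t := \sum_(x <- l) _; have t0 : 0 <= t.
    by rewrite sumr_ge0// => z _; exact: rnorm_ge0.
  apply/ler_addgt0Pr => d d0.
  pose k := e / (t + e * d).
  have td : 0 < t + e * d by rewrite ltr_wpDl// mulr_gt0.
  have k0 : 0 < k by rewrite divr_gt0.
  have := le (k%:C *: s); rewrite (linear_funZ lg) rnormZ rnormC gtr0_norm//.
  rewrite mulrC -ltr_pdivlMr// => /(_ _)/ltW h; apply: le_trans (h _) _.
    move=> x xl; rewrite (linear_funZ (lJ x)) rnormZ rnormC gtr0_norm//.
    rewrite /k mulrAC ltr_pdivrMr// ltr_pM2l//.
    by apply: le_lt_trans (lsum _ _ xl) _; rewrite ltrDl mulr_gt0.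
  by rewrite /k div1r invf_div mulrDl mulrAC divff ?gt_eqF// mul1r mulrC.
have [x xE] : exists x, forall s, g s = J s x; last by exists x.
apply: (@controlled_pairing S X J [seq (e^-1)%:C *: x | x <- l]) => // s.
apply: le_trans (key s) _; rewrite big_map mulr_sumr le_eqVlt; apply/orP; left.
apply/eqP; apply: eq_bigr => x _.
by rewrite (linear_funZ (lJ' s)) rnormZ rnormC gtr0_norm ?invr_gt0.
Qed.

Definition normal_functional (A : dualBanachAlg R) (f : A -> R[i]^o) : Prop :=
  exists z : predual A, forall a, f a = predual_map a z.

Lemma predual_map_pairing (A : dualBanachAlg R) :
  (forall z, linear (fun a : A => predual_map a z)).
Proof. by move=> z c a b; rewrite predual_map_linear. Qed.

(** From here on, weak* continuity of maps on A is only used through the elements of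
    the predual that represent the coefficients. *)
Theorem wstar_normal (A : dualBanachAlg R) (S : choiceType) (X : Type)
    (J : S -> X -> R[i]^o) (g : A -> S) :
  (forall x, linear (fun a => J (g a) x)) ->
  wstar_continuous predual_map J g <->
  forall x, normal_functional (fun a => J (g a) x).
Proof.
move=> lg; split=> [/wstar_continuousP cg x|gn].
  apply: (@wstar_representable A (predual A) (fun a z => predual_map a z)) => //.
  - exact: predual_map_pairing.
  - by move=> a; exact: blin_linear.
apply/wstar_continuousP => x; have [z zE] := gn x.
have : continuous ((fun a => predual_map a z) : initial_topology
    ((fun a z => predual_map a z) : A -> {ptws predual A -> R[i]^o}) -> R[i]^o).
  have /wstar_continuousP : wstar_continuous
    (fun (a : A) (z : predual A) => predual_map a z)
    (fun (a : A) (z : predual A) => predual_map a z) idfun by move=> a.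
  exact.
by rewrite (_ : (fun a => predual_map a z) = (fun a => J (g a) x))//; apply: funext => a; rewrite zE.
Qed.

End weak_star.

(** ** Normal functionals *)

Section normal_functionals.
Variables (R : realType) (A : dualBanachAlg R).
Implicit Types (f g : A -> R[i]^o).

Lemma rnorm_predual_map (a : A) : rnorm (predual_map a) = rnorm a.
Proof. by apply: (@complexI R); rewrite -!rnormE predual_map_isometry. Qed.

Lemma ler_predual_map (a : A) z : rnorm (predual_map a z) <= rnorm a * rnorm z.
Proof. by rewrite -rnorm_predual_map; exact: ler_blin. Qed.

Lemma rnorm_predual_le (z : predual A) (M : R) : 0 <= M ->
  (forall a, rnorm (predual_map a z) <= M * rnorm a) -> rnorm z <= M.
Proof.
move=> M0 h; apply: rnorm_le_dual => mu mu1; have [a aE] := predual_map_surjective mu.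
rewrite -aE in mu1 *; apply: le_trans (h a) _.
by rewrite ler_piMr// -rnorm_predual_map.
Qed.

Lemma predual_ext (z z' : predual A) :
  (forall a, predual_map a z = predual_map a z') -> z = z'.
Proof.
by move=> zz'; apply: dual_separates => mu; have [a <-] := predual_map_surjective mu.
Qed.

Lemma normal_linear c f g : normal_functional f -> normal_functional g ->
  normal_functional (fun a => c *: f a + g a).
Proof.
move=> [z zE] [w wE]; exists (c *: z + w) => a.
by rewrite zE wE [RHS]linearP.
Qed.

Lemma normal_zero : normal_functional (A := A) (fun=> 0).
Proof. by exists 0 => a; rewrite linear0. Qed.

Lemma normal_add f g : normal_functional f -> normal_functional g ->
  normal_functional (fun a => f a + g a).
Proof.
move=> nf ng; have [z zE] := normal_linear 1 nf ng; exists z => a.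
by rewrite -zE scale1r.
Qed.

Lemma normal_sum (J : Type) (K : seq J) (f : J -> A -> R[i]^o) :
  (forall j, normal_functional (f j)) ->
  normal_functional (fun a => \sum_(j <- K) f j a).
Proof.
move=> nf; elim: K => [|j K [z zE]].
  by have [z zE] := normal_zero; exists z => a; rewrite big_nil.
have [w wE] := normal_add (nf j) (ex_intro _ z zE); exists w => a.
by rewrite big_cons wE.
Qed.

(** The predual is norm-closed in the dual of A: it is complete and embedded
    isometrically. *)
Lemma normal_closed f :
  (forall e : R, 0 < e -> exists2 g, normal_functional g &
     forall a, rnorm (f a - g a) <= e * rnorm a) -> normal_functional f.
Proof.
move=> fC; have e0 n : (0 : R) < n.+1%:R^-1 by rewrite invr_gt0.
have /choice[z zP] : forall n, exists z : predual A, forall a : A,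
    rnorm (f a - predual_map a z) <= n.+1%:R^-1 * rnorm a.
  move=> n; have [g [z zE] gP] := fC _ (e0 n); exists z => a.
  by rewrite -zE.
have small := @inv_succ_small R.
have [|l zl] := @seq_complete_of_complete R (predual A) z.
  move=> e ep; have e3 : 0 < e / 3 by rewrite divr_gt0.
  have [N NP] := small _ e3; exists N => m n /NP/ltW Nm /NP/ltW Nn.
  apply: (@le_lt_trans _ _ (e / 3 + e / 3)); last by lra.
  apply: rnorm_predual_le => [|a]; first by rewrite addr_ge0 ?ltW.
  rewrite linearB /= -(subrK (f a) (predual_map a (z m))) -addrA.
  apply: le_trans (ler_rnormD _ _) _; rewrite rnormB mulrDl.
  by apply: lerD; apply: le_trans (zP _ a) _; rewrite ler_wpM2r ?rnorm_ge0.
exists l => a; apply: (@rcvg_unique _ _ (fun n => predual_map a (z n))); last first.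
  exact: rcvg_blin.
move=> e ep; have a0 : 0 < rnorm a + 1 by rewrite ltr_wpDl ?rnorm_ge0.
have [N NP] := small _ (divr_gt0 ep a0); exists N => n /NP h.
rewrite rnormB; apply: le_lt_trans (zP n a) _.
move: h; rewrite ltr_pdivlMr//; apply: le_lt_trans.
by rewrite ler_wpM2l ?(ltW (e0 n))// lerDl.
Qed.

End normal_functionals.

Lemma cvgn_rcvg (R : realType) (E : normedModType R[i]) (u : nat -> E) (l : E) :
  u @ \oo --> l -> rcvg u l.
Proof.
move=> /cvgrPdist_lt ul e e0; have := ul e%:C; rewrite ltcR => /(_ e0)[N _ NP].
by exists N => n /NP /=; rewrite rnormE ltcR rnormB.
Qed.

(** ** The weak* topology of the operators on E *)

Section operator_topology.
Variables (R : realType) (E : normedModType R[i]).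

Let pairing (T : blin E E) (mu : dual E) (x : E) : R[i]^o := mu (T x).

Lemma operator_pairing_rcvg (T : blin E E) (u : proj_tensor (dual E) E) :
  rcvg (fun n => tensor_eval (pairing T) (u n)) (operator_pairing T u).
Proof. by apply: cvgn_rcvg; exact: operator_pairing_cvg. Qed.

Lemma proj_norm_nil (u : seq (dual E * E)) :
  tensor_eq u [::] -> proj_norm u <= 0.
Proof.
move=> u0; apply: ge_inf.
  exists 0 => _ [v _ <-]; rewrite sumr_ge0// => p _.
  by rewrite mulr_ge0 ?rnorm_ge0.
by exists [::] => //; rewrite big_nil.
Qed.

Lemma elementary_tensor_cauchy (mu : dual E) (x : E) (e : R) : 0 < e ->
  exists N : nat, forall m n : nat, (N <= m)%N -> (N <= n)%N ->
  proj_norm (tensor_sub [:: (mu, x)] [:: (mu, x)]) < e.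
Proof.
move=> e0; exists 0%N => m n _ _; apply: le_lt_trans e0; apply: proj_norm_nil => B Bl.
by rewrite tensor_eval_sub// subrr /tensor_eval big_nil.
Qed.

Definition elementary_tensor (mu : dual E) (x : E) : proj_tensor (dual E) E :=
  @ProjTensor R (dual E) E (fun=> [:: (mu, x)]) (elementary_tensor_cauchy mu x).

Lemma operator_pairing_elementary (T : blin E E) mu x :
  operator_pairing T (elementary_tensor mu x) = mu (T x).
Proof.
apply: (rcvg_unique (operator_pairing_rcvg T _)) => e e0; exists 0%N => n _.
by rewrite /tensor_eval big_seq1 /pairing subrr rnorm0.
Qed.

Lemma operator_pairing_linear u : linear (@operator_pairing R E ^~ u).
Proof.
move=> c S T; apply: (rcvg_unique (operator_pairing_rcvg _ u)) => e e0.
have c0 : 0 < rnorm (c : R[i]^o) + 1 by rewrite ltr_wpDl ?rnorm_ge0.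
have e2 : 0 < e / 2 by rewrite divr_gt0.
have [N NP] := operator_pairing_rcvg S u (divr_gt0 e2 c0).
have [N' N'P] := operator_pairing_rcvg T u e2.
exists (maxn N N') => n; rewrite geq_max => /andP[/NP h /N'P h'].
rewrite (_ : tensor_eval (pairing (c *: S + T)) (u n) =
  c *: tensor_eval (pairing S) (u n) + tensor_eval (pairing T) (u n)); last first.
  rewrite /tensor_eval scaler_sumr -big_split /=; apply: eq_bigr => p _.
  rewrite /pairing -linearP; congr (p.1 _).
rewrite opprD addrACA -scalerBr (splitr e); apply: le_lt_trans (ler_rnormD _ _) _.
apply: ler_ltD => //; rewrite rnormZ; move: h; rewrite ltr_pdivlMr// => /ltW.
by apply: le_trans; rewrite mulrC ler_wpM2l ?rnorm_ge0// lerDl.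
Qed.

Variable A : dualBanachAlg R.
Variable pi : A -> blin E E.
Hypothesis lpi : linear pi.

Let pairing_linear u : linear (fun a => operator_pairing (pi a) u).
Proof. by move=> c a b; rewrite lpi operator_pairing_linear. Qed.

(** Testing on elementary tensors. *)
Lemma wstar_rep_normal : wstar_continuous predual_map (@operator_pairing R E) pi ->
  forall (mu : dual E) x, normal_functional (fun a => mu (pi a x)).
Proof.
move=> /(wstar_normal pairing_linear) cpi mu x.
have [z zE] := cpi (elementary_tensor mu x); exists z => a.
by rewrite -zE operator_pairing_elementary.
Qed.

(** Elements of the projective tensor product are limits of finite sums of
    elementary tensors, and for a bounded map this limit is uniform on the unit ball
    of A. *)
Lemma normal_rep_wstar (C : R) : (forall a, rnorm (pi a) <= C * rnorm a) ->
  (forall (mu : dual E) x, normal_functional (fun a => mu (pi a x))) ->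
  wstar_continuous predual_map (@operator_pairing R E) pi.
Proof.
move=> piC npi; apply/(wstar_normal pairing_linear) => u.
have C0 : 0 < `|C| + 1 by rewrite ltr_wpDl.
apply: normal_closed => e e0.
have [N NP] := proj_tensor_cauchy u (divr_gt0 e0 C0).
exists (fun a => tensor_eval (pairing (pi a)) (u N)).
  by apply: normal_sum => p; exact: npi.
move=> a; rewrite rnormB; apply/ler_addgt0Pr => d d0.
have [N' N'P] := operator_pairing_rcvg (pi a) u d0; pose n := maxn N N'.
rewrite -(subrK (tensor_eval (pairing (pi a)) (u n)) (tensor_eval _ (u N))) -addrA.
apply: le_trans (ler_rnormD _ _) _; apply: lerD; last first.
  by rewrite ltW// N'P// leq_maxr.
have Bl : bilinear_form (pairing (pi a)).
  by split=> [mu b x y|x b mu nu]; rewrite /pairing ?linearP.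
rewrite -tensor_eval_sub//.
have k0 : 0 <= (`|C| + 1) * rnorm a by rewrite mulr_ge0 ?rnorm_ge0 ?ltW.
apply: le_trans (ler_proj_norm _ Bl k0 _) _.
  move=> mu x; apply: le_trans (ler_blin _ _) _.
  rewrite mulrCA ler_wpM2l ?rnorm_ge0//; apply: le_trans (ler_blin _ _) _.
  rewrite ler_wpM2r ?rnorm_ge0//; apply: le_trans (piC a) _.
  by rewrite ler_wpM2r ?rnorm_ge0// ler_wpDr// ler_norm.
have := NP N n (leqnn _) (leq_maxl _ _); rewrite ltr_pdivlMr// => /ltW h.
by rewrite mulrAC ler_wpM2r ?rnorm_ge0// mulrC.
Qed.

(** Each coefficient a |-> mu (pi a x) is in the predual, hence bounded; uniform
    boundedness over the unit balls of E' and E does the rest. *)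
Lemma wstar_rep_bounded : wstar_continuous predual_map (@operator_pairing R E) pi ->
  exists C : R, forall a, rnorm (pi a) <= C * rnorm a.
Proof.
move=> /wstar_rep_normal npi.
have lcoef (mu : dual E) x : linear (fun a => mu (pi a x) : R[i]^o).
  by move=> c a b; rewrite lpi -linearP.
have bcoef (mu : dual E) x : exists M : R, forall a, rnorm (mu (pi a x)) <= M * rnorm a.
  have [z zE] := npi mu x; exists (rnorm z) => a; rewrite zE mulrC.
  exact: ler_predual_map.
pose J := {p : dual E * E | rnorm p.1 <= 1 /\ rnorm p.2 <= 1}.
pose f (j : J) : dual A := mkblin (lcoef (sval j).1 (sval j).2) (bcoef _ _).
have [|C CP] := uniform_boundedness (f := f) (@seq_complete_of_complete R A).
  move=> a; exists (rnorm (pi a)) => -[[mu x] /= [mu1 x1]].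
  apply: le_trans (ler_blin _ _) _; apply: le_trans (ler_piMl (rnorm_ge0 _) mu1) _.
  by apply: le_trans (ler_blin _ _) _; rewrite ler_piMr ?rnorm_ge0.
have C0 : 0 <= C.
  have p0 : rnorm (0 : dual E) <= 1 /\ rnorm (0 : E) <= 1 by rewrite !rnorm0.
  by apply: le_trans (CP (exist _ (0, 0) p0)); exact: rnorm_ge0.
exists C => a; apply: opnorm_le => x x1; apply: rnorm_le_dual => mu mu1.
have := ler_blin (f (exist _ (mu, x) (conj mu1 x1))) a => /le_trans; apply.
by rewrite ler_wpM2r ?rnorm_ge0.
Qed.

End operator_topology.

(** * Operators, subspaces and dual spaces as Banach spaces *)

Section bilinear_operators.
Variables (R : realType) (A E F : normedModType R[i]).
Variables (f : A -> E -> F) (C : R).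
Hypotheses (fl : forall a, linear (f a)) (fr : forall x, linear (f ^~ x)).
Hypothesis fC : forall a x, rnorm (f a x) <= C * rnorm a * rnorm x.

Let fbound a : exists M : R, forall x, rnorm (f a x) <= M * rnorm x.
Proof. by exists (C * rnorm a). Qed.

Let curry a : blin E F := mkblin (fl a) (fbound a).

Let curry_linear : linear curry.
Proof. by move=> c a b; apply: blinP => x; exact: fr. Qed.

Let curry_bound : exists M : R, forall a, rnorm (curry a) <= M * rnorm a.
Proof.
exists `|C| => a; apply: blin_norm_le => [|x]; first by rewrite mulr_ge0 ?rnorm_ge0.
apply: le_trans (fC a x) _; rewrite ler_wpM2r ?rnorm_ge0//.
by rewrite ler_wpM2r ?rnorm_ge0// ler_norm.
Qed.

Definition mkblin2 : blin A (blin E F) := mkblin curry_linear curry_bound.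

End bilinear_operators.

Record subspace (R : realType) (V : normedModType R[i]) := Subspace {
  spred :> {pred V};
  spred_closed : submod_closed spred }.

Section subspace_type.
Variables (R : realType) (V : normedModType R[i]) (S : subspace V).

HB.instance Definition _ :=
  GRing.isSubmodClosed.Build _ _ (spred S) (spred_closed S).

Record subsp := Subsp { subval :> V; _ : subval \in spred S }.

HB.instance Definition _ := [isSub for subval].
HB.instance Definition _ := [Choice of subsp by <:].
HB.instance Definition _ := [SubChoice_isSubLmodule of subsp by <:].

Definition subsp_norm (x : subsp) : R[i] := `|subval x|.

Lemma ler_subsp_normD x y : subsp_norm (x + y) <= subsp_norm x + subsp_norm y.
Proof. exact: ler_normD. Qed.

Lemma subsp_normZ (c : R[i]) x : subsp_norm (c *: x) = `|c| * subsp_norm x.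
Proof. exact: normrZ. Qed.

Lemma subsp_norm0_eq0 x : subsp_norm x = 0 -> x = 0.
Proof. by move=> /normr0_eq0 x0; exact: val_inj. Qed.

HB.instance Definition _ := Lmodule_isNormed.Build R[i] subsp
  ler_subsp_normD subsp_normZ subsp_norm0_eq0.

Lemma rnorm_subsp (x : subsp) : rnorm x = rnorm (subval x).
Proof. by []. Qed.

Lemma subvalP (x : subsp) : subval x \in spred S.
Proof. by case: x. Qed.

Lemma subval_linear : linear subval.
Proof. by []. Qed.

Lemma subsp_ext (x y : subsp) : subval x = subval y -> x = y.
Proof. exact: val_inj. Qed.

Lemma subsp_seq_complete : seq_complete V ->
  (forall u l, (forall n, u n \in spred S) -> rcvg u l -> l \in spred S) ->
  seq_complete subsp.
Proof.
move=> Vc Scl u uC; have [|l ul] := Vc (fun n => subval (u n)).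
  by move=> e /uC[N NP]; exists N => m n Nm Nn; exact: NP.
have lS : l \in spred S by apply: Scl ul => n; exact: subvalP.
by exists (Subsp lS) => e /ul[N NP]; exists N => n; exact: NP.
Qed.

End subspace_type.

Definition complete_pack (R : realType) (V : normedModType R[i])
    (h : seq_complete V) : completeNormedModType R[i] :=
  HB.pack (NormedModule.sort V) (NormedModule.class V)
    (Uniform_isComplete.Build (NormedModule.sort V) (complete_of_seq h)).

Lemma scalar_seq_complete (R : realType) : seq_complete (R[i]^o).
Proof.
move=> u uC; have /cvg_ex[l ul] := complex_cauchy_cvg uC.
by exists l; exact: cvgn_rcvg.
Qed.

(** The limit is pointwise; the Cauchy property makes the convergence uniform on
    bounded sets, which gives boundedness of the limit and convergence in norm. *)
Lemma dual_seq_complete (R : realType) (V : normedModType R[i]) :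
  seq_complete (dual V).
Proof.
move=> u uC; have /choice[l lP] : forall v, exists l, rcvg (fun n => u n v) l.
  move=> v; apply: scalar_seq_complete => e e0.
  have v0 : 0 < rnorm v + 1 by rewrite ltr_wpDl ?rnorm_ge0.
  have [N NP] := uC _ (divr_gt0 e0 v0); exists N => m n Nm Nn.
  have := NP m n Nm Nn; rewrite ltr_pdivlMr//; apply: le_lt_trans.
  rewrite [X in rnorm X](_ : _ = (u m - u n) v)//; apply: le_trans (ler_blin _ _) _.
  by rewrite ler_wpM2l ?rnorm_ge0// lerDl.
have near (e : R) : 0 < e -> exists N, forall n, (N <= n)%N ->
    forall v, rnorm (u n v - l v) <= e * rnorm v.
  move=> e0; have [N NP] := uC _ e0; exists N => n Nn v.
  apply/ler_addgt0Pr => d d0; have [N' N'P] := lP v _ d0; pose m := maxn N N'.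
  rewrite -(subrK (u m v) (u n v)) -addrA; apply: le_trans (ler_rnormD _ _) _.
  apply: lerD; last by rewrite ltW// N'P// leq_maxr.
  rewrite [X in rnorm X](_ : _ = (u n - u m) v)//; apply: le_trans (ler_blin _ _) _.
  by rewrite ler_wpM2r ?rnorm_ge0// ltW// NP// leq_maxl.
have ll : linear l.
  move=> c v w; apply: (rcvg_unique (lP _)) => e e0.
  have c0 : 0 < rnorm (c : R[i]^o) + 1 by rewrite ltr_wpDl ?rnorm_ge0.
  have e2 : 0 < e / 2 by rewrite divr_gt0.
  have [N NP] := lP v _ (divr_gt0 e2 c0); have [N' N'P] := lP w _ e2.
  exists (maxn N N') => n; rewrite geq_max => /andP[/NP h /N'P h'].
  rewrite linearP /= opprD addrACA -scalerBr (splitr e).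
  apply: le_lt_trans (ler_rnormD _ _) _; apply: ler_ltD => //; rewrite rnormZ.
  move: h; rewrite ltr_pdivlMr// => /ltW; apply: le_trans.
  by rewrite mulrC ler_wpM2l ?rnorm_ge0// lerDl.
have [N NP] := near _ ltr01.
have bl : exists M : R, forall v, rnorm (l v) <= M * rnorm v.
  exists (1 + rnorm (u N)) => v; rewrite -(subrK (u N v) (l v)) mulrDl.
  apply: le_trans (ler_rnormD _ _) _; rewrite rnormB; apply: lerD; first exact: NP.
  exact: ler_blin.
exists (mkblin ll bl) => e e0; have e2 : 0 < e / 2 by rewrite divr_gt0.
have [N' N'P] := near _ e2; exists N' => n Nn; apply: (@le_lt_trans _ _ (e / 2)); last by lra.
by apply: blin_norm_le => [|v]; [exact: ltW | exact: N'P].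
Qed.


(** * Connes-amenable algebras are injective *)

Section connes_amenability_to_expectation.
Variables (R : realType) (A : dualBanachAlg R) (E : normedModType R[i]).
Hypothesis Erefl : reflexive_space E.
Variable pi : A -> blin E E.
Hypotheses (lpi : linear pi) (piM : forall a b, pi (a *b b) = pi a \oB pi b).
Hypothesis pi_normal : forall (mu : dual E) x, normal_functional (fun a => mu (pi a x)).
Variable C : R.
Hypotheses (C0 : 0 <= C) (piC : forall a, rnorm (pi a) <= C * rnorm a).

Local Notation B := (blin E E).
Local Notation K := (commutant (range pi)).
Implicit Types (S T : B) (a b : A) (x : E) (mu : dual E).

Lemma commutantP T : K T -> forall a, T \oB pi a = pi a \oB T.
Proof. by move=> KT a; apply: KT; exists a. Qed.

(** Two operators that are bimodule maps over the commutant K and fix K pointwise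
    differ by an element of this space; a quasi-expectation is sought in the form
    id - Q. *)
Definition offset_pred : {pred blin B B} := fun Q =>
  `[< (forall c d T, K c -> K d -> Q (c \oB T \oB d) = c \oB Q T \oB d) /\
      (forall c, K c -> Q c = 0) >].

Lemma offset_closed : submod_closed offset_pred.
Proof.
split=> [|k Q Q' /asboolP[QM Q0] /asboolP[Q'M Q'0]]; apply/asboolP.
  have z T : (0 : blin B B) T = 0 by [].
  split=> [c d T _ _|c _]; last exact: z.
  by rewrite !z; apply: blinP => x /=; rewrite linear0.
have z T : (k *: Q + Q') T = k *: Q T + Q' T by [].
split=> [c d T Kc Kd|c Kc]; last by rewrite z Q0// Q'0// scaler0 addr0.
rewrite !z QM// Q'M//; apply: blinP => x /=.
by rewrite [RHS]linearP.
Qed.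

Definition offset_space : subspace (blin B B) := Subspace offset_closed.

Local Notation M := (subsp offset_space).

Lemma offsetM (Q : M) c d T : K c -> K d ->
  subval Q (c \oB T \oB d) = c \oB subval Q T \oB d.
Proof. by have := subvalP Q => /asboolP[h _]; exact: h. Qed.

Lemma offset0 (Q : M) c : K c -> subval Q c = 0.
Proof. by have := subvalP Q => /asboolP[_]; exact. Qed.

Lemma offset_linE k (Q Q' : M) T x :
  subval (k *: Q + Q') T x = k *: subval Q T x + subval Q' T x.
Proof.
exact: (etrans (congr1 (fun S : blin B B => S T x) (subval_linear k Q Q'))
  (etrans (congr1 (fun S : B => S x) (blin_linE k (subval Q) (subval Q') T))
    (blin_linE k (subval Q T) (subval Q' T) x))).
Qed.

Lemma rnorm_blin_comp (X Y Z : normedModType R[i]) (S : blin Y Z) (T : blin X Y) :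
  rnorm (S \oB T) <= rnorm S * rnorm T.
Proof.
apply: blin_norm_le => [|x]; first by rewrite mulr_ge0 ?rnorm_ge0.
apply: le_trans (ler_blin S (T x)) _; rewrite -mulrA.
by rewrite ler_wpM2l ?rnorm_ge0// ler_blin.
Qed.

(** The left and right action of a on an offset Q. They preserve the defining
    conditions because the elements of K commute with pi a. *)
Section actions.
Variables (a : A) (Q : M).

Let left_fun T : B := pi a \oB subval Q T.
Let right_fun T : B := subval Q T \oB pi a.

Let left_linear : linear left_fun.
Proof.
move=> k S T; apply: blinP => x; rewrite /left_fun /= linearP /=.
by rewrite [LHS]linearP.
Qed.

Let right_linear : linear right_fun.
Proof. by move=> k S T; apply: blinP => x; rewrite /right_fun /= linearP. Qed.

Let left_bound T : rnorm (left_fun T) <= rnorm (pi a) * rnorm Q * rnorm T.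
Proof.
apply: le_trans (rnorm_blin_comp _ _) _; rewrite -mulrA.
by rewrite ler_wpM2l ?rnorm_ge0//; exact: ler_blin.
Qed.

Let right_bound T : rnorm (right_fun T) <= rnorm (pi a) * rnorm Q * rnorm T.
Proof.
apply: le_trans (rnorm_blin_comp _ _) _; rewrite mulrC -mulrA.
by rewrite ler_wpM2l ?rnorm_ge0//; exact: ler_blin.
Qed.

Let left_blin : blin B B := mkblin left_linear (ex_intro _ _ left_bound).
Let right_blin : blin B B := mkblin right_linear (ex_intro _ _ right_bound).

Let left_in : left_blin \in offset_pred.
Proof.
apply/asboolP; split=> [c d T Kc Kd|c Kc]; apply: blinP => x /=.
  rewrite /left_fun offsetM// /=.
  by have := commutantP Kc a => /(congr1 (fun f : B => f (subval Q T (d x)))) /= ->.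
by rewrite /left_fun offset0//= linear0.
Qed.

Let right_in : right_blin \in offset_pred.
Proof.
apply/asboolP; split=> [c d T Kc Kd|c Kc]; apply: blinP => x /=.
  rewrite /right_fun offsetM// /=.
  by have := commutantP Kd a => /(congr1 (fun f : B => f x)) /= ->.
by rewrite /right_fun offset0.
Qed.

Definition offset_left : M := @Subsp R _ offset_space left_blin left_in.
Definition offset_right : M := @Subsp R _ offset_space right_blin right_in.

Lemma offset_leftE T x : subval offset_left T x = pi a (subval Q T x).
Proof. by []. Qed.

Lemma offset_rightE T x : subval offset_right T x = subval Q T (pi a x).
Proof. by []. Qed.

Lemma rnorm_offset_left : rnorm offset_left <= rnorm (pi a) * rnorm Q.
Proof. by apply: blin_norm_le => [|T]; [rewrite mulr_ge0 ?rnorm_ge0|exact: left_bound]. Qed.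

Lemma rnorm_offset_right : rnorm offset_right <= rnorm (pi a) * rnorm Q.
Proof. by apply: blin_norm_le => [|T]; [rewrite mulr_ge0 ?rnorm_ge0|exact: right_bound]. Qed.

End actions.

Lemma offset_ext (Q Q' : M) : (forall T x, subval Q T x = subval Q' T x) -> Q = Q'.
Proof. by move=> h; apply: val_inj; apply: blinP => T; apply: blinP => x; exact: h. Qed.

(** This is a . id - id . a. The identity does not vanish on K, hence is not an
    offset, but the commutator with pi a is: this is a derivation that need not be
    inner for trivial reasons. *)
Section commutator.
Variable a : A.

Let comm_fun T : B := (pi a \oB T) - (T \oB pi a).

Let commE T x : comm_fun T x = pi a (T x) - T (pi a x).
Proof. by []. Qed.

Let comm_linear : linear comm_fun.
Proof.
move=> k S T; apply: blinP => x; rewrite /comm_fun.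
rewrite !(blinDE, blinZE, blinBE, blin_compE) linearP /=.
by rewrite opprD addrACA scalerBr.
Qed.

Let comm_bound T : rnorm (comm_fun T) <= 2 * rnorm (pi a) * rnorm T.
Proof.
apply: le_trans (ler_rnormD _ _) _; rewrite rnormN.
have h1 := rnorm_blin_comp (pi a) T; have h2 := rnorm_blin_comp T (pi a).
by rewrite mulrC in h2; lra.
Qed.

Let comm_blin : blin B B := mkblin comm_linear (ex_intro _ _ comm_bound).

Let comm_in : comm_blin \in offset_pred.
Proof.
apply/asboolP; split=> [c d T Kc Kd|c Kc]; apply: blinP => x.
  rewrite [LHS](commE (c \oB T \oB d) x) [RHS](_ : _ = c (comm_fun T (d x)))//.
  rewrite commE !blin_compE.
  have /(congr1 (fun f : B => f (T (d x)))) /= <- := commutantP Kc a.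
  have /(congr1 (fun f : B => f x)) /= -> := commutantP Kd a.
  by rewrite linearB.
rewrite [LHS](commE c x).
have /(congr1 (fun f : B => f x)) /= -> := commutantP Kc a.
by rewrite subrr.
Qed.

Definition commutator : M := @Subsp R _ offset_space comm_blin comm_in.

Lemma commutatorE T x : subval commutator T x = pi a (T x) - T (pi a x).
Proof. by []. Qed.

Lemma rnorm_commutator : rnorm commutator <= 2 * C * rnorm a.
Proof.
apply: (@le_trans _ _ (2 * rnorm (pi a))); last by have := piC a; lra.
by apply: blin_norm_le => [|T]; [rewrite mulr_ge0 ?rnorm_ge0|exact: comm_bound].
Qed.

End commutator.

(** The closed span of these functionals is a predual of the space M of offsets. *)
Section point_functional.
Variables (mu : dual E) (T : B) (x : E).

Let pf_fun (Q : M) : R[i]^o := mu (subval Q T x).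

Let pf_linear : linear pf_fun.
Proof.
move=> k Q Q'.
exact: (etrans (congr1 mu (offset_linE k Q Q' T x)) (blin_linear mu k _ _)).
Qed.

Lemma pf_bound Q : rnorm (pf_fun Q) <= rnorm mu * rnorm T * rnorm x * rnorm Q.
Proof.
have h1 := ler_blin (subval Q T) x; have h2 := ler_blin (subval Q) T.
apply: le_trans (ler_blin mu _) _; rewrite -!mulrA ler_wpM2l ?rnorm_ge0//.
apply: le_trans h1 _; rewrite mulrA mulrAC [_ * rnorm Q]mulrC.
by rewrite ler_wpM2r ?rnorm_ge0.
Qed.

Definition point_functional : dual M := mkblin pf_linear (ex_intro _ _ pf_bound).

Lemma rnorm_point_functional :
  rnorm point_functional <= rnorm mu * rnorm T * rnorm x.
Proof.
by apply: blin_norm_le => [|Q]; [rewrite !mulr_ge0 ?rnorm_ge0|exact: pf_bound].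
Qed.

End point_functional.


Implicit Types (Q : M).

Let left_op_linear a : linear (offset_left a).
Proof.
move=> k Q Q'; apply: offset_ext => T x.
apply: (etrans (offset_leftE a (k *: Q + Q') T x)).
apply: (etrans (congr1 (pi a) (offset_linE k Q Q' T x))).
apply: (etrans (blin_linear (pi a) k _ _)); apply: esym.
exact: (offset_linE k (offset_left a Q) (offset_left a Q') T x).
Qed.

Let right_op_linear a : linear (offset_right a).
Proof.
move=> k Q Q'; apply: offset_ext => T x.
apply: (etrans (offset_rightE a (k *: Q + Q') T x)).
apply: (etrans (offset_linE k Q Q' T (pi a x))); apply: esym.
exact: (offset_linE k (offset_right a Q) (offset_right a Q') T x).
Qed.

Definition left_op a : blin M M :=
  mkblin (left_op_linear a) (ex_intro _ _ (rnorm_offset_left a)).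

Definition right_op a : blin M M :=
  mkblin (right_op_linear a) (ex_intro _ _ (rnorm_offset_right a)).

Lemma rnorm_left_op a : rnorm (left_op a) <= C * rnorm a.
Proof.
apply: blin_norm_le => [|Q]; first by rewrite mulr_ge0 ?rnorm_ge0.
apply: le_trans (rnorm_offset_left a Q) _.
by rewrite ler_wpM2r ?rnorm_ge0.
Qed.

Lemma rnorm_right_op a : rnorm (right_op a) <= C * rnorm a.
Proof.
apply: blin_norm_le => [|Q]; first by rewrite mulr_ge0 ?rnorm_ge0.
apply: le_trans (rnorm_offset_right a Q) _.
by rewrite ler_wpM2r ?rnorm_ge0.
Qed.

Definition tensor_fun (l : seq (dual E * (B * E))) : dual M :=
  \sum_(p <- l) point_functional p.1 p.2.1 p.2.2.

Definition offset_predual_pred : {pred dual M} := fun Psi =>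
  `[< forall e : R, 0 < e -> exists l, rnorm (Psi - tensor_fun l) <= e >].

Lemma point_functionalZ k mu T x :
  k *: point_functional mu T x = point_functional (k *: mu) T x.
Proof. exact: blinP. Qed.

Lemma offset_predual_closed : submod_closed offset_predual_pred.
Proof.
split=> [|k Psi Psi' /asboolP hP /asboolP hP']; apply/asboolP => e e0.
  by exists [::]; rewrite /tensor_fun big_nil subrr rnorm0 ltW.
have k0 : 0 < rnorm (k : R[i]^o) + 1 by rewrite ltr_wpDl ?rnorm_ge0.
have e2 : 0 < e / 2 by rewrite divr_gt0.
have [l lP] := hP _ (divr_gt0 e2 k0); have [l' l'P] := hP' _ e2.
exists ([seq (k *: p.1, p.2) | p <- l] ++ l').
have -> : tensor_fun ([seq (k *: p.1, p.2) | p <- l] ++ l') = k *: tensor_fun l + tensor_fun l'.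
  rewrite /tensor_fun big_cat big_map scaler_sumr; congr (_ + _).
  by apply: eq_bigr => p _; rewrite point_functionalZ.
rewrite opprD addrACA -scalerBr (splitr e); apply: le_trans (ler_rnormD _ _) _.
apply: lerD => //; rewrite rnormZ; move: lP; rewrite ler_pdivlMr//.
by apply: le_trans; rewrite mulrC ler_wpM2l ?rnorm_ge0// lerDl.
Qed.

Definition offset_predual : subspace (dual M) := Subspace offset_predual_closed.

Local Notation F0 := (subsp offset_predual).

Lemma offset_predual_seq_complete : seq_complete F0.
Proof.
apply: subsp_seq_complete; first exact: dual_seq_complete.
move=> u l uP ul; apply/asboolP => e e0; have e2 : 0 < e / 2 by rewrite divr_gt0.
have [N NP] := ul _ e2; have /asboolP/(_ _ e2)[t tP] := uP N; exists t.
rewrite -(subrK (u N) l) -addrA (splitr e); apply: le_trans (ler_rnormD _ _) _.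
by rewrite lerD// rnormB ltW// NP.
Qed.

Lemma offset_predual_dense (Psi : F0) (e : R) : 0 < e ->
  exists l, rnorm (subval (Psi : F0) - tensor_fun l) <= e.
Proof. by move=> e0; have /asboolP := subvalP (Psi : F0); apply. Qed.

Lemma tensor_fun_in l : tensor_fun l \in offset_predual_pred.
Proof. by apply/asboolP => e e0; exists l; rewrite subrr rnorm0 ltW. Qed.

Definition tensor l : F0 := (@Subsp R _ offset_predual _ (tensor_fun_in l) : F0).

Definition point mu T x : F0 := tensor [:: (mu, (T, x))].

Lemma pointE mu T x Q : subval (point mu T x : F0) Q = mu (subval Q T x).
Proof. by rewrite /= /tensor_fun big_seq1. Qed.

Lemma offset_predual_ext (Psi Psi' : F0) :
  (forall Q, subval (Psi : F0) Q = subval (Psi' : F0) Q) -> Psi = Psi'.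
Proof. by move=> h; apply: (@val_inj _ _ F0); apply: blinP. Qed.

Lemma offset_predual_linE k (Psi Psi' : F0) Q :
  subval (k *: Psi + Psi') Q = k *: subval Psi Q + subval Psi' Q.
Proof.
exact: (etrans (congr1 (fun f : dual M => f Q) (subval_linear k Psi Psi'))
  (blin_linE k (subval Psi) (subval Psi') Q)).
Qed.

Lemma tensor_cons mu T x l : tensor ((mu, (T, x)) :: l) = point mu T x + tensor l.
Proof.
apply: (@subsp_ext _ _ offset_predual).
have h : tensor_fun ((mu, (T, x)) :: l) = tensor_fun [:: (mu, (T, x))] + tensor_fun l.
  by rewrite /tensor_fun !big_cons big_nil addr0.
exact: (etrans h (esym (linear_funD (@subval_linear R _ offset_predual)
  (tensor [:: (mu, (T, x))] : F0) (tensor l : F0)))).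
Qed.

Lemma rnorm_point mu T x : rnorm (point mu T x) <= rnorm mu * rnorm T * rnorm x.
Proof.
have h : subval (point mu T x : F0) = point_functional mu T x.
  by rewrite /= /tensor_fun big_seq1.
have : rnorm (subval (point mu T x : F0)) <= rnorm mu * rnorm T * rnorm x.
  by rewrite h; exact: rnorm_point_functional.
exact.
Qed.

(** Operators on M whose adjoint maps point functionals to point functionals act on
    the predual of M. *)
Section precomposition.
Variable D : blin M M.
Hypothesis Dpoint : forall mu T x, exists p : dual E * (B * E), forall Q,
  mu (subval (D Q) T x) = p.1 (subval Q p.2.1 p.2.2).

Lemma precomp_in (Psi : F0) : (subval Psi \oB D : dual M) \in offset_predual_pred.
Proof.
apply/asboolP => e e0; have D0 : 0 < rnorm D + 1 by rewrite ltr_wpDl ?rnorm_ge0.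
have [l lP] := offset_predual_dense Psi (divr_gt0 e0 D0).
have [t tE] : exists t, (tensor_fun l \oB D : dual M) = tensor_fun t.
  elim: (l) => [|[mu [T x]] m [t tE]].
    by exists [::]; apply: blinP => Q; rewrite /tensor_fun /= !big_nil.
  have [p pE] := Dpoint mu T x; exists (p :: t).
  rewrite /tensor_fun !big_cons -/(tensor_fun t) -tE.
  apply: blinP => Q.
  exact: (congr1 (fun z => z + tensor_fun m (D Q)) (pE Q)).
exists t; rewrite -tE.
have -> : (subval Psi \oB D : dual M) - (tensor_fun l \oB D : dual M) =
   (subval Psi - tensor_fun l) \oB D by exact: blinP.
apply: le_trans (rnorm_blin_comp _ _) _.
move: lP; rewrite ler_pdivlMr//; apply: le_trans.
by rewrite ler_wpM2l ?rnorm_ge0// lerDl.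
Qed.

Definition precomp (Psi : F0) : F0 :=
  (@Subsp R _ offset_predual _ (precomp_in (Psi : F0)) : F0).

Lemma precompE Psi Q : subval (precomp Psi : F0) Q = subval (Psi : F0) (D Q).
Proof. by []. Qed.

Lemma precomp_linear : linear precomp.
Proof.
move=> k Psi Psi'; apply: offset_predual_ext => Q.
apply: (etrans (precompE (k *: Psi + Psi') Q)).
apply: (etrans (offset_predual_linE k Psi Psi' (D Q))); apply: esym.
exact: (offset_predual_linE k (precomp Psi) (precomp Psi') Q).
Qed.

Lemma rnorm_precomp Psi : rnorm (precomp Psi) <= rnorm D * rnorm Psi.
Proof. by rewrite mulrC; exact: (rnorm_blin_comp (subval (Psi : F0)) D). Qed.

End precomposition.

Lemma left_op_point a mu T x : exists p : dual E * (B * E), forall Q,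
  mu (subval (left_op a Q) T x) = p.1 (subval Q p.2.1 p.2.2).
Proof. by exists (mu \oB pi a : dual E, (T, x)). Qed.

Lemma right_op_point a mu T x : exists p : dual E * (B * E), forall Q,
  mu (subval (right_op a Q) T x) = p.1 (subval Q p.2.1 p.2.2).
Proof. by exists (mu, (T, pi a x)). Qed.

Let ract_fun a (Psi : F0) : F0 := precomp (left_op_point a) Psi.
Let lact_fun a (Psi : F0) : F0 := precomp (right_op_point a) Psi.

Let ract_linear Psi : linear (ract_fun ^~ Psi).
Proof.
move=> k a b; apply: offset_predual_ext => Q.
have h : left_op (k *: a + b) Q = k *: left_op a Q + left_op b Q.
  apply: offset_ext => T x.
  apply: (etrans (offset_leftE _ Q T x)); apply: esym.
  apply: (etrans (offset_linE k (left_op a Q) (left_op b Q) T x)).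
  exact: (esym (congr1 (fun S : B => S (subval Q T x)) (lpi k a b))).
apply: (etrans (congr1 (subval Psi) h)); apply: (etrans (blin_linear (subval Psi) k _ _)).
exact: (esym (offset_predual_linE k (ract_fun a Psi) (ract_fun b Psi) Q)).
Qed.

Let lact_linear Psi : linear (lact_fun ^~ Psi).
Proof.
move=> k a b; apply: offset_predual_ext => Q.
have h : right_op (k *: a + b) Q = k *: right_op a Q + right_op b Q.
  apply: offset_ext => T x.
  apply: (etrans (offset_rightE _ Q T x)); apply: esym.
  apply: (etrans (offset_linE k (right_op a Q) (right_op b Q) T x)).
  apply: (etrans (esym (blin_linear (subval Q T) k (pi a x) (pi b x)))).
  exact: (esym (congr1 (fun S : B => subval Q T (S x)) (lpi k a b))).
apply: (etrans (congr1 (subval Psi) h)); apply: (etrans (blin_linear (subval Psi) k _ _)).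
exact: (esym (offset_predual_linE k (lact_fun a Psi) (lact_fun b Psi) Q)).
Qed.

Let ract_bound a Psi : rnorm (ract_fun a Psi) <= C * rnorm a * rnorm Psi.
Proof.
apply: le_trans (rnorm_precomp _ _) _.
by rewrite ler_wpM2r ?rnorm_ge0// rnorm_left_op.
Qed.

Let lact_bound a Psi : rnorm (lact_fun a Psi) <= C * rnorm a * rnorm Psi.
Proof.
apply: le_trans (rnorm_precomp _ _) _.
by rewrite ler_wpM2r ?rnorm_ge0// rnorm_right_op.
Qed.

Let lact_op : blin A (blin F0 F0) :=
  mkblin2 (fun a => precomp_linear (right_op_point a)) lact_linear lact_bound.
Let ract_op : blin A (blin F0 F0) :=
  mkblin2 (fun a => precomp_linear (left_op_point a)) ract_linear ract_bound.

Let lact_mul a b (Psi : F0) : lact_op (a *b b) Psi = lact_op a (lact_op b Psi).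
Proof.
apply: offset_predual_ext => Q.
have h : right_op (a *b b) Q = right_op b (right_op a Q).
  apply: offset_ext => T x.
  exact: (congr1 (fun S : B => subval Q T (S x)) (piM a b)).
exact: (congr1 (subval Psi) h).
Qed.

Let ract_mul a b (Psi : F0) : ract_op (a *b b) Psi = ract_op b (ract_op a Psi).
Proof.
apply: offset_predual_ext => Q.
have h : left_op (a *b b) Q = left_op a (left_op b Q).
  apply: offset_ext => T x.
  exact: (congr1 (fun S : B => S (subval Q T x)) (piM a b)).
exact: (congr1 (subval Psi) h).
Qed.

Let lract_assoc a b (Psi : F0) : ract_op b (lact_op a Psi) = lact_op a (ract_op b Psi).
Proof.
apply: offset_predual_ext => Q.
have h : right_op a (left_op b Q) = left_op b (right_op a Q) by exact: offset_ext.
exact: (congr1 (subval Psi) h).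
Qed.

Definition offset_predual_banach : completeNormedModType R[i] :=
  complete_pack offset_predual_seq_complete.

(** Its dual is M with the two actions above, as shown by functional_operatorE. *)
Definition offset_bimodule : banachBimodule A :=
  @BanachBimodule R A offset_predual_banach lact_op ract_op lact_mul ract_mul lract_assoc.

Lemma point_op_right a mu T x : lact_op a (point mu T x) = point mu T (pi a x).
Proof.
apply: offset_predual_ext => Q.
exact: (etrans (pointE mu T x (right_op a Q)) (esym (pointE mu T (pi a x) Q))).
Qed.

Lemma point_op_left a mu T x :
  ract_op a (point mu T x) = point (mu \oB pi a : dual E) T x.
Proof.
apply: offset_predual_ext => Q.
exact: (etrans (pointE mu T x (left_op a Q)) (esym (pointE (mu \oB pi a : dual E) T x Q))).
Qed.

Lemma point_linear_l T x : linear (fun mu => point mu T x).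
Proof.
move=> k mu mu'; apply: offset_predual_ext => Q; apply: (etrans (pointE _ T x Q)).
apply: esym; apply: (etrans (offset_predual_linE k _ _ Q)).
by rewrite !pointE.
Qed.

Lemma point_linear_m mu x : linear (fun T => point mu T x).
Proof.
move=> k S T; apply: offset_predual_ext => Q; apply: (etrans (pointE _ _ x Q)).
apply: esym; apply: (etrans (offset_predual_linE k _ _ Q)).
rewrite !pointE; apply: (etrans (esym (blin_linear mu k _ _))).
apply: (congr1 mu); apply: (etrans (esym (blin_linE k _ _ x))).
exact: (congr1 (fun U : B => U x) (esym (blin_linear (subval Q) k S T))).
Qed.

Lemma point_linear_r mu T : linear (point mu T).
Proof.
move=> k x y; apply: offset_predual_ext => Q; apply: (etrans (pointE _ _ _ Q)).
apply: esym; apply: (etrans (offset_predual_linE k _ _ Q)).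
rewrite !pointE; apply: (etrans (esym (blin_linear mu k _ _))).
by apply: (congr1 mu); exact: (esym (blin_linear (subval Q T) k x y)).
Qed.

(** Weak* continuity is checked on the point functionals, as these have dense span. *)
Lemma offset_predual_normal (f : A -> dual F0) (D : R) : 0 <= D ->
  (forall a, rnorm (f a) <= D * rnorm a) ->
  (forall mu T x, normal_functional (fun a => f a (point mu T x))) ->
  forall Psi, normal_functional (fun a => f a Psi).
Proof.
move=> D0 fD fp Psi; apply: normal_closed => e e0.
have D1 : 0 < D + 1 by rewrite ltr_wpDl.
have [l lP] := offset_predual_dense Psi (divr_gt0 e0 D1).
exists (fun a => f a (tensor l)).
  elim: (l) => [|[mu [T x]] m IH].
    have t0 : tensor [::] = 0.
      apply: (@subsp_ext _ _ offset_predual).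
      by have : tensor_fun [::] = 0 by rewrite /tensor_fun big_nil.
    have [z zE] := @normal_zero R A; exists z => a; rewrite -zE t0.
    exact: linear0.
  have [z zE] := normal_add (fp mu T x) IH; exists z => a; rewrite -zE tensor_cons.
  exact: linear_funD (blin_linear (f a)) _ _.
move=> a; rewrite -(linear_funB (blin_linear (f a))).
apply: le_trans (ler_blin (f a) _) _.
have h : rnorm (Psi - tensor l) <= e / (D + 1).
  apply: le_trans lP; rewrite rnorm_subsp.
  by rewrite (linear_funB (@subval_linear R _ offset_predual)).
apply: le_trans (ler_pM (rnorm_ge0 _) (rnorm_ge0 _) (fD a) h) _.
rewrite mulrAC ler_wpM2r ?rnorm_ge0// mulrA ler_pdivrMr// mulrC.
by rewrite ler_wpM2l ?(ltW e0)// lerDl.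
Qed.

(** A functional Phi on the predual gives, for fixed T and x, a functional
    mu |-> Phi (point mu T x) on E', hence by reflexivity a vector of E: this is the
    value at x of the image of T under an operator on B(E). *)
Section functional_operator.
Variable Phi : dual F0.

Let q_exists p : exists y, forall mu, Phi (point mu p.1 p.2) = mu y.
Proof.
case: p => T x /=.
have lin : linear (fun mu => Phi (point mu T x) : R[i]^o).
  by move=> k mu mu'; rewrite point_linear_l; exact: (blin_linear Phi).
have bnd : exists N : R, forall mu, rnorm (Phi (point mu T x)) <= N * rnorm mu.
  exists (rnorm Phi * (rnorm T * rnorm x)) => mu.
  apply: le_trans (ler_blin Phi _) _; rewrite -mulrA ler_wpM2l ?rnorm_ge0//.
  by apply: le_trans (rnorm_point mu T x) _; rewrite -mulrA mulrC.
by have [y yE] := Erefl (mkblin lin bnd); exists y => mu; rewrite -yE.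
Qed.

Let q T x : E := projT1 (cid (q_exists (T, x))).

Let qE mu T x : Phi (point mu T x) = mu (q T x).
Proof. exact: (projT2 (cid (q_exists (T, x)))). Qed.

Let q_linear T : linear (q T).
Proof.
move=> k x y; apply: dual_separates => mu.
rewrite -qE point_linear_r (blin_linear Phi) !qE.
exact: (esym (blin_linear mu k _ _)).
Qed.

Let q_linearl x : linear (q ^~ x).
Proof.
move=> k S T; apply: dual_separates => mu.
rewrite -qE point_linear_m (blin_linear Phi) !qE.
exact: (esym (blin_linear mu k _ _)).
Qed.

Let q_bound T x : rnorm (q T x) <= rnorm Phi * rnorm T * rnorm x.
Proof.
apply: rnorm_le_dual => mu mu1; rewrite -qE; apply: le_trans (ler_blin Phi _) _.
rewrite -mulrA ler_wpM2l ?rnorm_ge0//; apply: le_trans (rnorm_point mu T x) _.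
by rewrite -mulrA ler_piMl// mulr_ge0 ?rnorm_ge0.
Qed.

Definition functional_operator : blin B B := mkblin2 q_linear q_linearl q_bound.

Lemma functional_operatorE mu T x :
  Phi (point mu T x) = mu (functional_operator T x).
Proof. exact: qE. Qed.

Lemma functional_operatorM c T d : K c -> K d ->
  functional_operator (c \oB T \oB d) = c \oB functional_operator T \oB d.
Proof.
move=> Kc Kd; apply: blinP => x; apply: dual_separates => mu.
rewrite -functional_operatorE.
have -> : point mu (c \oB T \oB d) x = point (mu \oB c : dual E) T (d x).
  apply: offset_predual_ext => Q; apply: (etrans (pointE _ _ _ Q)); apply: esym.
  apply: (etrans (pointE _ _ _ Q)).
  exact: (congr1 (fun S : B => mu (S x)) (esym (offsetM Q T Kc Kd))).
exact: functional_operatorE.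
Qed.

Lemma functional_operator0 c : K c -> functional_operator c = 0.
Proof.
move=> Kc; apply: blinP => x; apply: dual_separates => mu.
rewrite -functional_operatorE.
have -> : point mu c x = 0.
  apply: offset_predual_ext => Q; apply: (etrans (pointE _ _ _ Q)).
  apply: (etrans (congr1 (fun S : B => mu (S x)) (offset0 Q Kc))).
  exact: linear0.
rewrite (linear_fun0 (blin_linear Phi)); apply: esym; exact: linear0.
Qed.

Lemma left_normal Psi : normal_functional (fun a => Phi (ract_op a Psi)).
Proof.
apply: (@offset_predual_normal (fun a => Phi \oB ract_op a : dual F0) (rnorm Phi * rnorm ract_op)).
- by rewrite mulr_ge0 ?rnorm_ge0.
- move=> a; apply: le_trans (rnorm_blin_comp _ _) _.
  by rewrite -mulrA ler_wpM2l ?rnorm_ge0// ler_blin.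
- move=> mu T x; have [z zE] := pi_normal mu (functional_operator T x).
  exists z => a; rewrite -zE; apply: (etrans (congr1 Phi (point_op_left a mu T x))).
  exact: functional_operatorE.
Qed.

Lemma right_normal Psi : normal_functional (fun a => Phi (lact_op a Psi)).
Proof.
apply: (@offset_predual_normal (fun a => Phi \oB lact_op a : dual F0) (rnorm Phi * rnorm lact_op)).
- by rewrite mulr_ge0 ?rnorm_ge0.
- move=> a; apply: le_trans (rnorm_blin_comp _ _) _.
  by rewrite -mulrA ler_wpM2l ?rnorm_ge0// ler_blin.
- move=> mu T x; have [z zE] := pi_normal (mu \oB functional_operator T : dual E) x.
  exists z => a; rewrite -zE; apply: (etrans (congr1 Phi (point_op_right a mu T x))).
  exact: functional_operatorE.
Qed.

End functional_operator.

Lemma offset_bimodule_normal : normal_dual offset_bimodule.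
Proof.
move=> Phi; split; apply/wstar_normal.
- move=> Psi k a b; rewrite /dual_pairing /dual_lact !blin_compE.
  apply: (etrans (congr1 (Phi : dual F0) (ract_linear Psi k a b))).
  exact: (blin_linear (Phi : dual F0)).
- exact: (left_normal (Phi : dual F0)).
- move=> Psi k a b; rewrite /dual_pairing /dual_ract !blin_compE.
  apply: (etrans (congr1 (Phi : dual F0) (lact_linear Psi k a b))).
  exact: (blin_linear (Phi : dual F0)).
- exact: (right_normal (Phi : dual F0)).
Qed.

Let commutator_linear : linear commutator.
Proof.
move=> k a b; apply: offset_ext => T x; apply: (etrans (commutatorE _ T x)).
apply: esym; apply: (etrans (offset_linE k (commutator a) (commutator b) T x)).
rewrite !commutatorE lpi !blin_linE (blin_linear T) scalerBr.
by rewrite opprD addrACA.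
Qed.

Let der_linearr a : linear (fun Psi : F0 => subval Psi (commutator a) : R[i]^o).
Proof. by move=> k Psi Psi'; exact: offset_predual_linE. Qed.

Let der_linearl (Psi : F0) : linear (fun a => subval Psi (commutator a) : R[i]^o).
Proof.
move=> k a b; apply: (etrans (congr1 (subval Psi) (commutator_linear k a b))).
exact: (blin_linear (subval Psi)).
Qed.

Let der_bound a (Psi : F0) :
  rnorm (subval Psi (commutator a) : R[i]^o) <= 2 * C * rnorm a * rnorm Psi.
Proof.
apply: le_trans (ler_blin (subval Psi) _) _; rewrite mulrC.
by rewrite ler_wpM2r ?rnorm_ge0//; exact: rnorm_commutator.
Qed.

Definition commutator_derivation : blin A (dual F0) :=
  mkblin2 der_linearr der_linearl der_bound.

Lemma commutator_derivation_is :
  is_derivation (F := offset_bimodule) commutator_derivation.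
Proof.
move=> a b; apply: (@blinP _ F0 (R[i]^o)) => Psi.
have h : commutator (a *b b) = left_op a (commutator b) + right_op b (commutator a).
  apply: offset_ext => T x; apply: (etrans (commutatorE _ T x)); apply: esym.
  have h1 := linear_funD (@subval_linear R _ offset_space)
    (left_op a (commutator b)) (right_op b (commutator a)).
  apply: (etrans (congr1 (fun S : blin B B => S T x) h1)).
  apply: (@etrans _ _ (pi a (pi b (T x) - T (pi b x)) + (pi a (T (pi b x)) - T (pi a (pi b x))))).
    by [].
  by rewrite linearB piM !blin_compE addrA subrK.
apply: (etrans (congr1 (subval (Psi : F0)) h)).
exact: (linear_funD (blin_linear (subval (Psi : F0)))).
Qed.

Lemma commutator_derivation_normal :
  wstar_continuous predual_map (@dual_pairing R offset_bimodule) commutator_derivation.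
Proof.
apply/wstar_normal => [Psi|Psi]; first exact: der_linearl.
apply: (@offset_predual_normal commutator_derivation (rnorm commutator_derivation)).
- exact: rnorm_ge0.
- by move=> a; exact: ler_blin.
- move=> mu T x.
  have [z zE] := normal_linear (-1) (pi_normal (mu \oB T : dual E) x) (pi_normal mu (T x)).
  exists z => a; rewrite -zE; apply: (etrans (pointE mu T x (commutator a))).
  apply: (etrans (congr1 mu (commutatorE a T x))).
  by rewrite (linear_funB (blin_linear mu)) scaleN1r addrC.
Qed.

(** An implementing functional for the commutator derivation is an offset q with
    a . (id - q) = (id - q) . a, which says that id - q takes values in K. *)
Lemma connes_amenable_expectation : connes_amenable A ->
  exists Q : blin B B, quasi_expectation (range pi) Q.
Proof.
move=> cA; have [Phi PhiE] := cA offset_bimodule offset_bimodule_normal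
  commutator_derivation commutator_derivation_is commutator_derivation_normal.
pose q := functional_operator (Phi : dual F0).
have key a T x : pi a (T x - q T x) = T (pi a x) - q T (pi a x).
  apply: dual_separates => mu.
  have /(congr1 (fun f : dual F0 => f (point mu T x))) h := PhiE a.
  have h1 : commutator_derivation a (point mu T x) = mu (pi a (T x)) - mu (T (pi a x)).
    apply: (etrans (pointE mu T x (commutator a))).
    apply: (etrans (congr1 mu (commutatorE a T x))).
    exact: (linear_funB (blin_linear mu)).
  have h2 : (Phi : dual F0) (ract_op a (point mu T x)) = mu (pi a (q T x)).
    by rewrite point_op_left functional_operatorE.
  have h3 : (Phi : dual F0) (lact_op a (point mu T x)) = mu (q T (pi a x)).
    by rewrite point_op_right functional_operatorE.
  have {}h : mu (pi a (T x)) - mu (T (pi a x)) = mu (pi a (q T x)) - mu (q T (pi a x)).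
    exact: (etrans (esym h1) (etrans h (congr2 (fun u v : R[i]^o => u - v) h2 h3))).
  rewrite (linear_funB (blin_linear (pi a))) !(linear_funB (blin_linear mu)).
  have alg (r s t u : R[i]) : r - s = t - u -> r - t = s - u.
    by move=> rs; rewrite (_ : r = t - u + s); [ring | rewrite -rs; ring].
  exact: alg.
pose Q : blin B B := blin_id B - q.
have QE T : Q T = T - q T by [].
have QK T : K (Q T).
  move=> _ [a _ <-]; apply: blinP => x; apply: esym; rewrite !blin_compE QE.
  exact: key.
have Qid c : K c -> Q c = c by move=> Kc; rewrite QE functional_operator0// subr0.
exists Q; split.
- apply/seteqP; split=> [_ [T _ <-]|c Kc]; first exact: QK.
  by exists c => //; exact: Qid.
- by move=> T; rewrite Qid.
- move=> c d T Kc Kd; rewrite !QE functional_operatorM//; apply: blinP => x.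
  by rewrite !(blinBE, blin_compE) linearB.
Qed.

End connes_amenability_to_expectation.

Theorem connes_amenable_injective (R : realType) (A : dualBanachAlg R) (e : A) :
  connes_amenable A -> injective_dba e.
Proof.
move=> cA E Erefl pi [lpi piM _] cpi.
have npi := wstar_rep_normal lpi cpi.
have [C CP] := wstar_rep_bounded lpi cpi.
apply: (@connes_amenable_expectation R A E Erefl pi lpi piM npi `|C|) => // a.
by apply: le_trans (CP a) _; rewrite ler_wpM2r ?rnorm_ge0// ler_norm.
Qed.

(** * Hilbertian sums of seminorms *)

Lemma ler_sum_uniq (R : realType) (T : eqType) (r s : seq T) (f : T -> R) : uniq r ->
  {subset r <= s} -> (forall x, 0 <= f x) ->
  \sum_(x <- r) f x <= \sum_(x <- s) f x.
Proof.
move=> ur rs f0; have pe : perm_eq r [seq x <- undup s | x \in r].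
  apply: uniq_perm => //; first by rewrite filter_uniq// undup_uniq.
  move=> x; rewrite mem_filter mem_undup; apply/idP/andP => [xr|[]//].
  by rewrite xr rs.
rewrite (perm_big _ pe) big_filter.
apply: (@le_trans _ _ (\sum_(x <- undup s) f x)).
  by rewrite [leRHS](bigID (fun x => x \in r)) /= lerDl sumr_ge0.
elim: s {rs pe} => [|x s IH] //=; case: ifP => _; rewrite !big_cons ?lerD2l//.
by apply: le_trans IH _; rewrite lerDr.
Qed.

Record seminorm_family (R : realType) (V : lmodType R[i]) (J : choiceType) :=
  SeminormFamily {
    fam :> J -> V -> R;
    fam_seminorm : forall j, seminorm (fam j);
    fam_separating : forall v, (forall j, fam j v = 0) -> v = 0 }.

Section hilbert_sum.
Variables (R : realType) (V : lmodType R[i]) (J : choiceType).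
Variable P : seminorm_family V J.
Implicit Types (K L : seq J) (v w : V).

(** Norms are suprema over finite subfamilies, given by lists without repetition;
    this way every seminorm inequality reduces to finite sums. *)
Definition sum_sq K v : R := \sum_(j <- K) P j v ^+ 2.
Definition hsn K v : R := Num.sqrt (sum_sq K v).

Let P_ge0 j v : 0 <= P j v.
Proof. exact: seminorm_ge0 (fam_seminorm P j) v. Qed.

Lemma sum_sq_ge0 K v : 0 <= sum_sq K v.
Proof. by rewrite sumr_ge0// => j _; exact: sqr_ge0. Qed.

Lemma hsn_sq K v : hsn K v ^+ 2 = sum_sq K v.
Proof. by rewrite sqr_sqrtr// sum_sq_ge0. Qed.

Lemma hsn_ge0 K v : 0 <= hsn K v.
Proof. exact: sqrtr_ge0. Qed.

Lemma hsn_le K v (c : R) : 0 <= c -> (hsn K v <= c) = (sum_sq K v <= c ^+ 2).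
Proof. by move=> c0; rewrite -hsn_sq ler_pXn2r// nnegrE// hsn_ge0. Qed.

Lemma hsn_seminorm K : seminorm (hsn K).
Proof.
split=> [v w|c v]; last first.
  rewrite /hsn /sum_sq.
  under eq_bigr do rewrite (proj2 (fam_seminorm P _)) exprMn.
  by rewrite -mulr_sumr sqrtrM ?sqr_ge0// sqrtr_sqr ger0_norm ?rnorm_ge0.
elim: K => [|j K IH]; first by rewrite /hsn /sum_sq !big_nil sqrtr0 addr0.
have consE u : hsn (j :: K) u = Num.sqrt (P j u ^+ 2 + hsn K u ^+ 2).
  by rewrite hsn_sq /hsn /sum_sq big_cons.
rewrite !consE; apply: le_trans (minkowski2 _ _ _ _);
  rewrite ?P_ge0 ?hsn_ge0// ler_wsqrtr// lerD// ler_pXn2r//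
    ?nnegrE ?addr_ge0 ?P_ge0 ?hsn_ge0//.
exact: (proj1 (fam_seminorm P j)).
Qed.

Lemma hsn_le_sum K v : hsn K v <= \sum_(j <- K) P j v.
Proof.
rewrite hsn_le; last by rewrite sumr_ge0.
elim: K => [|j K IH]; first by rewrite /sum_sq !big_nil expr0n.
rewrite /sum_sq !big_cons sqrrD; apply: (@le_trans _ _ (P j v ^+ 2 + (\sum_(i <- K) P i v) ^+ 2)).
  by rewrite lerD2l; exact: IH.
rewrite -addrA lerD2l lerDr mulrn_wge0// mulr_ge0// sumr_ge0// => i _.
Qed.

Definition in_domain (D : pred J) K : Prop := uniq K /\ all D K.

Definition sq_summable v : Prop :=
  exists M : R, forall K, uniq K -> hsn K v <= M.

Definition hnorm (D : pred J) v : R :=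
  sup [set hsn K v | K in in_domain D].

Lemma hsn_nil v : hsn [::] v = 0.
Proof. by rewrite /hsn /sum_sq big_nil sqrtr0. Qed.

Lemma hnorm_ub D K v : sq_summable v -> in_domain D K -> hsn K v <= hnorm D v.
Proof.
move=> [M Mv] DK; apply: ub_le_sup; last by exists K.
by exists M => _ [L [uL _] <-]; exact: Mv.
Qed.

Lemma hnorm_le D v (c : R) :
  (forall K, in_domain D K -> hsn K v <= c) -> hnorm D v <= c.
Proof.
move=> vc; apply: ge_sup; first by exists (hsn [::] v), [::].
by move=> _ [K DK <-]; exact: vc.
Qed.

Lemma hnorm_ge0 D v : sq_summable v -> 0 <= hnorm D v.
Proof. by move=> sv; rewrite -(hsn_nil v) hnorm_ub. Qed.

Lemma sq_summableD v w : sq_summable v -> sq_summable w -> sq_summable (v + w).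
Proof.
move=> [M Mv] [N Nw]; exists (M + N) => K uK.
apply: le_trans (proj1 (hsn_seminorm K) _ _) _.
by rewrite lerD ?Mv ?Nw.
Qed.

Lemma sq_summableZ c v : sq_summable v -> sq_summable (c *: v).
Proof.
move=> [M Mv]; exists (rnorm (c : R[i]^o) * M) => K uK.
by rewrite (proj2 (hsn_seminorm K)) ler_wpM2l ?rnorm_ge0// Mv.
Qed.

Lemma hnormD D v w : sq_summable v -> sq_summable w ->
  hnorm D (v + w) <= hnorm D v + hnorm D w.
Proof.
move=> sv sw; apply: hnorm_le => K DK.
apply: le_trans (proj1 (hsn_seminorm K) _ _) _.
by rewrite lerD// hnorm_ub.
Qed.

Lemma hnormZ D (c : R[i]) v : sq_summable v ->
  hnorm D (c *: v) = rnorm (c : R[i]^o) * hnorm D v.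
Proof.
move=> sv; have le (d : R[i]) u : sq_summable u ->
    hnorm D (d *: u) <= rnorm (d : R[i]^o) * hnorm D u.
  move=> su; apply: hnorm_le => K DK.
  by rewrite (proj2 (hsn_seminorm K)) ler_wpM2l ?rnorm_ge0// hnorm_ub.
apply/eqP; rewrite eq_le le//=; have [->|c0] := eqVneq c 0.
  by rewrite rnorm0 mul0r hnorm_ge0//; exact: sq_summableZ.
have c0' : 0 < rnorm (c : R[i]^o) by rewrite rnorm_gt0.
rewrite -ler_pdivlMl//.
have -> : (rnorm (c : R[i]^o))^-1 = rnorm (c^-1 : R[i]^o).
  apply: (@mulfI _ (rnorm (c : R[i]^o))); first by rewrite gt_eqF.
  by rewrite mulfV ?gt_eqF// -rnormM mulfV ?rnorm1.
have {1}-> : v = c^-1 *: (c *: v) by rewrite scalerA mulVf// scale1r.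
by apply: le; exact: sq_summableZ.
Qed.

Lemma sum_sq_subset K L v : uniq L -> {subset L <= K} -> sum_sq L v <= sum_sq K v.
Proof. by move=> uL LK; apply: ler_sum_uniq => // j; exact: sqr_ge0. Qed.

Lemma sum_sq_cat K L v : sum_sq (K ++ L) v = sum_sq K v + sum_sq L v.
Proof. by rewrite /sum_sq big_cat. Qed.

Lemma hnorm_split K v : sq_summable v ->
  hnorm predT v <= Num.sqrt (hsn K v ^+ 2 + hnorm (fun j => j \notin K) v ^+ 2).
Proof.
move=> sv; set D := fun j => _; apply: hnorm_le => L [uL _].
rewrite hsn_le ?sqrtr_ge0// sqr_sqrtr ?addr_ge0 ?sqr_ge0// hsn_sq.
have -> : sum_sq L v = sum_sq [seq j <- L | j \in K] v + sum_sq [seq j <- L | D j] v.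
  by rewrite /sum_sq !big_filter [LHS](bigID (fun j => j \in K)).
apply: lerD.
  apply: sum_sq_subset; first exact: filter_uniq.
  by move=> j; rewrite mem_filter => /andP[].
rewrite -hsn_sq ler_pXn2r ?nnegrE ?hsn_ge0 ?hnorm_ge0//; apply: hnorm_ub => //.
by split; [exact: filter_uniq | exact: filter_all].
Qed.

(** A finite K that almost exhausts the supremum leaves little for lists disjoint
    from K. *)
Lemma hnorm_tail v (e : R) : sq_summable v -> 0 < e ->
  exists2 K, uniq K & hnorm (fun j => j \notin K) v <= e.
Proof.
move=> sv e0; set s := hnorm predT v; have s0 : 0 <= s by exact: hnorm_ge0.
have [K uK Ks] : exists2 K, uniq K & s ^+ 2 - e ^+ 2 < sum_sq K v.
  apply: contrapT => nK.
  have h K : uniq K -> sum_sq K v <= s ^+ 2 - e ^+ 2.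
    by move=> uK; rewrite leNgt; apply/negP => Ks; apply: nK; exists K.
  have d0 : 0 <= s ^+ 2 - e ^+ 2.
    by apply: le_trans (h [::] isT); exact: sum_sq_ge0.
  have : s <= Num.sqrt (s ^+ 2 - e ^+ 2).
    apply: hnorm_le => K [uK _]; rewrite hsn_le ?sqrtr_ge0// sqr_sqrtr//.
    exact: h.
  rewrite -(ler_pXn2r (_ : 0 < 2)%N)// ?nnegrE ?sqrtr_ge0// sqr_sqrtr//.
  by apply/negP; rewrite -ltNge ltrBlDr ltrDl exprn_gt0.
exists K => //; apply: hnorm_le => L [uL LK].
rewrite hsn_le ?ltW//.
have uKL : uniq (K ++ L).
  rewrite cat_uniq uK uL andbT /=; apply/hasPn => j /(allP LK); exact.
have := @hnorm_ub predT (K ++ L) v sv (conj uKL (all_predT _)).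
rewrite -/s hsn_le// sum_sq_cat => h.
by move: h Ks; lra.
Qed.

Definition sq_summable_pred : {pred V} := fun v => `[< sq_summable v >].

Lemma sq_summable_submod_closed : submod_closed sq_summable_pred.
Proof.
split=> [|c v w /asboolP sv /asboolP sw]; apply/asboolP.
  by exists 0 => K _; rewrite (seminorm0 (hsn_seminorm K)).
by apply: sq_summableD => //; exact: sq_summableZ.
Qed.

HB.instance Definition _ :=
  GRing.isSubmodClosed.Build _ _ sq_summable_pred sq_summable_submod_closed.

Record hilbert_sum := HilbertSum
  { hsval :> V; _ : hsval \in sq_summable_pred }.

HB.instance Definition _ := [isSub for hsval].
HB.instance Definition _ := [Choice of hilbert_sum by <:].
HB.instance Definition _ := [SubChoice_isSubLmodule of hilbert_sum by <:].

Implicit Types x y : hilbert_sum.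

Lemma hsvalP x : sq_summable (hsval x).
Proof. by case: x => v /= /asboolP. Qed.

Definition hs_norm x : R[i] := (hnorm predT (hsval x))%:C.

Lemma ler_hs_normD x y : hs_norm (x + y) <= hs_norm x + hs_norm y.
Proof.
rewrite /hs_norm -rmorphD lecR [hsval _](_ : _ = hsval x + hsval y)//.
by apply: hnormD; exact: hsvalP.
Qed.

Lemma hs_normZ (c : R[i]) x : hs_norm (c *: x) = `|c| * hs_norm x.
Proof.
rewrite /hs_norm [hsval _](_ : _ = c *: hsval x)// hnormZ; last exact: hsvalP.
by rewrite rmorphM; congr (_ * _); exact/esym/rnormE.
Qed.

Lemma fam_le_hnorm j v : sq_summable v -> P j v <= hnorm predT v.
Proof.
move=> sv; have := @hnorm_ub predT [:: j] v sv (conj isT isT).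
by rewrite /hsn /sum_sq big_seq1 sqrtr_sqr ger0_norm.
Qed.

Lemma hs_norm0_eq0 x : hs_norm x = 0 -> x = 0.
Proof.
move=> /complexI x0; suff xv : hsval x = 0 by exact: val_inj.
apply: (fam_separating (s := P)) => j; apply/eqP; rewrite eq_le P_ge0 andbT -x0; apply: fam_le_hnorm; exact: hsvalP.
Qed.

HB.instance Definition _ := Lmodule_isNormed.Build R[i] hilbert_sum
  ler_hs_normD hs_normZ hs_norm0_eq0.

Lemma rnorm_hs x : rnorm x = hnorm predT (hsval x).
Proof. by []. Qed.

Lemma hs_norm_le x (c : R) : (forall K, uniq K -> hsn K (hsval x) <= c) -> rnorm x <= c.
Proof. by move=> h; rewrite rnorm_hs; apply: hnorm_le => K [uK _]; exact: h. Qed.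

Lemma hsn_le_rnorm K x : uniq K -> hsn K (hsval x) <= rnorm x.
Proof.
move=> uK; rewrite rnorm_hs; apply: hnorm_ub; first exact: hsvalP.
by split=> //; exact: all_predT.
Qed.

Lemma fam_le_rnorm j x : P j (hsval x) <= rnorm x.
Proof. by apply: fam_le_hnorm; exact: hsvalP. Qed.

Lemma hnorm_le_rnorm D x : hnorm D (hsval x) <= rnorm x.
Proof. by apply: hnorm_le => K [uK _]; exact: hsn_le_rnorm. Qed.

Definition mkhs v (sv : sq_summable v) : hilbert_sum := HilbertSum (asboolT sv).

(** Functionals that depend on finitely many seminorms are dense in the dual.
    Splitting mu along K and its complement gives mu = a + b with
    |a|^2 + |b|^2 <= |mu|^2. If K carries almost all of a vector x at which mu almost
    attains its norm, then |a| is close to |mu| and b must be small. *)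
Theorem hs_dual_approx (mu : dual hilbert_sum) (e : R) : 0 < e ->
  exists (K : seq J) (a : dual hilbert_sum),
    (forall x, rnorm (a x) <= rnorm mu * hsn K (hsval x)) /\
    rnorm (mu - a) <= e.
Proof.
move=> e0; set M := rnorm mu; have M0 : 0 <= M by exact: rnorm_ge0.
pose t := e / (M + 1); have M1 : 0 < M + 1 by lra.
have t0 : 0 < t by rewrite divr_gt0.
have tM : t * M <= e by rewrite /t mulrAC ler_pdivrMr// ler_pM2l//; lra.
(* The parameters are such that M t <= e and d (M + 1) = t e / 2, which makes the
   final estimate t |b y| <= M t^2 / 2 + d (M + 1) at most t e. *)
pose d := t * e / 2 / (M + 1).
have te : 0 < t * e by rewrite mulr_gt0.
have d0 : 0 < d by rewrite !divr_gt0.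
have dE : d * (M + 1) = t * e / 2 by rewrite /d divfK ?gt_eqF.
have [x x1 xM] : exists2 x, rnorm x <= 1 & M - d < rnorm (mu x).
  by apply: opnorm_near; rewrite ltrBlDr ltrDl.
have [K uK Kx] := hnorm_tail (hsvalP x) d0.
set D := (fun j => _) in Kx.
have sK : seminorm (fun y => hsn K (hsval y)).
  by split=> *; [exact: (proj1 (hsn_seminorm K)) | exact: (proj2 (hsn_seminorm K))].
have sD : seminorm (fun y => hnorm D (hsval y)).
  split=> *; first by apply: hnormD; exact: hsvalP.
  by apply: hnormZ; exact: hsvalP.
have [|a [b [la lb muE ab]]] := split_hilbert sK sD M0 (blin_linear mu).
  move=> y; apply: le_trans (ler_blin _ _) _; rewrite ler_wpM2l// rnorm_hs.
  by apply: hnorm_split; exact: hsvalP.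
have aK y : rnorm (a y) <= M * hsn K (hsval y).
  have := ab y 0; rewrite (linear_fun0 lb) addr0 (seminorm0 sD).
  by rewrite expr0n addr0 sqrtr_sqr ger0_norm ?hsn_ge0.
have bD y : rnorm (b y) <= M * hnorm D (hsval y).
  have := ab 0 y; rewrite (linear_fun0 la) add0r (seminorm0 sK).
  by rewrite expr0n add0r sqrtr_sqr ger0_norm// (seminorm_ge0 sD).
have abd : exists N : R, forall y, rnorm (a y) <= N * rnorm y.
  exists M => y; apply: le_trans (aK y) _; rewrite ler_wpM2l//.
  exact: hsn_le_rnorm.
exists K, (mkblin la abd); split=> //.
apply: opnorm_le => y y1.
rewrite [X in rnorm X](_ : _ = b y); last first.
  by rewrite [LHS](_ : _ = mu y - a y)// muE addrC addKr.
(* |a x| + t |b y| <= M sqrt (1 + t^2), while |a x| >= M - d (M + 1). *)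
have [c [c1 cE]] := rnorm_rot (a x); have [c' [c'1 c'E]] := rnorm_rot (b y).
have := ab (c *: x) ((t%:C * c') *: y).
rewrite (linear_funZ la) (linear_funZ lb) -(scalerA t%:C c' (b y)).
have cE2 : c *: a x = (rnorm (a x))%:C := cE.
have c'E2 : c' *: b y = (rnorm (b y))%:C := c'E.
rewrite cE2 c'E2 [X in rnorm X](_ : _ = (rnorm (a x) + t * rnorm (b y))%:C); last first.
  by rewrite rmorphD [X in _ = _ + X]rmorphM.
have tb0 : 0 <= t * rnorm (b y) by rewrite mulr_ge0 ?rnorm_ge0 ?ltW.
rewrite rnormC ger0_norm; last by rewrite addr_ge0 ?rnorm_ge0.
rewrite (proj2 sK) c1 mul1r (proj2 sD) rnormM rnormC c'1 mulr1 (gtr0_norm t0).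
set h1 := hsn K _; set h2 := hnorm D (hsval y) => key.
have h11 : h1 <= 1 by apply: le_trans x1; exact: hsn_le_rnorm.
have h21 : h2 <= 1 by apply: le_trans y1; exact: hnorm_le_rnorm.
have h10 : 0 <= h1 by exact: hsn_ge0.
have h20 : 0 <= h2 by exact: (seminorm_ge0 sD).
have s1 : Num.sqrt (h1 ^+ 2 + (t * h2) ^+ 2) <= 1 + t ^+ 2 / 2.
  have q0 : 0 <= 1 + t ^+ 2 / 2 by rewrite addr_ge0 ?divr_ge0 ?sqr_ge0.
  rewrite -[leRHS](ger0_norm q0) -sqrtr_sqr ler_wsqrtr//.
  rewrite exprMn.
  have e1 : h1 ^+ 2 <= 1 by rewrite expr_le1.
  have e2 : h2 ^+ 2 <= 1 by rewrite expr_le1.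
  have e3 : t ^+ 2 * h2 ^+ 2 <= t ^+ 2 by rewrite ler_piMr ?sqr_ge0.
  have := sqr_ge0 (t ^+ 2 / 2); rewrite [in X in _ -> X]sqrrD expr1n mul1r.
  by move: e1 e3; move: (h1 ^+ 2) (t ^+ 2 * h2 ^+ 2) ((t ^+ 2 / 2) ^+ 2) (t ^+ 2) => *; lra.
have ax : M - d - M * d <= rnorm (a x).
  have := ler_rnormD (a x) (b x); rewrite -muE.
  have := bD x; have : M * hnorm D (hsval x) <= M * d by rewrite ler_wpM2l.
  by move: xM; lra.
have k2 : M * Num.sqrt (h1 ^+ 2 + (t * h2) ^+ 2) <= M * (1 + t ^+ 2 / 2).
  by rewrite ler_wpM2l.
have k3 : M * (t ^+ 2 / 2) <= t * e / 2.
  have : t * (t * M) <= t * e by rewrite ler_pM2l.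
  by rewrite expr2; lra.
rewrite -(ler_pM2l t0).
by move: key k2 ax dE k3; move: (Num.sqrt _) => s; lra.
Qed.

Hypothesis Pcomplete : forall u : nat -> V,
  (forall j (e : R), 0 < e -> exists N, forall m n, (N <= m)%N -> (N <= n)%N ->
     P j (u m - u n) < e) ->
  exists v, forall j (e : R), 0 < e -> exists N, forall n, (N <= n)%N ->
     P j (u n - v) < e.

Lemma hs_complete : seq_complete hilbert_sum.
Proof.
move=> u uC.
have [|v vP] := Pcomplete (u := fun n => hsval (u n)).
  move=> j e e0; have [N NP] := uC _ e0; exists N => m n Nm Nn.
  by apply: le_lt_trans (NP m n Nm Nn); exact: (fam_le_rnorm j (u m - u n)).
have lim K (e : R) : 0 < e -> exists N, forall n, (N <= n)%N -> hsn K (hsval (u n) - v) <= e.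
  move=> e0; suff [N NP] : exists N, forall n, (N <= n)%N ->
      \sum_(j <- K) P j (hsval (u n) - v) <= e.
    by exists N => n /NP; apply: le_trans; exact: hsn_le_sum.
  elim: K e e0 => [|j K IH] e e0; first by exists 0%N => n _; rewrite big_nil ltW.
  have e2 := divr_gt0 e0 (ltr0Sn _ 1).
  have [N NP] := IH _ e2; have [N' N'P] := vP j _ e2.
  exists (maxn N N') => n; rewrite geq_max => /andP[/NP h /N'P /ltW h'].
  by rewrite big_cons (splitr e) lerD.
have close (e : R) : 0 < e -> exists N, forall n, (N <= n)%N ->
    forall K, uniq K -> hsn K (hsval (u n) - v) <= e.
  move=> e0; have e2 := divr_gt0 e0 (ltr0Sn _ 1).
  have [N NP] := uC _ e2; exists N => n Nn K uK.
  have [N' N'P] := lim K _ e2; pose m := maxn N N'.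
  rewrite (_ : _ - v = hsval (u n - u m) + (hsval (u m) - v)); last first.
    by rewrite [hsval (_ - _)](_ : _ = hsval (u n) - hsval (u m))// addrA subrK.
  apply: le_trans (proj1 (hsn_seminorm K) _ _) _; rewrite (splitr e) lerD ?N'P ?leq_maxr//.
  apply: le_trans (hsn_le_rnorm _ uK) _; rewrite ltW// NP//.
  exact: leq_maxl.
have [N NP] := close _ ltr01.
have sv : sq_summable v.
  have -> : v = hsval (u N) + (-1) *: (hsval (u N) - v).
    by rewrite scaleN1r opprB addrC subrK.
  apply: sq_summableD; first exact: hsvalP.
  by apply: sq_summableZ; exists 1 => K; exact: NP.
exists (mkhs sv) => e e0; have e2 := divr_gt0 e0 (ltr0Sn _ 1).
have [N' N'P] := close _ e2; exists N' => n Nn.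
apply: (@le_lt_trans _ _ (e / 2)); last by lra.
by apply: hs_norm_le => K uK; exact: N'P.
Qed.

End hilbert_sum.

(** * Interpolation spaces of weakly compact sets *)

Section gauges.
Variables (R : realType) (G : normedModType R[i]).
Implicit Types (y : dual G) (g : G) (S : set G) (n : nat).

Definition rbounded S : Prop := exists M : R, forall w, S w -> rnorm w <= M.

(** Up to a factor 2 this is the polar of 2^n S + 2^-n B, where B is the unit ball,
    so that the gauge below is, up to equivalence, the Minkowski functional of that
    set: the norms used by Davis, Figiel, Johnson and Pelczynski. Through polars, no
    decompositions of vectors have to be chosen. *)
Definition polar S n : set (dual G) :=
  [set y : dual G | rnorm y <= 2 ^+ n /\ forall w, S w -> rnorm (y w) <= (2 ^+ n)^-1].

Definition gauge S n g : R := sup [set rnorm (y g) | y in polar S n].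

Let two_gt0 n : 0 < (2 : R) ^+ n.
Proof. by rewrite exprn_gt0. Qed.

Lemma polar0 S n : polar S n 0.
Proof.
split=> [|w _]; first by rewrite rnorm0 ltW.
by rewrite [X in rnorm X](_ : _ = 0)// rnorm0 invr_ge0 ltW.
Qed.

Lemma gauge_ub S n y g : polar S n y -> rnorm (y g) <= gauge S n g.
Proof.
move=> Sy; apply: ub_le_sup; last by exists y.
exists (2 ^+ n * rnorm g) => _ [z [z1 _] <-].
by apply: le_trans (ler_blin _ _) _; rewrite ler_wpM2r ?rnorm_ge0.
Qed.

Lemma gauge_le S n g (c : R) :
  (forall y, polar S n y -> rnorm (y g) <= c) -> gauge S n g <= c.
Proof.
move=> h; apply: ge_sup; first by exists (rnorm ((0 : dual G) g)), 0 => //; exact: polar0.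
by move=> _ [y Sy <-]; exact: h.
Qed.

Lemma gauge_ge0 S n g : 0 <= gauge S n g.
Proof. by apply: le_trans (gauge_ub g (polar0 S n)); exact: rnorm_ge0. Qed.

Lemma gauge_seminorm S n : seminorm (gauge S n).
Proof.
apply: seminorm_of_le => [g h|c g]; apply: gauge_le => y Sy.
  rewrite linearD; apply: le_trans (ler_rnormD _ _) _.
  by rewrite lerD// gauge_ub.
by rewrite linearZ rnormZ ler_wpM2l ?rnorm_ge0// gauge_ub.
Qed.

Lemma gauge_dual S n y g (t : R) : 0 <= t -> rnorm y <= t * 2 ^+ n ->
  (forall w, S w -> rnorm (y w) <= t * (2 ^+ n)^-1) ->
  rnorm (y g) <= t * gauge S n g.
Proof.
move=> t0 yn yS; have [t00|tn0] := eqVneq t 0.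
  have y0 : rnorm y = 0 by apply/eqP; rewrite eq_le rnorm_ge0 andbT -(mul0r (2 ^+ n)) -t00.
  by apply: le_trans (ler_blin _ _) _; rewrite y0 t00 !mul0r.
have tp : 0 < t by rewrite lt_neqAle eq_sym tn0.
rewrite -ler_pdivrMl//.
have tE : t^-1 = rnorm (t^-1%:C : R[i]^o) by rewrite rnormC gtr0_norm ?invr_gt0.
rewrite {1}tE -rnormZ [X in rnorm X](_ : _ = (t^-1%:C *: y) g)//.
apply: gauge_ub; split=> [|w Sw].
  by rewrite rnormZ -tE ler_pdivrMl.
rewrite [X in rnorm X](_ : _ = t^-1%:C *: y w)// rnormZ -tE ler_pdivrMl//.
exact: yS.
Qed.

Lemma gauge_le_norm S n g : gauge S n g <= 2 ^+ n * rnorm g.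
Proof.
apply: gauge_le => y [yn _]; apply: le_trans (ler_blin _ _) _.
by rewrite ler_wpM2r ?rnorm_ge0.
Qed.

Lemma norm_le_gauge S n : rbounded S ->
  exists2 c : R, 0 < c & forall g, rnorm g <= c * gauge S n g.
Proof.
move=> [M SM]; pose M' := Num.max M 1; exists (2 ^+ n * M').
  by rewrite mulr_gt0// lt_max ltr01 orbT.
have M'1 : 1 <= M' by rewrite le_max lexx orbT.
move=> g; apply: rnorm_le_dual => y y1; apply: gauge_dual.
- by rewrite mulr_ge0 ?ltW// (lt_le_trans ltr01).
- apply: le_trans y1 _; rewrite mulr_ege1//; last by rewrite exprn_ege1// ler1n.
  by rewrite mulr_ege1// exprn_ege1// ler1n.
- move=> w Sw; rewrite mulrAC divff ?gt_eqF// mul1r.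
  apply: le_trans (ler_blin _ _) _; apply: (@le_trans _ _ (1 * M')); last by rewrite mul1r.
  by rewrite ler_pM ?rnorm_ge0// (le_trans (SM _ Sw))// le_max lexx.
Qed.

(** Vectors of bounded gauges are in the closed span of S: all multiples of a
    functional that vanishes on S satisfy the second condition in the polar, so
    that |y g| is at most |y| M / 2^n. *)
Lemma gauge_vanish S g y (M : R) : (forall n, gauge S n g <= M) ->
  (forall w, S w -> y w = 0) -> y g = 0.
Proof.
move=> gM yS; apply: rnorm0_eq0; apply/eqP; rewrite eq_le rnorm_ge0 andbT.
have M0 : 0 <= M by apply: le_trans (gM 0%N); exact: gauge_ge0.
have key n : rnorm (y g) <= rnorm y * M / 2 ^+ n.
  apply: (@le_trans _ _ (rnorm y / 2 ^+ n * gauge S n g)).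
    apply: gauge_dual.
    - by rewrite divr_ge0 ?rnorm_ge0// ltW.
    - by rewrite divfK ?gt_eqF.
    - by move=> w /yS ->; rewrite rnorm0 mulr_ge0 ?divr_ge0 ?rnorm_ge0 ?invr_ge0 ?ltW.
  by rewrite mulrAC ler_wpM2r ?invr_ge0 ?(ltW (two_gt0 _))// ler_wpM2l ?rnorm_ge0.
rewrite leNgt; apply/negP => yg0.
pose n := (Num.truncn (rnorm y * M / rnorm (y g))).+1.
have N2 k : k%:R <= (2 : R) ^+ k.
  by rewrite -natrX ler_nat ltnW// ltn_expl.
have := key n; rewrite ler_pdivlMr// mulrC -ler_pdivlMr//.
apply/negP; rewrite -ltNge; apply: lt_le_trans (N2 n); exact: truncnS_gt.
Qed.

(** The weak* closed absolutely convex hull of S in the bidual is contained in G.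
    This form of relative weak compactness is the one that the proof of reflexivity
    uses, and Hahn-Banach alone shows that it holds for finite unions and for the
    images of balls of dual spaces. *)
Definition weakly_compact_hull S : Prop :=
  forall Phi : dual G -> R[i]^o, linear Phi ->
  (exists C : R, forall y (t : R), 0 <= t -> (forall w, S w -> rnorm (y w) <= t) ->
     rnorm (Phi y) <= C * t) ->
  exists g, forall y, Phi y = y g.

(** The value 0 keeps the supremum meaningful when S is empty. *)
Definition support_fun S y : R := sup [set rnorm (y w) | w in [set w | S w \/ w = 0]].

Lemma support_fun_ub S y w : rbounded S -> S w -> rnorm (y w) <= support_fun S y.
Proof.
move=> [M SM] Sw; apply: ub_le_sup; last by exists w => //; left.
exists (rnorm y * `|M|) => _ [z zS <-]; apply: le_trans (ler_blin _ _) _.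
rewrite ler_wpM2l ?rnorm_ge0//; case: zS => [Sz|->]; last by rewrite rnorm0.
exact: le_trans (SM _ Sz) (ler_norm _).
Qed.

Lemma support_fun_le S y (t : R) : 0 <= t ->
  (forall w, S w -> rnorm (y w) <= t) -> support_fun S y <= t.
Proof.
move=> t0 h; apply: ge_sup; first by exists (rnorm (y 0)), 0 => //; right.
by move=> _ [w [Sw|->] <-]; [exact: h | rewrite linear0 rnorm0].
Qed.

Lemma support_fun_ge0 S y : rbounded S -> 0 <= support_fun S y.
Proof.
move=> [M SM]; apply: ub_le_sup; last by exists 0; [right|rewrite linear0 rnorm0].
exists (rnorm y * `|M|) => _ [z zS <-]; apply: le_trans (ler_blin _ _) _.
rewrite ler_wpM2l ?rnorm_ge0//; case: zS => [Sz|->]; last by rewrite rnorm0.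
exact: le_trans (SM _ Sz) (ler_norm _).
Qed.

Lemma support_fun_seminorm S : rbounded S -> seminorm (support_fun S).
Proof.
move=> bS; apply: seminorm_of_le => [y z|c y]; apply: support_fun_le => [|w Sw].
- by rewrite addr_ge0 ?support_fun_ge0.
- by rewrite blinDE; apply: le_trans (ler_rnormD _ _) _; rewrite lerD ?support_fun_ub.
- by rewrite mulr_ge0 ?rnorm_ge0 ?support_fun_ge0.
- by rewrite blinZE rnormZ ler_wpM2l ?rnorm_ge0 ?support_fun_ub.
Qed.

Lemma weakly_compact_hullU S S' : rbounded S -> rbounded S' ->
  weakly_compact_hull S -> weakly_compact_hull S' ->
  weakly_compact_hull (S `|` S').
Proof.
move=> bS bS' wS wS' Phi lPhi [C hC].
have scS T : rbounded T -> seminorm (fun y => `|C| * support_fun T y).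
  move=> bT; split=> [y z|c y].
    by rewrite -mulrDr ler_wpM2l// (proj1 (support_fun_seminorm bT)).
  by rewrite (proj2 (support_fun_seminorm bT)) mulrCA.
have [y|P1 [P2 [lP1 lP2 PE P1S P2S]]] := split_add (scS _ bS) (scS _ bS') lPhi.
  rewrite -mulrDr; apply: (@le_trans _ _ (C * (support_fun S y + support_fun S' y))).
    apply: hC => [|w [Sw|Sw]]; first by rewrite addr_ge0 ?support_fun_ge0.
      by rewrite (le_trans (support_fun_ub _ bS Sw))// lerDl support_fun_ge0.
    by rewrite (le_trans (support_fun_ub _ bS' Sw))// lerDr support_fun_ge0.
  by rewrite ler_wpM2r ?ler_norm// addr_ge0 ?support_fun_ge0.
have [|g gE] := wS P1 lP1.
  exists `|C| => y t t0 h; apply: le_trans (P1S y) _.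
  by rewrite ler_wpM2l ?support_fun_le.
have [|g' g'E] := wS' P2 lP2.
  exists `|C| => y t t0 h; apply: le_trans (P2S y) _.
  by rewrite ler_wpM2l ?support_fun_le.
by exists (g + g') => y; rewrite PE gE g'E linearD.
Qed.

Lemma weakly_compact_hull0 : weakly_compact_hull set0.
Proof.
move=> Phi _ [C hC]; exists 0 => y; rewrite linear0; apply: rnorm0_eq0.
apply/eqP; rewrite eq_le rnorm_ge0 andbT.
by have := hC y 0 (lexx _); rewrite mulr0; apply.
Qed.

End gauges.

(** The hypothesis on T is continuity from the weak* to the weak topology: T has a
    pre-adjoint tau from G' to X. A functional on G' dominated by the support
    function of the image is dominated by the norm of tau, hence factors through tau
    and is given by an element of X'. *)
Lemma weakly_compact_hull_ball (R : realType) (X G : normedModType R[i])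
    (T : dual X -> G) : linear T ->
  (forall y : dual G, exists x, forall nu, y (T nu) = nu x) ->
  weakly_compact_hull (T @` [set nu | rnorm nu <= 1]).
Proof.
move=> lT /choice[tau tauE] Phi lPhi [C hC].
have ltau : linear tau.
  move=> c y z; apply: dual_separates => nu.
  by rewrite -tauE [RHS]linearP /= -!tauE.
have sp : seminorm (fun x : X => `|C| * rnorm x).
  split=> [x z|c x]; first by rewrite -mulrDr ler_wpM2l// ler_rnormD.
  by rewrite rnormZ mulrCA.
have [|psi [lpsi psiC psiE]] := hahn_banach sp ltau lPhi.
  move=> y; apply: (@le_trans _ _ (C * rnorm (tau y))); last first.
    by rewrite ler_wpM2r ?rnorm_ge0 ?ler_norm.
  apply: hC => [|_ [nu nu1 <-]]; first exact: rnorm_ge0.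
  rewrite tauE; apply: le_trans (ler_blin _ _) _.
  by rewrite ler_piMl ?rnorm_ge0.
pose nu : dual X := mkblin lpsi (ex_intro _ `|C| psiC).
by exists (T nu) => y; rewrite tauE -psiE.
Qed.

Record gauge_family (R : realType) (G : normedModType R[i]) (I : choiceType) :=
  GaugeFamily { gset :> I -> set G; gset_bounded : forall i, rbounded (gset i) }.

Section interpolation_space.
Variables (R : realType) (G : normedModType R[i]) (I : choiceType).
Variable W : gauge_family G I.

(** One coordinate for each set of the family, and infinitely many gauges for each
    coordinate; the l2 sum over all these pairs is taken at once. *)
Definition coord_gauge (j : I * nat) (v : I -> G) : R := gauge (W j.1) j.2 (v j.1).

Lemma coord_gauge_seminorm j : seminorm (coord_gauge j).
Proof. by split=> *; [exact: (proj1 (gauge_seminorm _ _))|exact: (proj2 (gauge_seminorm _ _))]. Qed.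

Lemma coord_gauge_separating v : (forall j, coord_gauge j v = 0) -> v = 0.
Proof.
move=> v0; apply/funext => i; apply: rnorm0_eq0; apply/eqP.
have [c _ cP] := norm_le_gauge 0 (gset_bounded W i).
rewrite eq_le rnorm_ge0 andbT; apply: le_trans (cP _) _.
by have := v0 (i, 0%N); rewrite /coord_gauge /= => ->; rewrite mulr0.
Qed.

Definition gauge_fam : seminorm_family (I -> G) (I * nat)%type :=
  SeminormFamily coord_gauge_seminorm coord_gauge_separating.

Definition interp := hilbert_sum gauge_fam.
HB.instance Definition _ := NormedModule.on interp.

Lemma interp_seq_complete : seq_complete G -> seq_complete interp.
Proof.
move=> Gc; apply: hs_complete => u uC.
have /choice[v vP] : forall i, exists l, rcvg (fun n => u n i) l.
  move=> i; apply: Gc => e e0.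
  have [c c0 cP] := norm_le_gauge 0 (gset_bounded W i).
  have [N NP] := uC (i, 0%N) _ (divr_gt0 e0 c0); exists N => m n Nm Nn.
  apply: le_lt_trans (cP _) _; rewrite mulrC -ltr_pdivlMr//; exact: NP.
exists v => -[i n] e e0; have n0 : 0 < (2 : R) ^+ n by rewrite exprn_gt0.
have [N NP] := vP i _ (divr_gt0 e0 n0); exists N => m /NP h.
by apply: le_lt_trans (gauge_le_norm _ _ _) _; rewrite mulrC -ltr_pdivlMr.
Qed.

Lemma gauge_le_rnorm (x : interp) i n : gauge (W i) n (hsval x i) <= rnorm x.
Proof. exact: (fam_le_rnorm (P := gauge_fam) (i, n) x). Qed.

Lemma interp_coord_bounded i :
  exists M : R, forall x : interp, rnorm (hsval x i) <= M * rnorm x.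
Proof.
have [c c0 cP] := norm_le_gauge 0 (gset_bounded W i); exists c => x.
apply: le_trans (cP _) _; rewrite ler_wpM2l ?(ltW c0)//; exact: gauge_le_rnorm.
Qed.

Lemma interp_coord_linear i : linear (fun x : interp => hsval x i).
Proof. by []. Qed.

Definition coord i : blin interp G :=
  mkblin (interp_coord_linear i) (interp_coord_bounded i).

Lemma sum_cauchy_schwarz (J : Type) (K : seq J) (a b : J -> R) :
  (forall j, 0 <= a j) -> (forall j, 0 <= b j) ->
  \sum_(j <- K) a j * b j <=
  Num.sqrt (\sum_(j <- K) a j ^+ 2) * Num.sqrt (\sum_(j <- K) b j ^+ 2).
Proof.
move=> a0 b0; elim: K => [|j K IH]; first by rewrite !big_nil sqrtr0 mul0r.
rewrite !big_cons; set A := \sum_(_ <- K) a _ ^+ 2; set B := \sum_(_ <- K) b _ ^+ 2.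
have A0 : 0 <= A by rewrite sumr_ge0// => *; exact: sqr_ge0.
have B0 : 0 <= B by rewrite sumr_ge0// => *; exact: sqr_ge0.
apply: le_trans (lerD (lexx _) IH) _; rewrite -/A -/B -!sqrtrM ?addr_ge0 ?sqr_ge0//.
set s := Num.sqrt (A * B).
have s0 : 0 <= s by exact: sqrtr_ge0.
have s2 : s ^+ 2 = A * B by rewrite sqr_sqrtr// mulr_ge0.
have l0 : 0 <= a j * b j + s by rewrite addr_ge0// mulr_ge0.
rewrite -[leLHS](ger0_norm l0) -sqrtr_sqr ler_wsqrtr// sqrrD s2 exprMn.
have : 2 * (a j * b j * s) <= a j ^+ 2 * B + A * b j ^+ 2; last by lra.
have := sqr_ge0 (a j * Num.sqrt B - b j * Num.sqrt A).
rewrite sqrrB !exprMn !sqr_sqrtr//.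
have -> : a j * Num.sqrt B * (b j * Num.sqrt A) = a j * b j * s.
  by rewrite /s sqrtrM//; ring.
by lra.
Qed.

Variable Phi : dual (dual interp).

Let Phi_coord i (y : dual G) : R[i]^o := Phi (y \oB coord i : dual interp).

Let Phi_coord_linear i : linear (Phi_coord i).
Proof.
move=> c y z; rewrite /Phi_coord -linearP; congr (Phi _).
exact: blinP.
Qed.

(** Restricted to the functionals y o coord i, an element Phi of the bidual is
    dominated by a multiple of 2^n times the support function of W i plus 2^-n |y|.
    Splitting it accordingly, the first part is given by a point of G; so Phi is at
    distance at most |Phi| / 2^n from G, for all n. *)
Lemma bidual_coord_near i n : weakly_compact_hull (W i) ->
  exists g, forall y, rnorm (Phi_coord i y - y g) <= rnorm Phi / 2 ^+ n * rnorm y.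
Proof.
move=> wc; have bW := gset_bounded W i; set M := rnorm Phi.
have M0 : 0 <= M by exact: rnorm_ge0.
have n0 : 0 < (2 : R) ^+ n by rewrite exprn_gt0.
have sa : seminorm (fun y : dual G => M / 2 ^+ n * rnorm y).
  split=> [y z|c y]; last by rewrite rnormZ mulrCA.
  by rewrite -mulrDr ler_wpM2l ?divr_ge0 ?(ltW n0)// ler_rnormD.
have sb : seminorm (fun y : dual G => M * 2 ^+ n * support_fun (W i) y).
  have [sD sZ] := support_fun_seminorm bW.
  split=> [y z|c y]; last by rewrite sZ mulrCA.
  by rewrite -mulrDr ler_wpM2l ?mulr_ge0 ?(ltW n0).
have [y|P1 [P2 [lP1 lP2 PE P1S P2S]]] := split_add sa sb (@Phi_coord_linear i).
  rewrite -!mulrA -mulrDr; apply: le_trans (ler_blin _ _) _; rewrite ler_wpM2l//.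
  have s0 := support_fun_ge0 y bW.
  have t0 : 0 <= (2 ^+ n)^-1 * rnorm y + 2 ^+ n * support_fun (W i) y.
    by rewrite addr_ge0 ?mulr_ge0 ?rnorm_ge0 ?invr_ge0 ?(ltW n0).
  apply: blin_norm_le => // x; rewrite [X in rnorm X](_ : _ = y (hsval x i))//.
  apply: (@le_trans _ _ (((2 ^+ n)^-1 * rnorm y + 2 ^+ n * support_fun (W i) y) *
    gauge (W i) n (hsval x i))).
    apply: gauge_dual => //.
      rewrite mulrDl mulrAC mulVf ?gt_eqF// mul1r lerDl.
      by rewrite !mulr_ge0// ?(ltW n0).
    move=> w Ww; rewrite mulrDl [in X in _ + X]mulrAC divff ?gt_eqF// mul1r.
    apply: le_trans (support_fun_ub y bW Ww) _; rewrite lerDr.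
    by rewrite !mulr_ge0 ?rnorm_ge0 ?invr_ge0 ?(ltW n0).
  by rewrite ler_wpM2l// gauge_le_rnorm.
have [|g gE] := wc P2 lP2.
  exists (M * 2 ^+ n) => y t t0 h; apply: le_trans (P2S y) _.
  by rewrite ler_wpM2l ?mulr_ge0 ?(ltW n0)// support_fun_le.
by exists g => y; rewrite PE -gE addrK.
Qed.

Lemma bidual_coord i : seq_complete G -> weakly_compact_hull (W i) ->
  exists g, forall y, Phi_coord i y = y g.
Proof.
move=> Gc wc; have /choice[g gP] n := bidual_coord_near n wc.
set M := rnorm Phi in gP; have M0 : 0 <= M by exact: rnorm_ge0.
have small (c e : R) : 0 <= c -> 0 < e -> exists N, forall n, (N <= n)%N -> c / 2 ^+ n < e.
  move=> c0 e0; exists (Num.truncn (c / e)).+1 => n Nn.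
  rewrite ltr_pdivrMr ?exprn_gt0// mulrC -ltr_pdivrMr//.
  apply: lt_le_trans (truncnS_gt _) _.
  apply: (@le_trans _ _ (n%:R)); first by rewrite ler_nat.
  by rewrite -natrX ler_nat ltnW// ltn_expl.
have near (y : dual G) n : rnorm y <= 1 -> rnorm (Phi_coord i y - y (g n)) <= M / 2 ^+ n.
  move=> y1; apply: le_trans (gP n y) _; rewrite ler_piMr// divr_ge0// ltW//.
  by rewrite exprn_gt0.
have [|l gl] := Gc g.
  move=> e e0; have e2 : 0 < e / 3 by rewrite divr_gt0.
  have [N NP] := small _ _ M0 e2; exists N => m n Nm Nn.
  apply: (@le_lt_trans _ _ (e / 3 + e / 3)); last by lra.
  apply: rnorm_le_dual => y y1; rewrite linearB /=.
  rewrite -(subrK (Phi_coord i y) (y (g m))) -addrA; apply: le_trans (ler_rnormD _ _) _.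
  rewrite (rnormB (y _)).
  by rewrite lerD// (le_trans (near _ _ y1))// ltW// NP.
exists l => y; apply: (@rcvg_unique _ _ (fun n => y (g n))); last exact: rcvg_blin.
move=> e e0; have [N NP] := small (M * rnorm y) e (mulr_ge0 M0 (rnorm_ge0 _)) e0.
exists N => n /NP; apply: le_lt_trans; rewrite rnormB; apply: le_trans (gP n y) _.
by rewrite mulrAC.
Qed.

Hypothesis Gc : seq_complete G.
Hypothesis wc : forall i, weakly_compact_hull (W i).

(** The points of G found in the coordinates form an element of the space: testing
    Phi on combinations of functionals y_j o coord j with y_j in the polars bounds
    the square sums of their gauges by |Phi|^2. *)
Lemma bidual_point : exists x : interp,
  forall i (y : dual G), Phi (y \oB coord i : dual interp) = y (hsval x i).
Proof.
have /choice[v vP] i := bidual_coord Gc (@wc i).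
suff sv : sq_summable gauge_fam v by exists (mkhs sv) => i y; rewrite -vP.
set M := rnorm Phi; have M0 : 0 <= M by exact: rnorm_ge0.
have fin (K : seq (I * nat)) (y : I * nat -> dual G) : uniq K ->
    (forall j, polar (W j.1) j.2 (y j)) ->
    \sum_(j <- K) rnorm (y j (v j.1)) ^+ 2 <= M ^+ 2.
  move=> uK yU; set S := \sum_(j <- K) _.
  have S0 : 0 <= S by rewrite sumr_ge0// => *; exact: sqr_ge0.
  have /choice[c cP] := fun j => rnorm_rot (y j (v j.1)).
  pose d j : R[i] := (rnorm (y j (v j.1)))%:C * c j.
  pose nu : dual interp := \sum_(j <- K) d j *: (y j \oB coord j.1 : dual interp).
  have PhinuE : Phi nu = S%:C.
    rewrite /nu linear_sum rmorph_sum; apply: eq_bigr => j _.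
    rewrite linearZ /= -/(Phi_coord j.1 (y j)) vP /d.
    rewrite -[_ *: _]/(_ * _ * _ : R[i]) -mulrA (proj2 (cP j)).
    by rewrite -rmorphM expr2.
  have nuE x : nu x = \sum_(j <- K) d j *: y j (hsval x j.1).
    by rewrite /nu; elim: (K) => [|j L IH]; rewrite ?big_nil// !big_cons -IH.
  have nuS : rnorm nu <= Num.sqrt S.
    apply: blin_norm_le => [|x]; first exact: sqrtr_ge0.
    rewrite nuE.
    apply: (@le_trans _ _ (\sum_(j <- K) rnorm (y j (v j.1)) * gauge_fam j (hsval x))).
      elim: (K) => [|j L IH]; first by rewrite !big_nil rnorm0.
      rewrite !big_cons; apply: le_trans (ler_rnormD _ _) _; rewrite lerD//.
      rewrite rnormZ /d rnormM (proj1 (cP j)) mulr1 rnormC ger0_norm ?rnorm_ge0//.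
      by rewrite ler_wpM2l ?rnorm_ge0//; exact: gauge_ub.
    apply: le_trans (sum_cauchy_schwarz K _ _) _.
    - by move=> j; exact: rnorm_ge0.
    - by move=> j; exact: gauge_ge0.
    by rewrite ler_wpM2l ?sqrtr_ge0//; exact: (hsn_le_rnorm (P := gauge_fam) x uK).
  have := ler_blin Phi nu; rewrite PhinuE rnormC ger0_norm// => h.
  have {}h : S <= M * Num.sqrt S by apply: le_trans h _; rewrite ler_wpM2l.
  have sS : Num.sqrt S ^+ 2 = S by rewrite sqr_sqrtr.
  have := sqrtr_ge0 S; rewrite le_eqVlt => /orP[/eqP s0|s0].
    by rewrite -sS -s0 expr0n sqr_ge0.
  rewrite -sS ler_pXn2r ?nnegrE ?sqrtr_ge0//.
  by move: h; rewrite -{1}sS expr2 ler_pM2r.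
exists M => K uK; rewrite hsn_le//.
apply/ler_addgt0Pr => e e0; set z := M ^+ 2 + e.
have Mz : M ^+ 2 < z by rewrite ltrDl.
have [S0|Sn0] := eqVneq (sum_sq gauge_fam K v) 0.
  by rewrite S0 ltW// (le_lt_trans _ Mz)// sqr_ge0.
set S := sum_sq _ _ _ in Sn0 *; have Sp : 0 < S by rewrite lt_neqAle eq_sym Sn0 sum_sq_ge0.
rewrite leNgt; apply/negP => zS.
have z0 : 0 < z by apply: le_lt_trans Mz; exact: sqr_ge0.
(* Each gauge is a supremum, attained only up to a factor q < 1; the factor is chosen
   so close to 1 that the bound M^2 on the finite sums is violated. *)
pose q := Num.sqrt (z / S).
have q2 : q ^+ 2 = z / S by rewrite sqr_sqrtr// divr_ge0 ?ltW.
have q0 : 0 <= q by exact: sqrtr_ge0.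
have q1 : q < 1.
  by rewrite -(ltr_pXn2r (_ : 0 < 2)%N)// ?nnegrE// q2 expr1n ltr_pdivrMr// mul1r.
have /choice[y yP] : forall j : I * nat, exists y, polar (W j.1) j.2 y /\
    q * gauge_fam j v <= rnorm (y (v j.1)).
  move=> j; have := gauge_ge0 (W j.1) j.2 (v j.1); rewrite le_eqVlt => /orP[/eqP g0|g0].
    exists 0; split; first exact: polar0.
    by rewrite /= /coord_gauge -g0 mulr0 rnorm_ge0.
  have ne : [set rnorm (y (v j.1)) | y in polar (W j.1) j.2] !=set0.
    by exists (rnorm ((0 : dual G) (v j.1))), 0 => //; exact: polar0.
  have lt : q * gauge_fam j v < gauge (W j.1) j.2 (v j.1) by rewrite gtr_pMl.
  have [_ [y yU <-] yg] := sup_gt ne lt.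
  by exists y; split=> //; exact: ltW.
have := fin K y uK (fun j => proj1 (yP j)); apply/negP; rewrite -ltNge.
apply: lt_le_trans Mz _; rewrite (_ : z = q ^+ 2 * S); last by rewrite q2 divfK.
rewrite /S /sum_sq mulr_sumr ler_sum// => j _; rewrite -exprMn.
by rewrite ler_pXn2r ?nnegrE ?mulr_ge0 ?gauge_ge0 ?rnorm_ge0//; exact: (proj2 (yP j)).
Qed.

End interpolation_space.

(** A functional dominated by finitely many coordinates is a sum of functionals of
    the coordinates. *)
Lemma coord_combination (R : realType) (E : lmodType R[i]) (G : normedModType R[i])
    (J : Type) (K : seq J) (c : J -> R) (L : J -> E -> G) (f : E -> R[i]^o) :
  (forall j, 0 <= c j) -> (forall j, linear (L j)) -> linear f ->
  (forall x, rnorm (f x) <= \sum_(j <- K) c j * rnorm (L j x)) ->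
  exists l : seq (J * dual G), forall x, f x = \sum_(p <- l) p.2 (L p.1 x).
Proof.
move=> c0 lL; elim: K f => [|j K IH] f lf fK.
  exists [::] => x; rewrite big_nil; apply: rnorm0_eq0.
  by apply/eqP; rewrite eq_le rnorm_ge0 andbT; have := fK x; rewrite big_nil.
have sG i : seminorm (fun g : G => c i * rnorm g).
  split=> [x y|d x]; first by rewrite -mulrDr ler_wpM2l// ler_rnormD.
  by rewrite rnormZ mulrCA.
have sL i : seminorm (fun x => c i * rnorm (L i x)).
  split=> [x y|d x]; first by rewrite (linear_funD (lL i)); exact: (proj1 (sG i)).
  by rewrite (linear_funZ (lL i)); exact: (proj2 (sG i)).
have [|f1 [f2 [lf1 lf2 fE f1p f2p]]] := split_add (sL j) (sum_seminorm K sL) lf.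
  by move=> x; have := fK x; rewrite big_cons.
have [l lE] := IH f2 lf2 f2p.
have [g [lg gp gE]] := hahn_banach (sG j) (lL j) lf1 f1p.
exists ((j, mkblin lg (ex_intro _ (c j) gp) : dual G) :: l) => x.
by rewrite big_cons /= fE lE -gE.
Qed.

Section interp_reflexivity.
Variables (R : realType) (G : normedModType R[i]) (I : choiceType).
Variable W : gauge_family G I.

Theorem interp_dual_dense (mu : dual (interp W)) (e : R) : 0 < e ->
  exists l : seq (I * dual G),
    rnorm (mu - \sum_(p <- l) (p.2 \oB coord W p.1 : dual (interp W))) <= e.
Proof.
move=> e0; have [K [a [aK mua]]] := hs_dual_approx mu e0.
have [|||l lE] := @coord_combination R (interp W) G (I * nat) K
    (fun j => rnorm mu * 2 ^+ j.2) (fun j x => hsval x j.1) a _ _ (blin_linear a).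
- by move=> j; rewrite mulr_ge0 ?rnorm_ge0 ?exprn_ge0.
- by move=> j.
- move=> x; apply: le_trans (aK x) _.
  apply: (@le_trans _ _ (rnorm mu * \sum_(j <- K) gauge_fam W j (hsval x))).
    by rewrite ler_wpM2l ?rnorm_ge0//; exact: hsn_le_sum.
  rewrite mulr_sumr ler_sum// => j _; rewrite -mulrA ler_wpM2l ?rnorm_ge0//.
  exact: gauge_le_norm.
exists [seq (p.1.1, p.2) | p <- l].
suff -> : \sum_(p <- [seq (p.1.1, p.2) | p <- l])
    (p.2 \oB coord W p.1 : dual (interp W)) = a by [].
apply: blinP => x; rewrite lE big_map.
by elim: (l) => [|p m IH]; rewrite ?big_nil// !big_cons -IH.
Qed.

(** On the functionals of finitely many coordinates an element of the bidual is
    evaluation at the point of bidual_point, and these functionals are dense. *)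
Theorem interp_reflexive : seq_complete G ->
  (forall i, weakly_compact_hull (W i)) -> reflexive_space (interp W).
Proof.
move=> Gc wc Phi; have [x xE] := bidual_point Phi Gc wc; exists x => mu.
apply/eqP; rewrite -subr_eq0; apply/eqP/rnorm0_eq0/eqP.
rewrite eq_le rnorm_ge0 andbT; apply/ler_addgt0Pr => e e0; rewrite add0r.
have M0 : 0 < rnorm Phi + rnorm x + 1 by rewrite ltr_wpDl// addr_ge0 ?rnorm_ge0.
have [l le] := interp_dual_dense mu (divr_gt0 e0 M0).
set a := \sum_(p <- l) _ in le.
have aE : Phi a = a x.
  rewrite /a; elim: (l) => [|p m IH]; first by rewrite big_nil linear0.
  by rewrite big_cons linearD /= IH xE.
have -> : Phi mu - mu x = Phi (mu - a) - (mu - a) x.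
  have -> : (mu - a) x = mu x - a x by [].
  by rewrite linearB /= aE opprB addrA subrK.
apply: le_trans (ler_rnormD _ _) _; rewrite rnormN.
apply: (@le_trans _ _ ((rnorm Phi + rnorm x + 1) * rnorm (mu - a))).
  rewrite !mulrDl mul1r -addrA; apply: lerD; first exact: ler_blin.
  by apply: le_trans (ler_blin _ _) _; rewrite mulrC lerDl rnorm_ge0.
by rewrite mulrC -ler_pdivlMr.
Qed.

End interp_reflexivity.

(** ** Operators between the coordinates *)

Section interp_operators.
Variables (R : realType) (G : normedModType R[i]) (I : choiceType).
Variable W : gauge_family G I.
Implicit Types (L : blin G G) (i j : I) (k : R).

(** By the bipolar theorem this says that L has norm at most k and maps the i-th set
    into k times the closed absolutely convex hull of the j-th one. *)
Definition dominated L i j k : Prop :=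
  [/\ 0 <= k, rnorm L <= k & forall (y : dual G) (t : R),
    (forall w, W j w -> rnorm (y w) <= t) ->
    forall w, W i w -> rnorm (y (L w)) <= k * t].

Lemma gauge_dominated L i j k n g : dominated L i j k ->
  gauge (W j) n (L g) <= k * gauge (W i) n g.
Proof.
move=> [k0 Lk Lij]; apply: gauge_le => y [yn yW].
rewrite [X in rnorm X](_ : _ = (y \oB L : dual G) g)//.
apply: gauge_dual => // [|w Ww]; last exact: Lij.
apply: blin_norm_le => [|h]; first by rewrite mulr_ge0 ?exprn_ge0.
apply: le_trans (ler_blin y (L h)) _; rewrite [k * _]mulrC -mulrA.
apply: ler_pM; rewrite ?rnorm_ge0//; apply: le_trans (ler_blin _ _) _.
by rewrite ler_wpM2r ?rnorm_ge0.
Qed.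

Lemma hsn_scale (K : seq (I * nat)) (u v : I -> G) k : 0 <= k ->
  (forall i n, gauge (W i) n (v i) <= k * gauge (W i) n (u i)) ->
  hsn (gauge_fam W) K v <= k * hsn (gauge_fam W) K u.
Proof.
move=> k0 vu; rewrite hsn_le ?mulr_ge0 ?hsn_ge0// exprMn hsn_sq.
rewrite /sum_sq mulr_sumr ler_sum// => -[i n] _; rewrite -exprMn.
rewrite ler_pXn2r ?nnegrE ?mulr_ge0//; try exact: gauge_ge0.
exact: vu.
Qed.

Section diagonal.
Variables (L : blin G G) (k : R).
Hypothesis Lk : forall i, dominated L i i k.
Hypothesis k0 : 0 <= k.

Lemma diagonal_summable (x : interp W) :
  sq_summable (gauge_fam W) (fun i => L (hsval x i)).
Proof.
exists (k * rnorm x) => K uK; apply: (@le_trans _ _ (k * hsn (gauge_fam W) K (hsval x))).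
  by apply: hsn_scale => // i n; exact: gauge_dominated.
by rewrite ler_wpM2l// hsn_le_rnorm.
Qed.

Definition diagonal_fun (x : interp W) : interp W := mkhs (diagonal_summable x).

Lemma diagonal_linear : linear diagonal_fun.
Proof.
by move=> c x y; apply: val_inj; apply/funext => i /=; rewrite [LHS]linearP.
Qed.

Lemma diagonal_bounded (x : interp W) : rnorm (diagonal_fun x) <= k * rnorm x.
Proof.
apply: hs_norm_le => K uK; apply: (@le_trans _ _ (k * hsn (gauge_fam W) K (hsval x))).
  by apply: hsn_scale => // i n; exact: gauge_dominated.
by rewrite ler_wpM2l// hsn_le_rnorm.
Qed.

Definition diagonal : blin (interp W) (interp W) :=
  mkblin diagonal_linear (ex_intro _ k diagonal_bounded).

Lemma rnorm_diagonal : rnorm diagonal <= k.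
Proof. by apply: blin_norm_le => // x; exact: diagonal_bounded. Qed.

End diagonal.

Definition single i (g : G) : I -> G := fun j => if j == i then g else 0.

Lemma hsn_single (K : seq (I * nat)) i j (g : G) (u : I -> G) k : uniq K -> 0 <= k ->
  (forall n, gauge (W j) n g <= k * gauge (W i) n (u i)) ->
  exists2 K', uniq K' & hsn (gauge_fam W) K (single j g) <= k * hsn (gauge_fam W) K' u.
Proof.
move=> uK k0 gu; exists [seq (i, p.2) | p <- K & p.1 == j].
  rewrite map_inj_in_uniq ?filter_uniq// => -[i1 n1] [i2 n2].
  by rewrite !mem_filter /= => /andP[/eqP -> _] /andP[/eqP -> _] [->].
rewrite hsn_le ?mulr_ge0 ?hsn_ge0// exprMn hsn_sq /sum_sq big_map big_filter.
rewrite (bigID (fun p => p.1 == j)) /= [X in _ + X]big1 ?addr0; last first.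
  move=> [i1 n1] /= /negPf ij; rewrite /coord_gauge /single /= ij.
  by rewrite (seminorm0 (gauge_seminorm _ _)) expr0n.
rewrite mulr_sumr ler_sum// => -[i1 n1] /= /eqP ->.
rewrite /coord_gauge /single /= eqxx -exprMn.
rewrite ler_pXn2r ?nnegrE ?mulr_ge0//; exact: gauge_ge0.
Qed.

Section transfer.
Variables (L : blin G G) (i j : I) (k : R).
Hypothesis Lk : dominated L i j k.

Let transfer_le (x : interp W) (K : seq (I * nat)) : uniq K ->
  hsn (gauge_fam W) K (single j (L (hsval x i))) <= k * rnorm x.
Proof.
move=> uK; have [k0 _ _] := Lk.
have [|K' uK' h] := @hsn_single K i j (L (hsval x i)) (hsval x) k uK k0.
  by move=> n; exact: gauge_dominated.
by apply: le_trans h _; rewrite ler_wpM2l// hsn_le_rnorm.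
Qed.

Lemma transfer_summable (x : interp W) :
  sq_summable (gauge_fam W) (single j (L (hsval x i))).
Proof. by exists (k * rnorm x) => K; exact: transfer_le. Qed.

Definition transfer_fun (x : interp W) : interp W := mkhs (transfer_summable x).

Lemma transfer_linear : linear transfer_fun.
Proof.
move=> c x y; apply: val_inj; apply/funext => i' /=; rewrite /single.
rewrite [RHS](_ : _ = c *: (if i' == j then L (hsval x i) else 0) +
  (if i' == j then L (hsval y i) else 0))//.
by case: ifP => _; rewrite ?scaler0 ?addr0// [LHS]linearP.
Qed.

Lemma transfer_bounded (x : interp W) : rnorm (transfer_fun x) <= k * rnorm x.
Proof. by apply: hs_norm_le => K; exact: transfer_le. Qed.

Definition transfer : blin (interp W) (interp W) :=
  mkblin transfer_linear (ex_intro _ k transfer_bounded).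

Lemma transferE x : hsval (transfer x) = single j (L (hsval x i)).
Proof. by []. Qed.

Lemma rnorm_transfer : rnorm transfer <= k.
Proof. by have [k0 _ _] := Lk; apply: blin_norm_le => // x; exact: transfer_bounded. Qed.

End transfer.

Lemma sum_geometric (r : seq nat) : uniq r ->
  \sum_(n <- r) ((2 : R) ^+ n)^-1 ^+ 2 <= 2 ^+ 2.
Proof.
move=> ur; pose N := (\max_(n <- r) n).+1.
apply: (@le_trans _ _ (\sum_(n <- index_iota 0 N) ((2 : R) ^+ n)^-1 ^+ 2)).
  apply: ler_sum_uniq => // [n nr|n]; last exact: sqr_ge0.
  by rewrite mem_index_iota /= ltnS; exact: leq_bigmax_seq.
suff h m : \sum_(0 <= n < m) ((2 : R) ^+ n)^-1 ^+ 2 <= 2 - 2 * (2 ^+ m)^-1 ^+ 2.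
  by apply: le_trans (h _) _; have := sqr_ge0 ((2 : R) ^+ N)^-1; lra.
elim: m => [|m IH]; first by rewrite big_nil expr0 invr1 expr1n; lra.
rewrite big_nat_recr //=; apply: le_trans (lerD IH (lexx _)) _.
by rewrite (exprS (2 : R) m) invfM exprMn; have := sqr_ge0 ((2 : R) ^+ m)^-1; lra.
Qed.

Lemma single_summable i g c : (forall n, gauge (W i) n g <= c * (2 ^+ n)^-1) ->
  forall K, uniq K -> hsn (gauge_fam W) K (single i g) <= 2 * c.
Proof.
move=> gc K uK; have c0 : 0 <= c.
  by have := gc 0%N; rewrite expr0 invr1 mulr1; apply: le_trans; exact: gauge_ge0.
rewrite hsn_le ?mulr_ge0// exprMn /sum_sq (bigID (fun p => p.1 == i)) /=.
rewrite [X in _ + X]big1 ?addr0; last first.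
  move=> [i1 n1] /= /negPf ij; rewrite /coord_gauge /single /= ij.
  by rewrite (seminorm0 (gauge_seminorm _ _)) expr0n.
apply: (@le_trans _ _ (c ^+ 2 * \sum_(n <- [seq p.2 | p <- K & p.1 == i])
    ((2 : R) ^+ n)^-1 ^+ 2)).
  rewrite mulr_sumr big_map big_filter ler_sum// => -[i1 n1] /= /eqP ->.
  rewrite /coord_gauge /single /= eqxx -exprMn.
  rewrite ler_pXn2r ?nnegrE ?mulr_ge0 ?invr_ge0 ?exprn_ge0//; exact: gauge_ge0.
rewrite mulrC ler_wpM2r ?sqr_ge0//; apply: sum_geometric.
rewrite map_inj_in_uniq ?filter_uniq// => -[i1 n1] [i2 n2].
by rewrite !mem_filter /= => /andP[/eqP -> _] /andP[/eqP -> _] ->.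
Qed.

(** A vector in a multiple of the hull of the i-th set has gauges of the order of
    2^-n, whose squares are summable. *)
Lemma single_exists i g c : (forall n, gauge (W i) n g <= c * (2 ^+ n)^-1) ->
  exists2 x : interp W, hsval x = single i g & rnorm x <= 2 * c.
Proof.
move=> gc; have h := single_summable gc.
exists (mkhs (ex_intro _ (2 * c) h)) => //.
exact: hs_norm_le.
Qed.

End interp_operators.

(** * The module twisted by a derivation *)

Section product_norm.
Variables (R : realType) (E F : normedModType R[i]).
Implicit Types (p : E * F).

Lemma rnorm_pair p : rnorm p = Num.max (rnorm p.1) (rnorm p.2).
Proof.
rewrite {1}/rnorm ProdNormedZmodule.prod_normE !rnormE /Order.max ltcR.
by case: ifP.
Qed.

Lemma rnorm_pair_le p (M : R) :
  (rnorm p <= M) = (rnorm p.1 <= M) && (rnorm p.2 <= M).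
Proof. by rewrite rnorm_pair ge_max. Qed.

Lemma rnorm_fst p : rnorm p.1 <= rnorm p.
Proof. by rewrite rnorm_pair le_max lexx. Qed.

Lemma rnorm_snd p : rnorm p.2 <= rnorm p.
Proof. by rewrite rnorm_pair le_max lexx orbT. Qed.

Lemma pair_seq_complete : seq_complete E -> seq_complete F ->
  seq_complete (E * F)%type.
Proof.
move=> Ec Fc u uC.
have [|l lP] := Ec (fun n => (u n).1).
  move=> e /uC[N NP]; exists N => m n Nm Nn.
  exact: le_lt_trans (rnorm_fst (u m - u n)) (NP _ _ Nm Nn).
have [|k kP] := Fc (fun n => (u n).2).
  move=> e /uC[N NP]; exists N => m n Nm Nn.
  exact: le_lt_trans (rnorm_snd (u m - u n)) (NP _ _ Nm Nn).
exists (l, k) => e e0; have [N NP] := lP _ e0; have [N' N'P] := kP _ e0.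
exists (maxn N N') => n; rewrite geq_max => /andP[/NP h /N'P h'].
by rewrite rnorm_pair gt_max h h'.
Qed.

End product_norm.

Lemma ball_homogeneous (R : realType) (X : normedModType R[i]) (f : X -> R[i]^o)
    (t : R) : linear f -> (forall x, rnorm x <= 1 -> rnorm (f x) <= t) ->
  forall x, rnorm (f x) <= rnorm x * t.
Proof.
move=> lf ft x; have [->|x0] := eqVneq x 0.
  by rewrite (linear_fun0 lf) !rnorm0 mul0r.
have rx : 0 < rnorm x by rewrite rnorm_gt0.
have := ft (((rnorm x)^-1)%:C *: x).
rewrite (linear_funZ lf) !rnormZ rnormC gtr0_norm ?invr_gt0// mulVf ?gt_eqF//.
by move=> /(_ (lexx _)); rewrite ler_pdivrMl.
Qed.

Section derivation_module.
Variables (R : realType) (A : dualBanachAlg R) (e : A).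
Hypothesis he : is_unit e.
Variables (F : banachBimodule A) (d : blin A (dual F)).
Hypothesis normalF : normal_dual F.
Hypothesis der : is_derivation d.
Hypothesis d_normal : forall x, normal_functional (fun a => d a x).
Implicit Types (a b c : A) (z : predual A) (x : F) (nu : dual F).

Lemma normal_lact nu x : normal_functional (fun a => nu (lact F a x)).
Proof.
have [_ /wstar_normal] := normalF nu; apply.
by move=> y k a b; rewrite /dual_pairing /dual_ract !blin_compE (blin_linear (lact F)) blin_linE (blin_linear nu).
Qed.

Lemma normal_ract nu x : normal_functional (fun a => nu (ract F a x)).
Proof.
have [/wstar_normal h _] := normalF nu; apply: h.
by move=> y k a b; rewrite /dual_pairing /dual_lact !blin_compE (blin_linear (ract F)) blin_linE (blin_linear nu).
Qed.

Lemma normal_mulr a z : normal_functional (fun b => predual_map (a *b b) z).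
Proof.
have /wstar_normal := @bmul_wstar_continuousr R A a; apply => y k b c.
by rewrite (bmul_linearr a) predual_map_linear.
Qed.

Lemma normal_mull a z : normal_functional (fun b => predual_map (b *b a) z).
Proof.
have /wstar_normal := @bmul_wstar_continuousl R A a; apply => y k b c.
by rewrite (bmul_linearl a) predual_map_linear.
Qed.

(** The functional a |-> <a . nu, x> = <nu, x . a> as an element of the predual. *)
Definition coef nu x : predual A := projT1 (cid (normal_ract nu x)).

Lemma coefE nu x a : predual_map a (coef nu x) = nu (ract F a x).
Proof. exact: (esym (projT2 (cid (normal_ract nu x)) a)). Qed.

(** The two translations on the predual, which are the pre-adjoints of the
    multiplications of A. *)
Definition lmul a z : predual A := projT1 (cid (normal_mull a z)).
Definition rmul a z : predual A := projT1 (cid (normal_mulr a z)).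

Lemma lmulE a z b : predual_map b (lmul a z) = predual_map (b *b a) z.
Proof. exact: (esym (projT2 (cid (normal_mull a z)) b)). Qed.

Lemma rmulE a z b : predual_map b (rmul a z) = predual_map (a *b b) z.
Proof. exact: (esym (projT2 (cid (normal_mulr a z)) b)). Qed.

Lemma predual_linE a k z w :
  predual_map a (k *: z + w) = k *: predual_map a z + predual_map a w.
Proof. exact: blin_linear. Qed.

Lemma coef_linearl x : linear (coef ^~ x).
Proof. by move=> k nu nu'; apply: predual_ext => a; rewrite predual_linE !coefE. Qed.

Lemma coef_linearr nu : linear (coef nu).
Proof.
move=> k x y; apply: predual_ext => a; rewrite predual_linE !coefE.
by rewrite (blin_linear (ract F a)) (blin_linear nu).
Qed.

Lemma lmul_linearr a : linear (lmul a).
Proof. by move=> k z w; apply: predual_ext => b; rewrite predual_linE !lmulE predual_linE. Qed.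

Lemma lmul_linearl z : linear (lmul ^~ z).
Proof.
move=> k a b; apply: predual_ext => c; rewrite predual_linE !lmulE.
by rewrite (bmul_linearr c) predual_map_linear.
Qed.

Lemma rmul_linearr a : linear (rmul a).
Proof. by move=> k z w; apply: predual_ext => b; rewrite predual_linE !rmulE predual_linE. Qed.

Lemma rnorm_bmul a b : rnorm (a *b b) <= rnorm a * rnorm b.
Proof. by have := ler_bnormM a b; rewrite !rnormE -rmorphM lecR. Qed.

Lemma rnorm_coef nu x : rnorm (coef nu x) <= rnorm (ract F) * rnorm nu * rnorm x.
Proof.
apply: rnorm_predual_le => [|a]; first by rewrite !mulr_ge0 ?rnorm_ge0.
rewrite coefE; apply: le_trans (ler_blin nu _) _.
have h1 := ler_blin (ract F) a; have h2 := ler_blin (ract F a) x.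
apply: (@le_trans _ _ (rnorm nu * (rnorm (ract F) * rnorm a * rnorm x))).
  rewrite ler_wpM2l ?rnorm_ge0//; apply: le_trans h2 _.
  by rewrite ler_wpM2r ?rnorm_ge0.
by rewrite le_eqVlt; apply/orP; left; apply/eqP; ring.
Qed.

Lemma rnorm_lmul a z : rnorm (lmul a z) <= rnorm a * rnorm z.
Proof.
apply: rnorm_predual_le => [|b]; first by rewrite mulr_ge0 ?rnorm_ge0.
rewrite lmulE; apply: le_trans (ler_predual_map _ _) _; rewrite mulrAC.
by rewrite ler_wpM2r ?rnorm_ge0// mulrC rnorm_bmul.
Qed.

Lemma rnorm_rmul a z : rnorm (rmul a z) <= rnorm a * rnorm z.
Proof.
apply: rnorm_predual_le => [|b]; first by rewrite mulr_ge0 ?rnorm_ge0.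
rewrite rmulE; apply: le_trans (ler_predual_map _ _) _; rewrite mulrAC.
by rewrite ler_wpM2r ?rnorm_ge0// rnorm_bmul.
Qed.

Local Notation G := (predual A * F)%type.
Implicit Types (g : G) (y : dual G).

Let act_fun a g : G := (lmul a g.1 + coef (d a) g.2, lact F a g.2).

Let act_linearr a : linear (act_fun a).
Proof.
move=> k g h; congr pair; last exact: (blin_linear (lact F a)).
rewrite [LHS](_ : _ = lmul a (k *: g.1 + h.1) + coef (d a) (k *: g.2 + h.2))//.
rewrite [RHS](_ : _ = k *: (lmul a g.1 + coef (d a) g.2) + (lmul a h.1 + coef (d a) h.2))//.
by rewrite lmul_linearr coef_linearr scalerDr addrACA.
Qed.

Let act_linearl g : linear (act_fun ^~ g).
Proof.
move=> k a b; rewrite /act_fun (lmul_linearl g.1) (blin_linear d) (coef_linearl g.2).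
congr pair; first by rewrite /= scalerDr addrACA.
by rewrite (blin_linear (lact F)) blin_linE.
Qed.

Definition act_const : R := 1 + rnorm (ract F) * rnorm d + rnorm (lact F).

Lemma act_const_ge0 : 0 <= act_const.
Proof. by rewrite !addr_ge0 ?mulr_ge0 ?rnorm_ge0. Qed.

Let act_bound a g : rnorm (act_fun a g) <= act_const * rnorm a * rnorm g.
Proof.
have g1 := rnorm_fst g; have g2 := rnorm_snd g.
have h0 : 0 <= rnorm a * rnorm g by rewrite mulr_ge0 ?rnorm_ge0.
have h1 : rnorm (lmul a g.1) <= rnorm a * rnorm g.
  by apply: le_trans (rnorm_lmul _ _) _; rewrite ler_wpM2l ?rnorm_ge0.
have h2 : rnorm (coef (d a) g.2) <= rnorm (ract F) * rnorm d * (rnorm a * rnorm g).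
  apply: le_trans (rnorm_coef _ _) _; rewrite mulrA -[X in _ <= X * _]mulrA.
  by apply: ler_pM; rewrite ?mulr_ge0 ?rnorm_ge0// ler_wpM2l ?rnorm_ge0// ler_blin.
have h3 : rnorm (lact F a g.2) <= rnorm (lact F) * (rnorm a * rnorm g).
  apply: le_trans (ler_blin _ _) _; rewrite mulrA.
  by apply: ler_pM; rewrite ?rnorm_ge0// ler_blin.
have c1 : 0 <= rnorm (ract F) * rnorm d by rewrite mulr_ge0 ?rnorm_ge0.
have c2 : 0 <= rnorm (lact F) by exact: rnorm_ge0.
have e1 : 0 <= rnorm (ract F) * rnorm d * (rnorm a * rnorm g) by rewrite mulr_ge0.
have e2 : 0 <= rnorm (lact F) * (rnorm a * rnorm g) by rewrite mulr_ge0.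
rewrite -mulrA /act_const !mulrDl mul1r rnorm_pair_le /=; apply/andP; split.
  by apply: le_trans (ler_rnormD _ _) _; apply: le_trans (lerD h1 h2) _; rewrite lerDl.
by apply: le_trans h3 _; rewrite lerDr addr_ge0.
Qed.

(** The left action a . (f, x) = (a . f + <. d(a), x>, a . x). The derivation law is
    what makes it associative; the orbit of (0, x) consists of the vectors
    (<. d(a), x>, a . x), so that d appears as the defect of the projection to the
    first summand from being a module map. *)
Definition act : blin A (blin G G) := mkblin2 act_linearr act_linearl act_bound.

Lemma actE a g : act a g = (lmul a g.1 + coef (d a) g.2, lact F a g.2).
Proof. by []. Qed.

Lemma rnorm_act a : rnorm (act a) <= act_const * rnorm a.
Proof.
apply: blin_norm_le => [|g]; last exact: act_bound.
by rewrite mulr_ge0 ?rnorm_ge0 ?act_const_ge0.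
Qed.

Lemma derE a b x : d (a *b b) x = d b (ract F a x) + d a (lact F b x).
Proof. by rewrite der. Qed.

Lemma actM a b g : act (a *b b) g = act a (act b g).
Proof.
rewrite !actE /=; congr pair; last exact: lactM.
apply: predual_ext => c; rewrite !linearD /= !(lmulE, coefE) linearD /= !(lmulE, coefE).
by rewrite derE bmulA -addrA ractM lractA.
Qed.

Lemma dual_fst y : exists b, forall z, y (z, 0) = predual_map b z.
Proof.
have lin : linear (fun z => y (z, 0) : R[i]^o).
  by move=> k z w; rewrite -(blin_linear y); congr (y (_, _)); rewrite /= scaler0 addr0.
have bd : exists M : R, forall z, rnorm (y (z, 0)) <= M * rnorm z.
  exists (rnorm y) => z; apply: le_trans (ler_blin _ _) _.
  by rewrite ler_wpM2l ?rnorm_ge0// rnorm_pair_le /= lexx rnorm0 rnorm_ge0.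
have [b bE] := predual_map_surjective (mkblin lin bd : dual (predual A)).
by exists b => z; rewrite bE.
Qed.

Lemma dual_snd y : exists nu, forall x, y (0, x) = nu x.
Proof.
have lin : linear (fun x => y (0, x) : R[i]^o).
  by move=> k z w; rewrite -(blin_linear y); congr (y (_, _)); rewrite /= scaler0 addr0.
have bd : exists M : R, forall x, rnorm (y (0, x)) <= M * rnorm x.
  exists (rnorm y) => x; apply: le_trans (ler_blin _ _) _.
  by rewrite ler_wpM2l ?rnorm_ge0// rnorm_pair_le /= lexx rnorm0 rnorm_ge0.
by exists (mkblin lin bd : dual F).
Qed.

Lemma act_normal y g : normal_functional (fun a => y (act a g)).
Proof.
have [b bE] := dual_fst y; have [nu nuE] := dual_snd y.
have [z zE] := normal_add (normal_add (normal_mulr b g.1) (d_normal (ract F b g.2)))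
  (normal_lact nu g.2).
exists z => a; rewrite -zE actE.
have -> : (lmul a g.1 + coef (d a) g.2, lact F a g.2) =
    (lmul a g.1 + coef (d a) g.2, 0) + (0, lact F a g.2) :> G.
  by congr pair; rewrite /= ?addr0 ?add0r.
by rewrite (linear_funD (blin_linear y)) bE nuE linearD /= lmulE coefE.
Qed.

(** Two weakly compact sets that the action maps into multiples of themselves.
    Finite unions are indexed by lists of vectors x; the boolean tells whether the
    orbits of (0, x) are included or only the coefficients, which lie in the first
    summand. *)
Definition coef_ball x : set G := [set (coef nu x, 0) | nu in [set nu | rnorm nu <= 1]].
Definition orbit_ball x : set G := [set act a (0, x) | a in [set a | rnorm a <= 1]].

Fixpoint orbits (b : bool) (s : seq F) : set G :=
  if s is x :: s' then
    coef_ball x `|` (if b then orbit_ball x else set0) `|` orbits b s'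
  else set0.

Lemma orbitsP (b : bool) s w : orbits b s w <->
  exists2 x, x \in s & coef_ball x w \/ b /\ orbit_ball x w.
Proof.
elim: s => [|x s IH] /=; first by split=> [|[]].
split=> [[[Cw|Ow]|/IH[u us uw]]|[u]].
- by exists x; [rewrite inE eqxx|left].
- by exists x; [rewrite inE eqxx|right; case: (b) Ow].
- by exists u; [rewrite inE us orbT|].
rewrite inE => /orP[/eqP ->|us]; last by move=> uw; right; apply/IH; exists u.
case=> [Cw|[bT Ow]]; first by left; left.
by left; right; rewrite bT.
Qed.

Lemma coef_ball_bounded x : rbounded (coef_ball x).
Proof.
exists (rnorm (ract F) * rnorm x) => _ [nu nu1 <-]; rewrite rnorm_pair_le /= rnorm0.
rewrite mulr_ge0 ?rnorm_ge0// andbT; apply: le_trans (rnorm_coef _ _) _.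
by rewrite mulrAC ler_piMr// mulr_ge0 ?rnorm_ge0.
Qed.

Lemma orbit_ball_bounded x : rbounded (orbit_ball x).
Proof.
exists (act_const * rnorm ((0, x) : G)) => _ [a a1 <-]; apply: le_trans (act_bound _ _) _.
rewrite ler_wpM2r ?rnorm_ge0// ler_piMr//; exact: act_const_ge0.
Qed.

Lemma rboundedU (S S' : set G) : rbounded S -> rbounded S' -> rbounded (S `|` S').
Proof.
move=> [M SM] [M' SM']; exists (Num.max M M') => w [/SM h|/SM' h].
  by rewrite le_max h.
by rewrite le_max h orbT.
Qed.

Lemma rbounded0 : rbounded (set0 : set G).
Proof. by exists 0. Qed.

Lemma orbits_bounded (b : bool) s : rbounded (orbits b s).
Proof.
elim: s => [|x s IH] /=; first exact: rbounded0.
apply: rboundedU => //; apply: rboundedU; first exact: coef_ball_bounded.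
by case: b {IH}; [exact: orbit_ball_bounded|exact: rbounded0].
Qed.

(** For fixed x the pre-adjoint of nu |-> (coef nu x, 0) takes values in F: this is
    where b . nu has to be paired with x by moving b to x. *)
Lemma coef_ball_compact x : weakly_compact_hull (coef_ball x).
Proof.
apply: (@weakly_compact_hull_ball R F G (fun nu => (coef nu x, 0))).
  move=> k nu nu'; congr pair; first exact: coef_linearl.
  by rewrite /= scaler0 addr0.
move=> y; have [b bE] := dual_fst y.
by exists (ract F b x) => nu; rewrite -coefE bE.
Qed.

Lemma predual_map_inj a b : predual_map a = predual_map b -> a = b.
Proof.
move=> ab; apply/eqP; rewrite -subr_eq0; apply/eqP/rnorm0_eq0.
rewrite -rnorm_predual_map (linear_funB (@predual_map_linear R A)) ab subrr.
exact: rnorm0.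
Qed.

(** The orbit map is weak* to weak continuous on A, which is the dual of its
    predual. *)
Lemma orbit_ball_compact x : weakly_compact_hull (orbit_ball x).
Proof.
have /choice[inv invE] := @predual_map_surjective R A.
have -> : orbit_ball x = (fun nu : dual (predual A) => act (inv nu) (0, x)) @`
    [set nu : dual (predual A) | rnorm nu <= 1].
  apply/seteqP; split=> w [].
    move=> a /= a1 <-; exists (predual_map a : dual (predual A)) => /=.
      by rewrite rnorm_predual_map.
    by congr (act _ _); apply: predual_map_inj; rewrite invE.
  move=> nu /= nu1 <-; exists (inv nu) => //=.
  by rewrite -rnorm_predual_map invE.
apply: weakly_compact_hull_ball => [k nu nu'|y].
  have -> : inv (k *: nu + nu') = k *: inv nu + inv nu'.
    by apply: predual_map_inj; rewrite predual_map_linear !invE.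
  by rewrite (blin_linear act).
have [z zE] := act_normal y (0, x); exists z => nu.
by rewrite zE invE.
Qed.

Lemma orbits_compact (b : bool) s : weakly_compact_hull (orbits b s).
Proof.
elim: s => [|x s IH] /=; first exact: weakly_compact_hull0.
have bO : rbounded (if b then orbit_ball x else set0).
  by case: (b); [exact: orbit_ball_bounded|exact: rbounded0].
apply: weakly_compact_hullU => //.
- by apply: rboundedU => //; exact: coef_ball_bounded.
- exact: orbits_bounded.
- apply: weakly_compact_hullU => //; first exact: coef_ball_bounded.
    exact: coef_ball_compact.
  by case: (b); [exact: orbit_ball_compact|exact: weakly_compact_hull0].
Qed.

Definition orbit_family : gauge_family G (bool * seq F)%type :=
  @GaugeFamily R G (bool * seq F)%type (fun i => orbits i.1 i.2)
    (fun i => orbits_bounded i.1 i.2).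

End derivation_module.

(** * Representations on interpolation spaces *)

Section quasi_expectation_facts.
Variables (R : realType) (E : normedModType R[i]) (C : set (blin E E)).
Variable Q : blin (blin E E) (blin E E).
Hypothesis qeQ : quasi_expectation C Q.

Lemma commutant_id : commutant C (blin_id E).
Proof. by move=> S _; apply: blinP. Qed.

Lemma expectation_commutant T : commutant C (Q T).
Proof. by have [<- _ _] := qeQ; exists T. Qed.

Lemma expectation_fix T : commutant C T -> Q T = T.
Proof. by have [rQ QQ _] := qeQ; rewrite -rQ => -[S _ <-]; exact: QQ. Qed.

Lemma expectation_left c T : commutant C c -> Q (c \oB T) = c \oB Q T.
Proof.
move=> cC; have [_ _ QM] := qeQ.
have h (S : blin E E) : S \oB blin_id E = S by exact: blinP.
by have := QM c (blin_id E) T cC commutant_id; rewrite !h.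
Qed.

Lemma expectation_right T c : commutant C c -> Q (T \oB c) = Q T \oB c.
Proof.
move=> cC; have [_ _ QM] := qeQ.
have h (S : blin E E) : blin_id E \oB S = S by exact: blinP.
by have := QM (blin_id E) c T commutant_id cC; rewrite !h.
Qed.

End quasi_expectation_facts.

Section diagonal_representation.
Variables (R : realType) (A : dualBanachAlg R) (e : A).
Variables (G : normedModType R[i]) (I : choiceType) (W : gauge_family G I).
Variable rho : blin A (blin G G).
Hypothesis rhoM : forall a b g, rho (a *b b) g = rho a (rho b g).
Hypothesis rho_normal : forall (y : dual G) g, normal_functional (fun a => y (rho a g)).
Hypothesis rho_unit : forall i w, W i w -> rho e w = w.
Variable C : R.
Hypothesis C0 : 0 <= C.
Hypothesis rho_dominated : forall a i, dominated W (rho a) i i (C * rnorm a).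

Local Notation E := (interp W).

Let k0 (a : A) : 0 <= C * rnorm a.
Proof. by rewrite mulr_ge0 ?rnorm_ge0. Qed.

Definition diag_rep a : blin E E := diagonal (rho_dominated a) (k0 a).

Lemma diag_repE a (x : E) i : hsval (diag_rep a x) i = rho a (hsval x i).
Proof. by []. Qed.

Lemma hsval_ext (x y : E) : (forall i, hsval x i = hsval y i) -> x = y.
Proof. by move=> h; apply: val_inj; exact/funext. Qed.

Lemma hsval_linE k (x y : E) i :
  hsval (k *: x + y) i = k *: hsval x i + hsval y i.
Proof. by []. Qed.

Lemma diag_rep_linear : linear diag_rep.
Proof.
move=> k a b; apply: blinP => x; apply: hsval_ext => i.
rewrite diag_repE (blin_linear rho) blin_linE [RHS](_ : _ = hsval (k *: diag_rep a x + diag_rep b x) i)//.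
Qed.

(** The unit acts as the identity on the sets W i, hence on the closed spans, where
    the coordinates live. *)
Lemma diag_rep_unital : unital_representation e diag_rep.
Proof.
split; first exact: diag_rep_linear.
  by move=> a b; apply: blinP => x; apply: hsval_ext => i; rewrite diag_repE rhoM.
apply: blinP => x; apply: hsval_ext => i; rewrite diag_repE.
apply: dual_separates => y; apply/eqP; rewrite -subr_eq0; apply/eqP.
have := @gauge_vanish R G (W i) (hsval x i) ((y \oB rho e : dual G) - y) (rnorm x).
rewrite blinBE blin_compE; apply=> [n|w Ww]; first exact: gauge_le_rnorm.
by rewrite blinBE blin_compE (rho_unit Ww) subrr.
Qed.

Lemma rnorm_diag_rep (a : A) : rnorm (diag_rep a) <= C * rnorm a.
Proof. exact: rnorm_diagonal. Qed.

Lemma diag_rep_normal (mu : dual E) x : normal_functional (fun a => mu (diag_rep a x)).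
Proof.
apply: normal_closed => r r0.
have D0 : 0 < C * rnorm x + 1 by rewrite ltr_wpDl ?mulr_ge0 ?rnorm_ge0.
have [l lP] := interp_dual_dense mu (divr_gt0 r0 D0).
set nu := \sum_(p <- l) _ in lP.
exists (fun a => \sum_(p <- l) p.2 (rho a (hsval x p.1))).
  by apply: normal_sum => p; exact: rho_normal.
move=> a; have -> : \sum_(p <- l) p.2 (rho a (hsval x p.1)) = nu (diag_rep a x).
  by rewrite /nu; elim: (l) => [|p m IH]; rewrite ?big_nil// !big_cons blinDE -IH.
rewrite -blinBE; apply: le_trans (ler_blin _ _) _.
have h : rnorm (diag_rep a x) <= C * rnorm a * rnorm x.
  apply: le_trans (ler_blin _ _) _; rewrite ler_wpM2r ?rnorm_ge0//.
  exact: rnorm_diag_rep.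
apply: le_trans (ler_pM (rnorm_ge0 _) (rnorm_ge0 _) lP h) _.
rewrite mulrAC ler_pdivrMr// -[X in _ <= X]mulrA ler_wpM2l ?(ltW r0)//.
rewrite (_ : rnorm a * _ = C * rnorm a * rnorm x + rnorm a); last by ring.
by rewrite lerDl rnorm_ge0.
Qed.

Lemma diag_rep_wstar :
  wstar_continuous predual_map (@operator_pairing R E) diag_rep.
Proof.
apply: (normal_rep_wstar diag_rep_linear rnorm_diag_rep).
exact: diag_rep_normal.
Qed.

Lemma injective_interp : injective_dba e -> seq_complete G ->
  (forall i, weakly_compact_hull (W i)) ->
  exists Q : blin (blin E E) (blin E E), quasi_expectation (range diag_rep) Q.
Proof.
move=> inj Gc wc.
exact: (inj (complete_pack (@interp_seq_complete R G I W Gc))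
  (interp_reflexive Gc wc) diag_rep diag_rep_unital diag_rep_wstar).
Qed.

Lemma transfer_commutant (L : blin G G) i j k (Lk : dominated W L i j k) :
  (forall a g, L (rho a g) = rho a (L g)) ->
  commutant (range diag_rep) (transfer Lk).
Proof.
move=> Lrho _ [a _ <-]; apply: blinP => x; apply: hsval_ext => i'.
rewrite [LHS](_ : _ = single j (L (rho a (hsval x i))) i')//.
rewrite [RHS](_ : _ = rho a (single j (L (hsval x i)) i'))// /single.
by case: ifP => _; rewrite ?Lrho// linear0.
Qed.

End diagonal_representation.

(** * Averaging the projection *)

Section embedded_vectors.
Variables (R : realType) (G : normedModType R[i]) (I : choiceType).
Variable W : gauge_family G I.
Implicit Types (i j : I) (g h : G).

(** A vector with this property gives an element of the space with g as its only
    nonzero coordinate. *)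
Definition admissible i g : Prop :=
  exists c : R, forall n, gauge (W i) n g <= c * (2 ^+ n)^-1.

Lemma admissible_lin i k g h : admissible i g -> admissible i h ->
  admissible i (k *: g + h).
Proof.
move=> [c cP] [c' c'P]; exists (rnorm (k : R[i]^o) * c + c') => n.
have [gD gZ] := gauge_seminorm (W i) n; apply: le_trans (gD _ _) _.
rewrite mulrDl gZ -mulrA; apply: lerD => //.
by rewrite ler_wpM2l ?rnorm_ge0.
Qed.

Lemma admissible_dominated (L : blin G G) i j k g : dominated W L i j k ->
  admissible i g -> admissible j (L g).
Proof.
move=> LD [c cP]; exists (k * c) => n; have [k0 _ _] := LD.
by apply: le_trans (gauge_dominated n g LD) _; rewrite -mulrA ler_wpM2l.
Qed.

Definition embed i g : interp W :=
  xget 0 [set x : interp W | hsval x = single i g].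

Lemma embedE i g : admissible i g -> hsval (embed i g) = single i g.
Proof.
move=> [c cP]; have [x xE _] := single_exists cP.
exact: (xgetPex 0 (ex_intro _ x xE : exists x, [set x : interp W | hsval x = single i g] x)).
Qed.

Lemma rnorm_embed i g c : (forall n, gauge (W i) n g <= c * (2 ^+ n)^-1) ->
  rnorm (embed i g) <= 2 * c.
Proof.
move=> gc; have [x xE xc] := single_exists gc.
suff -> : embed i g = x by [].
by apply: val_inj; rewrite [LHS]embedE ?xE//; exists c.
Qed.

Lemma single_self i g : single i g i = g.
Proof. by rewrite /single eqxx. Qed.

Lemma single_lin i k g h : single i (k *: g + h) = k *: single i g + single i h.
Proof.
apply/funext => j; rewrite /single.
rewrite [RHS](_ : _ = k *: (if j == i then g else 0) + (if j == i then h else 0))//.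
by case: ifP => _; rewrite ?scaler0 ?addr0.
Qed.

Lemma embed_lin i k g h : admissible i g -> admissible i h ->
  embed i (k *: g + h) = k *: embed i g + embed i h.
Proof.
move=> ag ah; apply: val_inj; rewrite [LHS]embedE; last exact: admissible_lin.
rewrite [RHS](_ : _ = k *: hsval (embed i g) + hsval (embed i h))//.
by rewrite !embedE// single_lin.
Qed.

Lemma transfer_embed (L : blin G G) i j k g (LD : dominated W L i j k) :
  admissible i g -> transfer LD (embed i g) = embed j (L g).
Proof.
move=> ag; apply: val_inj; rewrite [RHS]embedE; last exact: admissible_dominated LD ag.
by rewrite [LHS]transferE embedE// single_self.
Qed.

Lemma transfer_square (L L' M M' : blin G G) i j j' l k k' m m'
    (LD : dominated W L j l k) (LD' : dominated W L' i j k')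
    (MD : dominated W M j' l m) (MD' : dominated W M' i j' m') :
  (forall x : interp W, L (L' (hsval x i)) = M (M' (hsval x i))) ->
  transfer LD \oB transfer LD' = transfer MD \oB transfer MD'.
Proof.
move=> LM; apply: blinP => x; apply: val_inj.
rewrite [LHS](_ : _ = single l (L (single j (L' (hsval x i)) j)))//.
rewrite [RHS](_ : _ = single l (M (single j' (M' (hsval x i)) j')))//.
by rewrite !single_self LM.
Qed.

End embedded_vectors.

Section implementing_functional.
Variables (R : realType) (A : dualBanachAlg R) (e : A).
Hypothesis he : is_unit e.
Variables (F : banachBimodule A) (d : blin A (dual F)).
Hypothesis normalF : normal_dual F.
Hypothesis der : is_derivation d.
Hypothesis d_normal : forall x, normal_functional (fun a => d a x).
Hypothesis d_unit : d e = 0.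
Hypothesis inj : injective_dba e.
Implicit Types (a b c : A) (z : predual A) (x : F) (nu : dual F) (k : R).

Local Notation G := (predual A * F)%type.
Local Notation I := (bool * seq F)%type.
Local Notation W := (orbit_family d normalF).
Local Notation act := (act d normalF).
Local Notation coef := (coef normalF).
Implicit Types (i j : I) (g w : G) (y : dual G).

Let eM a : e *b a = a. Proof. by case: he. Qed.
Let Me a : a *b e = a. Proof. by case: he. Qed.

Definition in_ball k j w : Prop :=
  (exists2 x, x \in j.2 & exists2 nu, rnorm nu <= k & w = (coef nu x, 0)) \/
  (j.1 /\ exists2 x, x \in j.2 & exists2 a, rnorm a <= k & w = act a (0, x)).

Lemma in_ball1 j w : W j w -> in_ball 1 j w.
Proof.
move=> /orbitsP[x xs [[nu nu1 <-]|[jT [a a1 <-]]]].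
  by left; exists x => //; exists nu.
by right; split=> //; exists x => //; exists a.
Qed.

Lemma in_ball_test k j w y (t : R) : in_ball k j w ->
  (forall w, W j w -> rnorm (y w) <= t) -> rnorm (y w) <= k * t.
Proof.
move=> jw yt; have bound r : 0 <= r -> r <= k -> 0 <= t -> r * t <= k * t.
  by move=> *; rewrite ler_wpM2r.
case: jw => [[x xs [nu nuk ->]]|[jT [x xs [a ak ->]]]].
- have lin : linear (fun nu => y (coef nu x, 0) : R[i]^o).
    move=> c nu1 nu2; rewrite -(blin_linear y); congr (y (_, _)).
      by rewrite (coef_linearl normalF x).
    by rewrite /= scaler0 addr0.
  have h nu1 : rnorm nu1 <= 1 -> rnorm (y (coef nu1 x, 0)) <= t.
    by move=> n1; apply: yt; apply/orbitsP; exists x => //; left; exists nu1.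
  apply: le_trans (ball_homogeneous lin h nu) _; apply: bound => //.
    exact: rnorm_ge0.
  by apply: le_trans (h 0 _); rewrite ?rnorm_ge0// rnorm0.
- have lin : linear (fun a => y (act a (0, x)) : R[i]^o).
    by move=> c a1 a2; rewrite (blin_linear act) blin_linE (blin_linear y).
  have h a1 : rnorm a1 <= 1 -> rnorm (y (act a1 (0, x))) <= t.
    by move=> n1; apply: yt; apply/orbitsP; exists x => //; right; split=> //; exists a1.
  apply: le_trans (ball_homogeneous lin h a) _; apply: bound => //.
    exact: rnorm_ge0.
  by apply: le_trans (h 0 _); rewrite ?rnorm_ge0// rnorm0.
Qed.

Lemma in_ball_gauge k j w n : in_ball k j w -> gauge (W j) n w <= k * (2 ^+ n)^-1.
Proof. by move=> jw; apply: gauge_le => y [_ yW]; exact: in_ball_test jw yW. Qed.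

Lemma in_ball_admissible k j w : in_ball k j w -> admissible W j w.
Proof. by move=> jw; exists k => n; exact: in_ball_gauge. Qed.

Lemma dominated_intro (L : blin G G) i j k : 0 <= k -> rnorm L <= k ->
  (forall w, W i w -> in_ball k j (L w)) -> dominated W L i j k.
Proof.
move=> k0 Lk LW; split=> // y t yt w Ww.
exact: in_ball_test (LW _ Ww) yt.
Qed.

Lemma rnorm_dual_lact a nu : rnorm (dual_lact a nu) <= rnorm (ract F) * rnorm a * rnorm nu.
Proof.
apply: le_trans (rnorm_blin_comp _ _) _; rewrite mulrC.
by rewrite ler_wpM2r ?rnorm_ge0// ler_blin.
Qed.

Lemma act_coef a nu x : act a (coef nu x, 0) = (coef (dual_lact a nu) x, 0).
Proof.
rewrite actE /=; congr pair; last exact: linear0.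
apply: predual_ext => b.
rewrite (linear_fun0 (coef_linearr normalF (d a))) addr0 lmulE !coefE ractM.
by rewrite blin_compE.
Qed.

Definition dom_const : R := act_const d + rnorm (ract F) + 1.

Lemma dom_const_ge0 : 0 <= dom_const.
Proof.
rewrite /dom_const; apply: addr_ge0 => //.
by apply: addr_ge0; [exact: act_const_ge0|exact: rnorm_ge0].
Qed.

Lemma act_dominated a i : dominated W (act a) i i (dom_const * rnorm a).
Proof.
have a0 := rnorm_ge0 a; have c0 := act_const_ge0 d.
have r0 := rnorm_ge0 (ract F).
apply: dominated_intro; first by rewrite mulr_ge0 ?dom_const_ge0.
  apply: le_trans (rnorm_act d normalF a) _; rewrite ler_wpM2r//.
  by rewrite /dom_const -addrA lerDl addr_ge0.
move=> _ /orbitsP[x xs [[nu nu1 <-]|[jT [b b1 <-]]]].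
  left; exists x => //; exists (dual_lact a nu); last exact: act_coef.
  apply: le_trans (rnorm_dual_lact _ _) _; rewrite -mulrA mulrA.
  apply: (@le_trans _ _ (rnorm (ract F) * rnorm a)).
    by rewrite ler_piMr// mulr_ge0.
  by rewrite ler_wpM2r// /dom_const addrAC lerDr addr_ge0.
right; split=> //; exists x => //; exists (a *b b); last by rewrite -actM.
apply: le_trans (rnorm_bmul _ _) _; apply: (@le_trans _ _ (rnorm a)).
  by rewrite ler_piMr.
by rewrite ler_peMl// /dom_const lerDr addr_ge0.
Qed.

Lemma act_unit i w : W i w -> act e w = w.
Proof.
move=> /orbitsP[x xs [[nu nu1 <-]|[jT [b b1 <-]]]].
  rewrite act_coef; congr pair; apply: predual_ext => a.
  by rewrite !coefE blin_compE -ractM Me.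
by rewrite -(actM normalF der) eM.
Qed.

Let proj_linear : linear (fun g : G => (g.1, 0) : G).
Proof. by move=> k g h; congr pair; rewrite /= scaler0 addr0. Qed.

Let proj_bound g : rnorm ((g.1, 0) : G) <= 1 * rnorm g.
Proof. by rewrite mul1r rnorm_pair_le /= rnorm_fst rnorm0 rnorm_ge0. Qed.

(** The projection to the first summand is not a module map, by proj_act; it will be
    averaged by a quasi-expectation. *)
Definition proj : blin G G := mkblin proj_linear (ex_intro _ 1 proj_bound).

Lemma projE g : proj g = (g.1, 0). Proof. by []. Qed.

Definition proj_const : R := 1 + rnorm d.

Lemma proj_act a x : proj (act a (0, x)) = (coef (d a) x, 0).
Proof.
rewrite projE actE /=; congr pair.
by rewrite (linear_fun0 (lmul_linearr a)) add0r.
Qed.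

Lemma proj_dominated (b : bool) s : dominated W proj (b, s) (false, s) proj_const.
Proof.
have d0 := rnorm_ge0 d; have p0 : 0 <= proj_const by rewrite addr_ge0.
apply: dominated_intro => //.
  apply: (@le_trans _ _ 1); last by rewrite lerDl.
  by apply: blin_norm_le => // g; exact: proj_bound.
move=> _ /orbitsP[x xs [[nu nu1 <-]|[jT [a a1 <-]]]]; left; exists x => //.
  by exists nu => //; apply: le_trans nu1 _; rewrite lerDl.
exists (d a); last exact: proj_act.
apply: le_trans (ler_blin _ _) _; apply: (@le_trans _ _ (rnorm d)).
  by rewrite ler_piMr.
by rewrite lerDr.
Qed.

Lemma incl_dominated (b b' : bool) (s s' : seq F) : (b -> b') -> {subset s <= s'} ->
  dominated W (blin_id G) (b, s) (b', s') 1.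
Proof.
move=> bb ss; apply: dominated_intro => //.
  by apply: blin_norm_le => // g; rewrite mul1r.
move=> w /in_ball1[[x xs xw]|[bT [x xs xw]]].
  by left; exists x => //; exact: ss.
by right; split; [exact: bb|exists x => //; exact: ss].
Qed.

(** This right action commutes with the twisted left action. *)
Section right_translation.
Variable a : A.

Let right_linear : linear (fun g : G => (rmul a g.1, ract F a g.2) : G).
Proof.
by move=> k g h; congr pair; [exact: rmul_linearr|exact: (blin_linear (ract F a))].
Qed.

Let right_bound : exists M : R, forall g : G,
  rnorm ((rmul a g.1, ract F a g.2) : G) <= M * rnorm g.
Proof.
have ra := rnorm_ge0 (ract F a); have a0 := rnorm_ge0 a.
exists (rnorm a + rnorm (ract F a)) => g; have g0 := rnorm_ge0 g.
rewrite mulrDl rnorm_pair_le /=; apply/andP; split.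
  apply: le_trans (rnorm_rmul _ _) _; apply: (@le_trans _ _ (rnorm a * rnorm g)).
    by rewrite ler_wpM2l// rnorm_fst.
  by rewrite lerDl mulr_ge0.
apply: le_trans (ler_blin _ _) _; apply: (@le_trans _ _ (rnorm (ract F a) * rnorm g)).
  by rewrite ler_wpM2l// rnorm_snd.
by rewrite lerDr mulr_ge0.
Qed.

Definition right : blin G G := mkblin right_linear right_bound.

Lemma rightE g : right g = (rmul a g.1, ract F a g.2). Proof. by []. Qed.

Lemma right_coef nu x : right (coef nu x, 0) = (coef nu (ract F a x), 0).
Proof.
rewrite rightE /=; congr pair; last exact: linear0.
by apply: predual_ext => b; rewrite rmulE !coefE ractM.
Qed.

Lemma right_act b g : right (act b g) = act b (right g).
Proof.
rewrite !rightE !actE /=; congr pair; last by rewrite lractA.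
apply: predual_ext => c; rewrite linearD /= !(rmulE, lmulE, coefE).
rewrite linearD /= !(rmulE, lmulE, coefE) bmulA ractM.
by [].
Qed.

Lemma right_dominated (b : bool) x :
  dominated W right (b, [:: x]) (b, [:: ract F a x]) (1 + rnorm right).
Proof.
have r0 := rnorm_ge0 right.
apply: dominated_intro; rewrite ?addr_ge0 ?lerDr//.
move=> _ /orbitsP[_ /[!inE] /eqP -> [[nu nu1 <-]|[jT [c c1 <-]]]].
  left; exists (ract F a x); first by rewrite inE.
  exists nu; last exact: right_coef.
  by apply: le_trans nu1 _; rewrite lerDl.
right; split=> //; exists (ract F a x); first by rewrite inE.
exists c; first by apply: le_trans c1 _; rewrite lerDl.
rewrite right_act rightE /=; congr (act c (_, _)).
exact: (linear_fun0 (rmul_linearr a)).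
Qed.

End right_translation.

(** Without orbits, the set of the coordinate lies in the first summand, and so does
    its closed span. *)
Lemma coef_coord_snd (u : interp W) s : (hsval u (false, s)).2 = 0.
Proof.
apply: dual_separates => nu; rewrite linear0.
have lin : linear (fun g : G => nu g.2 : R[i]^o).
  by move=> k g h; rewrite -(blin_linear nu).
have bnd : exists M : R, forall g : G, rnorm (nu g.2) <= M * rnorm g.
  exists (rnorm nu) => g; apply: le_trans (ler_blin _ _) _.
  by rewrite ler_wpM2l ?rnorm_ge0// rnorm_snd.
apply: (@gauge_vanish R G (W (false, s)) _ (mkblin lin bnd) (rnorm u)).
  by move=> n; exact: gauge_le_rnorm.
move=> w /orbitsP[x xs [[nu' _ <-]|[]//]].
exact: linear0.
Qed.

Lemma proj_coef_coord (u : interp W) s :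
  proj (hsval u (false, s)) = hsval u (false, s).
Proof. by rewrite projE -{1}(coef_coord_snd u s); case: (hsval u (false, s)). Qed.

Local Notation E := (interp W).
Local Notation rep := (diag_rep dom_const_ge0 act_dominated).

Lemma expectation_exists : exists Q : blin (blin E E) (blin E E),
  quasi_expectation (range rep) Q.
Proof.
apply: (@injective_interp R A e _ _ _ act) => //.
- exact: (actM normalF der).
- exact: (act_normal normalF d_normal).
- exact: act_unit.
- by apply: pair_seq_complete; exact: seq_complete_of_complete.
- by move=> i; exact: (orbits_compact d_normal).
Qed.

Section with_expectation.
Variable Q : blin (blin E E) (blin E E).
Hypothesis qeQ : quasi_expectation (range rep) Q.

Let tproj (b : bool) s := transfer (proj_dominated b s).
Let incl (b b' : bool) s s' bb ss := transfer (@incl_dominated b b' s s' bb ss).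

Let incl_commutant (b b' : bool) s s' bb ss :
  commutant (range rep) (@incl b b' s s' bb ss).
Proof. exact: transfer_commutant. Qed.

Let right_commutant a (b : bool) x :
  commutant (range rep) (transfer (right_dominated a b x)).
Proof. by apply: transfer_commutant => c g; exact: right_act. Qed.

Let unit_val g : R[i]^o := predual_map e g.1.

(** The transfer tproj through the projection goes to a coordinate in the first
    summand. Its average Q (tproj true s) is a module map; as all commutant elements
    used below are transfers, it is compatible with them, and the element g of G alone
    determines its value. *)
Definition mean s g : R[i]^o :=
  unit_val (hsval (Q (tproj true s) (embed W (true, s) g)) (false, s)).

Let unit_val_lin (k : R[i]) g h :
  unit_val (k *: g + h) = k *: unit_val g + unit_val h.
Proof. exact: (blin_linear (predual_map e)). Qed.

Lemma mean_lin s (k : R[i]) g h : admissible W (true, s) g ->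
  admissible W (true, s) h -> mean s (k *: g + h) = k *: mean s g + mean s h.
Proof.
move=> ag ah; rewrite /mean embed_lin// (blin_linear (Q _)) hsval_linE.
exact: unit_val_lin.
Qed.

(** The bimodule property of Q in the form of commuting squares: the horizontal maps
    c and c' will be inclusions between coordinates or right translations. *)
Lemma expectation_square (u u' : blin E E) (c c' : blin E E) :
  commutant (range rep) c -> commutant (range rep) c' ->
  c \oB u = u' \oB c' -> forall v : E, c (Q u v) = Q u' (c' v).
Proof.
move=> Kc Kc' cu v.
have h : c \oB Q u = Q u' \oB c'.
  by rewrite -(expectation_left qeQ)// cu (expectation_right qeQ).
exact: (congr1 (fun f : blin E E => f v) h).
Qed.

Lemma mean_incl s s' g : {subset s <= s'} -> admissible W (true, s) g ->
  mean s g = mean s' g.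
Proof.
move=> ss ag; pose c := @incl false false s s' id ss.
pose c' := @incl true true s s' id ss.
have cc : c \oB tproj true s = tproj true s' \oB c' by exact: transfer_square.
have := expectation_square (@incl_commutant _ _ _ _ _ _) (@incl_commutant _ _ _ _ _ _) cc (embed W (true, s) g).
rewrite (transfer_embed _ ag) => /(congr1 (fun v : E => hsval v (false, s'))).
rewrite [LHS](_ : _ = single (false, s') (hsval (Q (tproj true s) (embed W (true, s) g)) (false, s)) (false, s'))//.
by rewrite single_self /mean => ->.
Qed.

Lemma mean_right a x g : admissible W (true, [:: x]) g ->
  mean [:: ract F a x] (right a g) =
  unit_val (right a (hsval (Q (tproj true [:: x]) (embed W (true, [:: x]) g)) (false, [:: x]))).
Proof.
move=> ag; pose c := transfer (right_dominated a false x).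
pose c' := transfer (right_dominated a true x).
have cc : c \oB tproj true [:: x] = tproj true [:: ract F a x] \oB c'.
  apply: transfer_square => u; rewrite !projE !rightE /=; congr pair.
  by rewrite linear0.
have := expectation_square (right_commutant _ _ _) (right_commutant _ _ _) cc
  (embed W (true, [:: x]) g).
rewrite (transfer_embed _ ag) => /(congr1 (fun v : E => hsval v (false, [:: ract F a x]))).
rewrite [LHS](_ : _ = single (false, [:: ract F a x]) (right a (hsval (Q (tproj true [:: x])
  (embed W (true, [:: x]) g)) (false, [:: x]))) (false, [:: ract F a x]))//.
by rewrite single_self /mean => ->.
Qed.

(** On elements (coef nu x, 0) the projection coincides with an inclusion, and
    inclusions are in the commutant and fixed by Q. *)
Lemma mean_coef s x nu : x \in s -> mean s (coef nu x, 0) = nu (ract F e x).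
Proof.
move=> xs; have ag : admissible W (false, s) (coef nu x, 0).
  by apply: (@in_ball_admissible (rnorm nu)); left; exists x => //; exists nu.
have tf : false -> true by [].
pose c := @incl false false s s id (fun _ h => h).
pose c' := @incl false true s s tf (fun _ h => h).
have cc : c \oB c = tproj true s \oB c'.
  by apply: transfer_square => u; rewrite -[RHS]/(proj (hsval u (false, s))) proj_coef_coord.
have h := expectation_square (@incl_commutant _ _ _ _ _ _) (@incl_commutant _ _ _ _ _ _) cc (embed W (false, s) (coef nu x, 0)).
move: h; rewrite (expectation_fix qeQ); last exact: incl_commutant.
rewrite !(transfer_embed _ ag) => /(congr1 (fun v : E => hsval v (false, s))).
rewrite embedE// single_self => h.
by rewrite /mean -h /unit_val /= coefE.
Qed.

Lemma mean_act s a g : admissible W (true, s) g ->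
  mean s (act a g) =
  unit_val (act a (hsval (Q (tproj true s) (embed W (true, s) g)) (false, s))).
Proof.
move=> ag; have aag := admissible_dominated (act_dominated a (true, s)) ag.
have KQ : rep a \oB Q (tproj true s) = Q (tproj true s) \oB rep a.
  by apply: esym; apply: (expectation_commutant qeQ); exists a.
have := congr1 (fun f : blin E E => hsval (f (embed W (true, s) g)) (false, s)) KQ.
rewrite [LHS](_ : _ = act a (hsval (Q (tproj true s) (embed W (true, s) g)) (false, s)))//.
move=> ->; rewrite /mean; congr (unit_val (hsval (Q (tproj true s) _) _)).
apply: hsval_ext => i; rewrite diag_repE !embedE// /single.
by case: ifP => // _; rewrite linear0.
Qed.

Definition mean_fun x : R[i]^o := mean [:: x] (0, x).

Lemma orbit_vector x s : lact F e x = x -> x \in s ->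
  in_ball 1 (true, s) (0, x).
Proof.
move=> ex xs; right; split=> //; exists x => //; exists e.
  by have [_ _ e1] := he; rewrite -lecR -rnormE e1.
rewrite actE /= d_unit ex; congr pair.
by rewrite (linear_fun0 (lmul_linearr e)) (linear_fun0 (coef_linearl normalF x)) addr0.
Qed.

Lemma mean_funE x s : lact F e x = x -> x \in s -> mean s (0, x) = mean_fun x.
Proof.
move=> ex xs; apply: esym; apply: mean_incl.
  by move=> y; rewrite inE => /eqP ->.
by apply: (@in_ball_admissible 1); apply: orbit_vector; rewrite ?inE.
Qed.

(** Each of the three vectors has its own coordinate; all three are compared in the
    coordinate of their union. *)
Lemma mean_fun_lin (k : R[i]) x x' : lact F e x = x -> lact F e x' = x' ->
  mean_fun (k *: x + x') = k *: mean_fun x + mean_fun x'.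
Proof.
move=> ex ex'; pose s := [:: x; x'; k *: x + x'].
have exx : lact F e (k *: x + x') = k *: x + x'.
  by rewrite (blin_linear (lact F e)) ex ex'.
rewrite -(@mean_funE _ s exx) -?(@mean_funE _ s ex) -?(@mean_funE _ s ex')
  ?inE ?eqxx ?orbT//.
have -> : (0, k *: x + x') = k *: (0, x) + (0, x') :> G.
  by congr pair; rewrite /= scaler0 addr0.
rewrite mean_lin//; apply: (@in_ball_admissible 1); apply: orbit_vector;
  by rewrite ?inE ?eqxx ?orbT.
Qed.

(** The constant is uniform in x as the spaces of all coordinates are part of one
    sum, with one Q. *)
Lemma mean_fun_bounded : exists M : R, forall x, lact F e x = x -> rnorm x <= 1 ->
  rnorm (mean_fun x) <= M.
Proof.
have r0 := rnorm_ge0 (ract F).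
pose t : R := 1 + rnorm (ract F).
have t0 : 0 <= t by rewrite addr_ge0.
have e1 : rnorm e = 1.
  have [_ _ e1] := he; apply: (@complexI R); rewrite -rnormE e1.
  by rewrite rmorph1.
have lin : linear unit_val by move=> k g h; exact: unit_val_lin.
have bnd g : rnorm (unit_val g) <= 1 * rnorm g.
  rewrite mul1r; apply: le_trans (ler_predual_map _ _) _; rewrite e1 mul1r.
  exact: rnorm_fst.
pose y : dual G := mkblin lin (ex_intro _ 1 bnd).
exists (t * (rnorm Q * proj_const * 2)) => x ex x1.
set u := Q (tproj true [:: x]) (embed W (true, [:: x]) (0, x)).
have hu : rnorm u <= rnorm Q * proj_const * 2.
  apply: le_trans (ler_blin _ _) _; apply: ler_pM; rewrite ?rnorm_ge0//.
    apply: le_trans (ler_blin _ _) _; rewrite ler_wpM2l ?rnorm_ge0//.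
    exact: rnorm_transfer.
  rewrite -[leRHS]mulr1; apply: rnorm_embed => n; apply: in_ball_gauge.
  by apply: orbit_vector; rewrite ?inE.
apply: (@le_trans _ _ (t * gauge (W (false, [:: x])) 0 (hsval u (false, [:: x])))).
  apply: (@gauge_dual R G _ 0 y) => //.
    rewrite expr0 mulr1; apply: (@le_trans _ _ 1); last by rewrite lerDl.
    by apply: blin_norm_le.
  rewrite expr0 invr1 mulr1 => w /orbitsP[x' /[!inE] /eqP -> [[nu nu1 <-]|[]//]].
  rewrite [X in rnorm X](_ : _ = predual_map e (coef nu x))// coefE.
  apply: le_trans (ler_blin nu _) _; apply: (@le_trans _ _ (rnorm (ract F e x))).
    by rewrite ler_piMl ?rnorm_ge0.
  apply: le_trans (ler_blin _ _) _; apply: (@le_trans _ _ (rnorm (ract F e))).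
    by rewrite ler_piMr ?rnorm_ge0.
  apply: le_trans (ler_blin _ _) _; rewrite e1 mulr1.
  by rewrite lerDr.
by rewrite ler_wpM2l//; apply: le_trans hu; exact: gauge_le_rnorm.
Qed.

(** Moving a from the right to the left uses that the averaged projection of (0, x)
    lies in the first summand, where evaluation at e of the right and the left
    translate agree. Then a . (0, x) = (<. d(a), x>, 0) + (0, a . x), and the average
    of the first term is the term itself. *)
Lemma mean_fun_derivation a x : lact F e x = x -> ract F e x = x ->
  mean_fun (ract F a x) - mean_fun (lact F a x) = d a x.
Proof.
move=> ex xe.
have ag : admissible W (true, [:: x]) (0, x).
  by apply: (@in_ball_admissible 1); apply: orbit_vector; rewrite ?inE.
have -> : mean_fun (ract F a x) = mean [:: x] (act a (0, x)).
  have -> : mean_fun (ract F a x) = mean [:: ract F a x] (right a (0, x)).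
    rewrite /mean_fun rightE /=; congr (mean _ (_, _)).
    by rewrite (linear_fun0 (rmul_linearr a)).
  rewrite mean_right// mean_act//; set g := hsval _ _.
  rewrite /unit_val rightE actE /= coef_coord_snd linearD /= rmulE lmulE eM Me.
  by rewrite (linear_fun0 (coef_linearr normalF (d a))) linear0 addr0.
pose s := [:: x; lact F a x].
have eax : lact F e (lact F a x) = lact F a x by rewrite -lactM eM.
rewrite (@mean_incl [:: x] s); last 2 first.
- by move=> x'; rewrite !inE => ->.
- exact: admissible_dominated (act_dominated a _) ag.
have -> : act a (0, x) = 1 *: (coef (d a) x, 0) + (0, lact F a x).
  rewrite actE /= scale1r; congr pair; rewrite /= ?addr0 ?add0r//.
  by rewrite (linear_fun0 (lmul_linearr a)) add0r.
rewrite mean_lin; last 2 first.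
- apply: (@in_ball_admissible (rnorm (d a))); left; exists x; first by rewrite inE eqxx.
  by exists (d a).
- by apply: (@in_ball_admissible 1); apply: orbit_vector; rewrite ?inE ?eqxx ?orbT.
rewrite scale1r mean_coef ?inE ?eqxx// xe mean_funE ?inE ?eqxx ?orbT//.
by rewrite addrK.
Qed.

End with_expectation.
End implementing_functional.

(** * Injective algebras are Connes-amenable *)

Lemma is_derivationI (R : realType) (A : banachAlg R) (F : banachBimodule A)
    (d : blin A (dual F)) :
  (forall a b x, d (a *b b) x = d b (ract F a x) + d a (lact F b x)) ->
  is_derivation d.
Proof. by move=> h a b; apply: blinP => x; rewrite h. Qed.

Lemma is_innerP (R : realType) (A : banachAlg R) (F : banachBimodule A)
    (d : blin A (dual F)) :
  is_inner d <-> exists mu : dual F, forall a x,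
    d a x = mu (ract F a x) - mu (lact F a x).
Proof.
split=> -[mu muE]; exists mu => a; first by move=> x; rewrite muE.
by apply: blinP => x; rewrite muE.
Qed.

Section injective_connes_amenable.
Variables (R : realType) (A : dualBanachAlg R) (e : A).
Hypothesis he : is_unit e.
Variable F : banachBimodule A.
Hypothesis normalF : normal_dual F.
Hypothesis inj : injective_dba e.
Implicit Types (a b : A) (x : F).

Let eM a : e *b a = a. Proof. by case: he. Qed.
Let Me a : a *b e = a. Proof. by case: he. Qed.

(** The vector (0, x) is in its own orbit when x = e . x, so the mean is used on
    e F e only; since d e = 0, the derivation takes its values in e F' e and nothing
    is lost by composing with x |-> e . x . e. *)
Lemma derivation_inner0 (d : blin A (dual F)) : is_derivation d ->
  (forall x, normal_functional (fun a => d a x)) -> d e = 0 -> is_inner d.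
Proof.
move=> der d_normal d_unit.
have [Q qeQ] := expectation_exists he normalF der d_normal inj.
pose m := mean_fun e Q.
have m_lin := mean_fun_lin he d_unit qeQ.
have [M mM] := mean_fun_bounded he d_unit Q.
have m_der := mean_fun_derivation he d_unit qeQ.
pose p x : F := lact F e (ract F e x).
have ep x : lact F e (p x) = p x by rewrite /p -lactM eM.
have pe x : ract F e (p x) = p x by rewrite /p lractA -ractM eM.
have lp : linear p.
  by move=> k x x'; rewrite /p (blin_linear (ract F e)) (blin_linear (lact F e)).
have lm : linear (fun x => m (p x) : R[i]^o).
  by move=> k x x'; rewrite lp; exact: m_lin.
have m0 : m 0 = 0.
  have := m_lin (-1) 0 0; rewrite (linear_fun0 (blin_linear (lact F e))) => /(_ erefl erefl).
  by rewrite scaleN1r oppr0 addr0 scaleN1r addNr.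
have M0 : 0 <= M.
  apply: le_trans (mM 0 _ _); rewrite ?rnorm_ge0 ?rnorm0//.
  exact: linear0.
have mp y : lact F e y = y -> rnorm (m y) <= M * rnorm y.
  move=> ey; have [->|y0] := eqVneq y 0; first by rewrite m0 !rnorm0 mulr0.
  have ry : 0 < rnorm y by rewrite rnorm_gt0.
  pose k : R[i] := ((rnorm y)^-1)%:C.
  have mk : m (k *: y) = k *: m y.
    have := m_lin k y 0; rewrite (linear_fun0 (blin_linear (lact F e))) => /(_ ey erefl).
    by rewrite addr0 => h; rewrite /m h -/m m0 addr0.
  have := mM (k *: y); rewrite (linear_funZ (blin_linear (lact F e))) ey => /(_ erefl).
  rewrite -/m mk !rnormZ rnormC gtr0_norm ?invr_gt0// mulVf ?gt_eqF// => /(_ (lexx _)).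
  by rewrite ler_pdivrMl// mulrC.
have bm : exists N : R, forall x, rnorm (m (p x)) <= N * rnorm x.
  exists (M * (rnorm (lact F e) * rnorm (ract F e))) => x.
  apply: le_trans (mp _ (ep x)) _; rewrite -mulrA ler_wpM2l//.
  apply: le_trans (ler_blin _ _) _; rewrite -mulrA ler_wpM2l ?rnorm_ge0//.
  exact: ler_blin.
apply/is_innerP; exists (mkblin lm bm : dual F) => a x.
apply: (@etrans _ _ (m (p (ract F a x)) - m (p (lact F a x)))); last by [].
have -> : p (ract F a x) = ract F a (p x).
  by rewrite /p lractA -!ractM eM Me.
have -> : p (lact F a x) = lact F a (p x).
  by rewrite /p lractA -!lactM eM Me.
rewrite m_der//; apply: esym.
have dl y : d a (ract F e y) = d a y.
  by have := derE der e a y; rewrite eM d_unit blin0E addr0 => <-.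
have dr y : d a (lact F e y) = d a y.
  by have := derE der a e y; rewrite Me d_unit blin0E add0r => <-.
by rewrite /p dr dl.
Qed.

Section inner_part.
Variable mu : dual F.

Let inner_linearr a : linear (fun x => mu (ract F a x) - mu (lact F a x) : R[i]^o).
Proof.
move=> k x x'; rewrite (blin_linear (ract F a)) (blin_linear (lact F a)).
by rewrite !(blin_linear mu) opprD addrACA scalerBr.
Qed.

Let inner_linearl x : linear (fun a => mu (ract F a x) - mu (lact F a x) : R[i]^o).
Proof.
move=> k a b; rewrite (blin_linear (ract F)) (blin_linear (lact F)) !blin_linE.
by rewrite !(blin_linear mu) opprD addrACA scalerBr.
Qed.

Let inner_bound a x : rnorm (mu (ract F a x) - mu (lact F a x) : R[i]^o) <=
  rnorm mu * (rnorm (ract F) + rnorm (lact F)) * rnorm a * rnorm x.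
Proof.
have h (T : blin A (blin F F)) : rnorm (mu (T a x)) <= rnorm mu * rnorm T * rnorm a * rnorm x.
  rewrite -!mulrA; apply: le_trans (ler_blin mu _) _; rewrite ler_wpM2l ?rnorm_ge0//.
  apply: le_trans (ler_blin (T a) x) _; rewrite mulrA ler_wpM2r ?rnorm_ge0//.
  exact: ler_blin.
apply: le_trans (ler_rnormD _ _) _; rewrite rnormN mulrDr !mulrDl.
by apply: lerD; exact: h.
Qed.

Definition inner : blin A (dual F) := mkblin2 inner_linearr inner_linearl inner_bound.

Lemma innerE a x : inner a x = mu (ract F a x) - mu (lact F a x).
Proof. by []. Qed.

Lemma inner_derivation : is_derivation inner.
Proof.
apply: is_derivationI => a b x; rewrite !innerE.
by rewrite ractM lactM lractA addrA subrK.
Qed.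

End inner_part.

(** From d(e) = e . d(e) + d(e) . e one gets e . d(e) . e = 0, and then
    mu = e . d(e) - d(e) . e satisfies e . mu - mu . e = d(e); subtracting the inner
    derivation of mu reduces to the case d e = 0. *)
Lemma derivation_inner (d : blin A (dual F)) : is_derivation d ->
  (forall x, normal_functional (fun a => d a x)) -> is_inner d.
Proof.
move=> der d_normal.
pose mu : dual F := dual_lact e (d e) - dual_ract (d e) e.
have muE x : mu x = d e (ract F e x) - d e (lact F e x) by [].
have dee x : d e x = d e (ract F e x) + d e (lact F e x).
  by rewrite -(derE der) eM.
have ede x : d e (ract F e (lact F e x)) = 0.
  have := dee (ract F e (lact F e x)).
  rewrite -ractM eM lractA -lactM eM => /eqP.
  by rewrite addrC -subr_eq subrr eq_sym => /eqP.
have dE a x : (d - inner mu : blin A (dual F)) a x = d a x - inner mu a x by [].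
have /is_innerP[nu nuE] : is_inner (d - inner mu : blin A (dual F)).
  apply: derivation_inner0.
  - apply: is_derivationI => a b x; rewrite !dE.
    rewrite (derE der) (derE (inner_derivation mu)).
    rewrite opprD addrACA; exact: erefl.
  - move=> x; have [z zE] := normal_linear (-1) (normal_ract normalF mu x) (d_normal x).
    have [z' z'E] := normal_add (ex_intro _ z zE) (normal_lact normalF mu x).
    exists z' => a; rewrite -z'E dE innerE scaleN1r opprB.
    by rewrite addrA addrAC [_ + d a x]addrC.
  - apply: blinP => x; rewrite dE blin0E innerE !muE.
    have ede' : d e (lact F e (ract F e x)) = 0 by rewrite -lractA.
    by rewrite -ractM -lactM eM ede ede' subr0 sub0r opprK -dee subrr.
clearbody mu; apply/is_innerP; exists (nu + mu) => a x.
have := nuE a x; rewrite dE innerE => /eqP; rewrite subr_eq => /eqP ->.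
by rewrite !blinDE opprD addrACA.
Qed.

End injective_connes_amenable.

Theorem theorem6p13 (R : realType) (A : dualBanachAlg R) (e : A)
    (he : is_unit e) :
  connes_amenable A <-> injective_dba e.
Proof.
split; first exact: connes_amenable_injective.
move=> inj F normalF d der cd; apply: (derivation_inner he normalF inj der).
have lin x : linear (fun a => dual_pairing (d a) x).
  by move=> k a b; rewrite /dual_pairing (blin_linear d).
exact: (proj1 (wstar_normal lin) cd).
Qed.
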